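(* Let $\mathbb{K}$, $\mathbf{p}$, $R$, $N$ be as in the context, and let $f:\mathbb{K}^2\to\mathbb{C}$ be Schwartz–Bruhat with Fourier support in $\mathcal{N}_{R^{-1}}(\mathbb{P}^1)$. Then for every $\alpha>0$, \[ \alpha^4\mu\big(\{x\in\mathbb{K}^2:|f(x)|>\alpha\}\big)\leq 13\,\mathbf{p}^{12}(\log R)^{10}\sum_{\substack{s\in\mathbf{p}^{\mathbb{Z}}\\ R^{-1/2}\leq s\leq 1}}\ \sum_{\substack{\tau\\ \mathrm{diam}(\tau)=s}}\ \sum_{U\in\mathcal{G}_\tau}\mu(U)\Big(\frac{1}{\mu(U)}\int_U\sum_{\theta\prec\tau}|f_\theta|^2\Big)^2 . \]
   Context: $\mathbb{K}$ is a non-Archimedean local field with $\mathrm{char}(\mathbb{K})\neq2$, absolute value $|\cdot|$ normalized to be the modular function, $\mathcal{O}=\{|x|\leq1\}$, $\varpi$ a uniformizer; $\eta$ is the least positive integer with $\mathbf{p}:=|\varpi|^{-\eta}\geq|2|^{-1}$. $R\in\mathbf{p}^{2\mathbb{N}}$, $N=\frac12\log_{\mathbf{p}}R$; $\log$ is natural log. $\mu$ is Haar measure on $\mathbb{K}^2$; $|x|=\max(|x_1|,|x_2|)$ on $\mathbb{K}^2$. Fourier transform $\hat f(\xi)=\int e(x\cdot\xi)f(x)d\mu(x)$ with $e$ an additive character trivial on $\mathcal{O}$, nontrivial on $\varpi^{-1}\mathcal{O}$; Schwartz–Bruhat = finite linear combination of indicators of balls; $f_A$ is the Fourier projection of $f$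 onto $A$. $\mathcal{N}_{R^{-1}}(\mathbb{P}^1)=\{(x,y):|x|\leq1,|y-x^2|\leq R^{-1}\}$. For a closed ball $I\subseteq\mathcal{O}$ of radius $s$, the cap above $I$ is $\tau_I=\{(x,y):x\in I,\ |y-x^2|\leq s^2\}$, of diameter $s$; caps of diameter $R^{-1/2}$ are denoted $\theta$; $\theta\prec\tau$ means $\theta=\tau_J,\tau=\tau_I$ with $J\subseteq I$. For a cap $\tau$ of diameter $s$, $\#\tau$ denotes the number of caps of diameter $s$ with $f_\tau\not\equiv0$. For such $\tau$, pick $c$ with $(c,c^2)\in\tau$ and let $U_\tau^0=\{(x_1,x_2)\in\mathbb{K}^2:|x_1+2cx_2|\leq sR,\ |x_2|\leq R\}$ (a rectangle of dimensions $R\times sR$ centered at $0$ whose long side points along the normal direction to $\mathbb{P}^1$ at $(c,c^2)$); the tiles are the translates of $U_\tau^0$. $\mathcal{G}_\tau$ is the set of such tiles $U$ satisfying $\frac{e^2}{2}\frac{(\log R)^2}{(\log\mathbf{p})^2}\frac{1}{\mu(U)}\int_U\sum_{\theta\prec\tau}|f_\theta|^2\geq\frac{\alpha^2}{(\#\tau)^2}$. *)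

(* Defs.v *)
From HB Require Import structures.
From mathcomp Require Import all_boot all_order all_algebra.
From mathcomp Require Import all_classical all_reals all_analysis.
From mathcomp.real_closed Require Import complex.
Import Order.TTheory GRing.Theory Num.Theory.

Set Implicit Arguments.
Unset Strict Implicit.
Unset Printing Implicit Defensive.

Local Open Scope classical_set_scope.
Local Open Scope ring_scope.

(* The plane K^2 (as a pointed choice type, so that it can carry a sigma-algebra). *)
Definition K2 (K : fieldType) := (K * K)%type.
HB.instance Definition _ (K : fieldType) := Choice.on (K2 K).
HB.instance Definition _ (K : fieldType) := isPointed.Build (K2 K) (0, 0).

Section Defs.
Context {R : realType} {K : fieldType}.
Variable absv : K -> R.

Definition is_nonarch_abs : Prop :=
  [/\ forall x, absv x = 0 <-> x = 0,
      forall x, 0 <= absv x,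
      forall x y, absv (x * y) = absv x * absv y &
      forall x y, absv (x + y) <= Num.max (absv x) (absv y)].

Definition is_uniformizer (w : K) : Prop :=
  0 < absv w < 1 /\ forall x, absv x < 1 -> absv x <= absv w.

(* K is a non-Archimedean local field: complete for a discrete absolute value
   with finite residue field; absv is normalized (|w| = 1/q, q = #residue field),
   i.e. it is the modular function. *)
Definition nonarch_local_field (w : K) : Prop :=
  [/\ is_nonarch_abs,
      is_uniformizer w,
      (forall x, x != 0 -> exists k : int, absv x = absv w ^ k),
      (* finite residue field O/wO, with q = size reps elements, and |w| = q^-1 *)
      (exists reps : seq K,
          [/\ forall r, r \in reps -> absv r <= 1,
              forall i j, (i < size reps)%N -> (j < size reps)%N -> i != j ->
                1 <= absv (nth 0 reps i - nth 0 reps j),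
              forall x, absv x <= 1 -> exists2 r, r \in reps & absv (x - r) < 1 &
              absv w = ((size reps)%:R)^-1]) &
      (forall u : nat -> K,
          (forall eps : R, 0 < eps -> exists M : nat, forall m n : nat,
              (M <= m)%N -> (M <= n)%N -> absv (u m - u n) < eps) ->
          exists l : K, forall eps : R, 0 < eps -> exists M : nat, forall n : nat,
              (M <= n)%N -> absv (u n - l) < eps)].

Definition sub2 (x y : K2 K) : K2 K := (x.1 - y.1, x.2 - y.2).
Definition abs2 (x : K2 K) : R := Num.max (absv x.1) (absv x.2).
Definition dot2 (x y : K2 K) : K := x.1 * y.1 + x.2 * y.2.

Definition ballK (c : K) (r : R) : set K := [set x | absv (x - c) <= r].
Definition ball2 (c : K2 K) (r : R) : set (K2 K) := [set x | abs2 (sub2 x c) <= r].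
Definition balls2 : set (set (K2 K)) :=
  [set B | exists c r, 0 < r /\ B = ball2 c r].
Definition O2 : set (K2 K) := ball2 (0, 0) 1.

Definition translate (a : K2 K) (A : set (K2 K)) : set (K2 K) :=
  [set x | A (sub2 x a)].

Definition indic2 (A : set (K2 K)) (x : K2 K) : R[i] :=
  if `[< A x >] then 1 else 0.

Definition schwartz_bruhat (f : K2 K -> R[i]) : Prop :=
  exists l : seq (R[i] * K2 K * R),
    (forall t, t \in l -> 0 < t.2) /\
    forall x, f x = \sum_(t <- l) t.1.1 * indic2 (ball2 t.1.2 t.2) x.

Definition std_character (w : K) (ch : K -> R[i]) : Prop :=
  [/\ forall x y, ch (x + y) = ch x * ch y,
      forall x, ComplexField.Normc.normc (ch x) = 1,
      forall x, absv x <= 1 -> ch x = 1 &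
      exists x, absv x <= (absv w)^-1 /\ ch x != 1].

Section Measure.
Variable mu : {measure set (g_sigma_algebraType balls2) -> \bar R}.

Definition haar_normalized : Prop :=
  (forall (a : K2 K) (A : set (g_sigma_algebraType balls2)),
      measurable A -> mu (translate a A) = mu A) /\
  mu O2 = 1%E.

Definition Cint (D : set (K2 K)) (g : K2 K -> R[i]) : R[i] :=
  Complex (Rintegral mu D (fun x => complex.Re (g x)))
          (Rintegral mu D (fun x => complex.Im (g x))).

Variable ch : K -> R[i].

Definition fourier (f : K2 K -> R[i]) (xi : K2 K) : R[i] :=
  Cint setT (fun x => ch (dot2 x xi) * f x).

Definition fproj (f : K2 K -> R[i]) (A : set (K2 K)) (x : K2 K) : R[i] :=
  Cint setT (fun xi => fourier f xi * indic2 A xi * ch (- dot2 x xi)).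

Definition nbhd_parabola (Rr : R) : set (K2 K) :=
  [set xi | absv xi.1 <= 1 /\ absv (xi.2 - xi.1 ^+ 2) <= Rr^-1].

Definition cap (c : K) (s : R) : set (K2 K) :=
  [set xi | absv (xi.1 - c) <= s /\ absv (xi.2 - xi.1 ^+ 2) <= s ^+ 2].

Definition caps (s : R) : set (set (K2 K)) :=
  [set tau | exists c, ballK c s `<=` ballK 0 1 /\ tau = cap c s].

Definition cap_prec (r s : R) (theta tau : set (K2 K)) : Prop :=
  exists cJ cI, [/\ theta = cap cJ r, tau = cap cI s & ballK cJ r `<=` ballK cI s].

Definition tile0 (c : K) (s Rr : R) : set (K2 K) :=
  [set x | absv (x.1 + 2%:R * c * x.2) <= s * Rr /\ absv x.2 <= Rr].
Definition tiles (s Rr : R) (tau : set (K2 K)) : set (set (K2 K)) :=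
  [set U | exists c a, tau (c, c ^+ 2) /\ U = translate a (tile0 c s Rr)].

Variable f : K2 K -> R[i].

Definition ncaps (s : R) : R :=
  (\sum_(tau \in [set tau | caps s tau /\ exists x, fproj f tau x != 0]) (1 : R))%R.

Definition sqfun (r s : R) (tau : set (K2 K)) (x : K2 K) : R :=
  (\sum_(theta \in [set theta | caps r theta /\ cap_prec r s theta tau])
      ComplexField.Normc.normc (fproj f theta x) ^+ 2)%R.

Definition avg (U : set (K2 K)) (g : K2 K -> R) : R :=
  (fine (mu U))^-1 * Rintegral mu U g.

(* G_tau.  p : the number bold-p, Rr : the scale R, r = R^{-1/2} : diameter of the caps theta,
   s : diameter of tau *)
Definition good_tiles (p Rr r alpha s : R) (tau : set (K2 K)) : set (set (K2 K)) :=
  [set U | tiles s Rr tau U /\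
     alpha ^+ 2 / (ncaps s) ^+ 2 <=
     (expR 1) ^+ 2 / 2 * (ln Rr) ^+ 2 / (ln p) ^+ 2 * avg U (sqfun r s tau)].

End Measure.
End Defs.

(* Main.v *)
Require Import Defs.
From HB Require Import structures.
From mathcomp Require Import all_boot all_order all_algebra.
From mathcomp Require Import all_classical all_reals all_analysis.
From mathcomp Require Import measurable_realfun.
From mathcomp Require Import ring lra zify.
From mathcomp.real_closed Require Import complex.
Import Order.TTheory GRing.Theory Num.Theory.
Local Open Scope classical_set_scope.
Local Open Scope ring_scope.

Set Implicit Arguments.
Unset Strict Implicit.
Unset Printing Implicit Defensive.
Import ComplexField.Normc.

(* Let [F c] be the projection of [f] to the cap [theta] above [c].  A multiplicative form of
   Fourier support is enough throughout: [F c (x + a)] is a character in [a] times [F c x] for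
   [a] in the dual tile, so a sum over all points vanishes as soon as some translation
   multiplies the summand by a nontrivial constant.  Since [f] is a step function supported in
   a ball, every integral is a finite sum over representatives of cosets of a small ball.

   At each point discard the caps [theta] lying in a [tau] whose tile there is not good, scale
   by scale from the smallest one.  Either the part surviving all scales is still at least
   [alpha / 5], and Cordoba's L^4 square function estimate applies, or for some scale [k] the
   part removed at scale [k] is at least [alpha / (2 N)].  In the latter case pass to a
   dominating child cap as long as one exists; where this stops, two distinct caps contribute
   comparably, and the L^4 norm is bounded by a bilinear term, which local orthogonality
   compares with the square function of the caps at scale [k].  As the tile was not good, the
   low-frequency part of that square function is at most half of it, so its high-frequency part
   dominates; splitting the latter into frequency bands, each band is almost orthogonal and is
   controlled by the good tiles of one scale. *)

(** Pruning starts from the smallest scale so that the part removed at scale [k] is carried by good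
    tiles of every scale [m > k]; the wave envelope sums met in its high-frequency part are then
    dominated by the right-hand side. Goodness is constant along tiles, hence along the planks dual
    to the smallest caps, so pruning preserves equivariance; this is why the analysis is made for an
    arbitrary equivariant family [h].

    The obstacle in descending to dominating children is a loss of [1 + e] per scale. With
    [e = 1 / (4 N)] its fourth power over all scales stays below 3, at the price of a broad constant
    of order [e ^- 2]. Of the ten powers of [N], four come from the threshold [alpha / (2 N)], one
    from the number of removed parts, one from the number of stopping scales, two from the broad
    constant and at most two from the frequency bands.

    Transversality of tiles is measured by [2 (c - c')]. Since [|2| >= 1 / p], the factor 2 costs
    one power of [p]; another is spent on the width of a band, hence the separation [p ^ 2 * p ^- l]
    used throughout. *)

Section ComplexDot.
Variable R : rcfType.
Implicit Types z t : R[i].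

Definition cdot z t : R := complex.Re z * complex.Re t + complex.Im z * complex.Im t.
Definition normc2 z : R := cdot z z.

Lemma ReD z t : complex.Re (z + t) = complex.Re z + complex.Re t.
Proof. by case: z; case: t. Qed.

Lemma ImD z t : complex.Im (z + t) = complex.Im z + complex.Im t.
Proof. by case: z; case: t. Qed.

Lemma cdotC z t : cdot z t = cdot t z.
Proof. by rewrite /cdot mulrC [X in _ + X]mulrC. Qed.

Lemma cdotDl z z' t : cdot (z + z') t = cdot z t + cdot z' t.
Proof. by rewrite /cdot ReD ImD; ring. Qed.

Lemma cdot0l t : cdot 0 t = 0.
Proof. by rewrite /cdot /= !mul0r addr0. Qed.

Lemma cdot_suml (I : Type) (s : seq I) (P : pred I) (F : I -> R[i]) t :
  cdot (\sum_(i <- s | P i) F i) t = \sum_(i <- s | P i) cdot (F i) t.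
Proof.
elim: s => [|i s IH]; first by rewrite !big_nil cdot0l.
by rewrite !big_cons; case: (P i); rewrite ?cdotDl IH.
Qed.

Lemma cdot_sumr (I : Type) (s : seq I) (P : pred I) (F : I -> R[i]) t :
  cdot t (\sum_(i <- s | P i) F i) = \sum_(i <- s | P i) cdot t (F i).
Proof. by rewrite cdotC cdot_suml; apply: eq_bigr => i _; rewrite cdotC. Qed.

Lemma cdotE z t : cdot z t = complex.Re (z * conjc t).
Proof. by case: z => a b; case: t => c d; rewrite /cdot /=; ring. Qed.

Lemma conjcM z t : conjc (z * t) = conjc z * conjc t.
Proof. exact: (rmorphM (@conjc R)). Qed.

Lemma normc2E z : normc z ^+ 2 = normc2 z.
Proof.
case: z => a b; by rewrite /normc2 /cdot /= sqr_sqrtr ?addr_ge0 ?sqr_ge0.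
Qed.

Lemma normc2_ge0 z : 0 <= normc2 z.
Proof. by rewrite -normc2E sqr_ge0. Qed.

Lemma normc_ge0 z : 0 <= normc z.
Proof. by case: z => a b /=; apply: sqrtr_ge0. Qed.

Lemma normc2M z t : normc2 (z * t) = normc2 z * normc2 t.
Proof. by rewrite -!normc2E normcM exprMn. Qed.

Lemma normc2_0 : normc2 0 = 0 :> R.
Proof. exact: cdot0l. Qed.

Lemma normc2_eq0 z : (normc2 z == 0) = (z == 0).
Proof.
apply/idP/eqP => [|->]; last by rewrite normc2_0.
by rewrite -normc2E sqrf_eq0 => /eqP /eq0_normc.
Qed.

Lemma cdot_le z t : cdot z t <= (normc2 z + normc2 t) / 2.
Proof.
rewrite /normc2 /cdot; set a := complex.Re z; set b := complex.Im z.
set c := complex.Re t; set d := complex.Im t.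
have := sqr_ge0 (a - c); have := sqr_ge0 (b - d); nra.
Qed.

Lemma normc_sum (I : Type) (s : seq I) (P : pred I) (F : I -> R[i]) :
  normc (\sum_(i <- s | P i) F i) <= \sum_(i <- s | P i) normc (F i).
Proof.
elim/big_rec2: _ => [|i x y _ IH]; first by rewrite normc0.
by apply: le_trans (le_normcD _ _) _; rewrite lerD2l.
Qed.

Lemma sqr_sum_le (I : Type) (s : seq I) (P : pred I) (a : I -> R) :
  (\sum_(i <- s | P i) a i) ^+ 2 <=
  (count P s)%:R * \sum_(i <- s | P i) a i ^+ 2.
Proof.
elim: s => [|i s IH]; first by rewrite !big_nil expr0n mulr0.
rewrite !big_cons /=; case: (P i) => //=.
set A := \sum_(j <- s | P j) a j in IH *.
set B := \sum_(j <- s | P j) a j ^+ 2 in IH *.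
have B0 : 0 <= B by apply: sumr_ge0 => j _; apply: sqr_ge0.
rewrite natrD; move: (count P s) IH => n IH.
have n0 : 0 <= n%:R :> R by [].
have [n_0|npos] := posnP n.
  rewrite n_0 mul0r in IH *.
  have {}A0 : A = 0 by apply/eqP; rewrite -sqrf_eq0; apply/eqP/le_anti; rewrite IH sqr_ge0.
  by rewrite A0 !addr0 mul1r lerDl.
have nn : 0 < n%:R :> R by rewrite ltr0n.
have : 0 <= (n%:R * a i - A) ^+ 2 by apply: sqr_ge0.
move=> H; rewrite -subr_ge0 -(pmulr_rge0 _ nn).
have -> : n%:R * ((1%:R + n%:R) * (a i ^+ 2 + B) - (a i + A) ^+ 2) =
  (n%:R * a i - A) ^+ 2 + (n%:R + 1) * (n%:R * B - A ^+ 2) by ring.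
by rewrite addr_ge0 // mulr_ge0 ?subr_ge0 // addr_ge0.
Qed.

Lemma normc2_sum_le (I : Type) (s : seq I) (P : pred I) (F : I -> R[i]) :
  normc2 (\sum_(i <- s | P i) F i) <=
  (count P s)%:R * \sum_(i <- s | P i) normc2 (F i).
Proof.
rewrite -normc2E (eq_bigr (fun i => normc (F i) ^+ 2)) => [|i _]; last by rewrite normc2E.
apply: le_trans (sqr_sum_le _ _ _).
by rewrite lerXn2r ?nnegrE ?normc_ge0 ?normc_sum // sumr_ge0 // => i _; apply: normc_ge0.
Qed.

End ComplexDot.

(** * Schur's test *)

Section Schur.
Variable R : rcfType.

Lemma sum_const_count (I : Type) (s : seq I) (P : pred I) (a : R) :
  \sum_(i <- s | P i) a = (count P s)%:R * a.
Proof. by rewrite big_const_seq iter_addr_0 mulr_natl. Qed.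

(** By symmetry of [adj] the bound on pairs charges [Q i] once per neighbour of [i], so almost
    orthogonality costs only the maximal degree. *)
Lemma schur_test (T : eqType) (s : seq T) (adj : rel T) (B : T -> T -> R)
  (Q : T -> R) (M : R) :
  (forall i j, i \in s -> j \in s -> adj i j = adj j i) ->
  (forall i, i \in s -> (count (adj i) s)%:R <= M) ->
  (forall i, 0 <= Q i) ->
  (forall i j, B i j <= (Q i + Q j) / 2) ->
  (forall i j, i \in s -> j \in s -> ~~ adj i j -> B i j = 0) ->
  \sum_(i <- s) \sum_(j <- s) B i j <= M * \sum_(i <- s) Q i.
Proof.
move=> sym deg Q0 BQ B0.
apply: (@le_trans _ _ (\sum_(i <- s) \sum_(j <- s | adj i j) (Q i + Q j) / 2)).
  rewrite big_seq [leRHS]big_seq; apply: ler_sum => i si.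
  rewrite (bigID (adj i)) /= [X in _ + X]big_seq_cond [X in _ + X]big1 ?addr0.
    by apply: ler_sum.
  by move=> j /andP[sj]; apply: B0.
have -> : \sum_(i <- s) \sum_(j <- s | adj i j) (Q i + Q j) / 2 =
  (\sum_(i <- s) \sum_(j <- s | adj i j) Q i +
   \sum_(i <- s) \sum_(j <- s | adj i j) Q j) / 2.
  rewrite -big_split mulr_suml; apply: eq_bigr => i _ /=.
  by rewrite -big_split mulr_suml.
have -> : \sum_(i <- s) \sum_(j <- s | adj i j) Q j =
  \sum_(i <- s) \sum_(j <- s | adj i j) Q i.
  rewrite (exchange_big_dep predT) //= big_seq [RHS]big_seq.
  apply: eq_bigr => i si; rewrite big_seq_cond [RHS]big_seq_cond.
  by apply: eq_bigl => j; case sj: (j \in s) => //=; rewrite sym.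
set S := \sum_(i <- s) _.
have -> : (S + S) / 2 = S by field.
rewrite /S mulr_sumr big_seq [leRHS]big_seq; apply: ler_sum => i si.
by rewrite sum_const_count ler_wpM2r // deg.
Qed.

End Schur.

(** * Sums without a dominant term *)

Section Broad.
Variables (R : rcfType) (T : eqType).

(** Let [b] be the largest term, [t] the sum of the squares of the others and [S] the sum of all
    squares. The off-diagonal sum is at least [S * t] and at least [2 * b^2 * t], while
    Cauchy-Schwarz gives [H^2 <= p * S] and [(H - b)^2 <= (p - 1) * t]. Which bounds to combine
    depends on whether [b] exceeds [H / 2]. *)
Lemma broad_pairs (s : seq T) (a : T -> R) (H p e c : R) : uniq s ->
  (size s)%:R <= p -> 2 <= p -> 0 < e <= 1 -> (forall i, 0 <= a i) ->
  0 <= H -> H <= \sum_(i <- s) a i -> (forall i, i \in s -> (1 + e) * a i <= H) ->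
  4 * p ^+ 2 <= c -> (1 + e) ^+ 4 * (p - 1) <= 2 * e ^+ 2 * c ->
  H ^+ 4 <= c * \sum_(i <- s) \sum_(j <- s | i != j) a i ^+ 2 * a j ^+ 2.
Proof.
move=> us sp p2 /andP[e0 e1] a0 H0 Hs aH c1 c2.
have c0 : 0 <= c by apply: le_trans c1; rewrite mulr_ge0 // sqr_ge0.
have [s0|sN0] := eqVneq s [::].
  move: Hs; rewrite s0 !big_nil mulr0 => H00.
  have -> : H = 0 by apply: le_anti; rewrite H0 H00.
  by rewrite expr0n.
have [i0 i0s i0max] : exists2 i0, i0 \in s & forall i, i \in s -> a i <= a i0.
  elim: (s) sN0 => // i s' IH _; have [->|/IH[i1 i1s m1]] := eqVneq s' [::].
    by exists i; rewrite ?mem_head // => j; rewrite inE => /eqP ->.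
  have [le1|/ltW le1] := leP (a i1) (a i).
    exists i; rewrite ?mem_head // => j; rewrite inE => /predU1P[->//|/m1 h].
    exact: le_trans le1.
  by exists i1; rewrite ?inE ?i1s ?orbT // => j; rewrite inE => /predU1P[->//|/m1].
set B := \sum_(i <- s) _; set b := a i0.
pose I i := \sum_(j <- s | i != j) a j ^+ 2.
have BE : B = \sum_(i <- s) a i ^+ 2 * I i.
  by apply: eq_bigr => i _; rewrite /I mulr_sumr.
set S := \sum_(i <- s) a i ^+ 2.
have IE i : i \in s -> S = a i ^+ 2 + I i.
  move=> si; rewrite /S (bigD1_seq i) //=; congr (_ + _).
  by apply: eq_bigl => j; rewrite eq_sym.
set t := I i0; have t0 : 0 <= t by apply: sumr_ge0 => j _; apply: sqr_ge0.
have b0 : 0 <= b by apply: a0.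
have St : S = b ^+ 2 + t by apply: IE.
have It i : i \in s -> t <= I i.
  move=> si; have := IE i si; rewrite St => e'.
  have : a i ^+ 2 <= b ^+ 2 by rewrite lerXn2r ?nnegrE // i0max.
  by lra.
have Ib i : i != i0 -> b ^+ 2 <= I i.
  move=> ii; rewrite /I big_mkcond (bigD1_seq i0) //= ii lerDl.
  by apply: sumr_ge0 => j _; case: ifP => // _; apply: sqr_ge0.
have B1 : S * t <= B.
  rewrite BE /S mulr_suml big_seq [leRHS]big_seq; apply: ler_sum => i si.
  by rewrite ler_wpM2l ?sqr_ge0 // It.
have B2 : 2 * (b ^+ 2 * t) <= B.
  rewrite BE (bigD1_seq i0) //= -/b -/t mulrDl mul1r lerD2l.
  rewrite (_ : t = \sum_(i <- s | i != i0) a i ^+ 2); last first.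
    by apply: eq_bigl => j; rewrite eq_sym.
  rewrite mulr_sumr; apply: ler_sum => i ii.
  by rewrite mulrC ler_wpM2l ?sqr_ge0 // Ib.
have HS : H ^+ 2 <= p * S.
  apply: (@le_trans _ _ ((\sum_(i <- s) a i) ^+ 2)).
    by rewrite lerXn2r ?nnegrE // (le_trans H0 Hs).
  apply: le_trans (sqr_sum_le _ _ _) _; rewrite count_predT ler_wpM2r //.
  by apply: sumr_ge0 => j _; apply: sqr_ge0.
have bH : (1 + e) * b <= H by apply: aH.
have Ht : (H - b) ^+ 2 <= (p - 1) * t.
  apply: (@le_trans _ _ ((\sum_(i <- s | i0 != i) a i) ^+ 2)).
    have : H - b <= \sum_(i <- s | i0 != i) a i.
      rewrite lerBlDl; apply: le_trans Hs _; rewrite (bigD1_seq i0) //= -/b lerD2l.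
      by rewrite le_eqVlt; apply/orP; left; apply/eqP; apply: eq_bigl => j; rewrite eq_sym.
    move=> h; rewrite lerXn2r ?nnegrE //; first by nra.
    by apply: sumr_ge0.
  apply: le_trans (sqr_sum_le _ _ _) _; rewrite ler_wpM2r //.
  have -> : count (fun i => i0 != i) s = (size s).-1.
    rewrite -(count_predC (pred1 i0) s) count_uniq_mem // i0s /=.
    by apply: eq_count => j /=; rewrite eq_sym.
  by rewrite -subn1 natrB ?lerB // lt0n size_eq0.
(* Here [H - b >= H / 2], so one factor [H^2] is paid by [S] and the other by [t]. *)
have [bh|bh] := leP (2 * b) H.
  have Hp : H ^+ 2 <= 4 * (p * t) by nra.
  apply: (@le_trans _ _ (c * (S * t))); last by rewrite ler_wpM2l.
  apply: (@le_trans _ _ (4 * p ^+ 2 * (S * t))); last first.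
    by rewrite ler_wpM2r // mulr_ge0 // St addr_ge0 // sqr_ge0.
  rewrite (_ : H ^+ 4 = H ^+ 2 * H ^+ 2); last by ring.
  rewrite (_ : 4 * _ * _ = (p * S) * (4 * (p * t))); last by ring.
  by rewrite ler_pM ?sqr_ge0.
(* Beyond [H / 2] the product [b * (H - b)] decreases in [b]; its least value, at [b = H / (1 + e)],
   is [e * H^2 / (1 + e)^2]. *)
have key : e * H ^+ 2 <= (1 + e) ^+ 2 * (b * (H - b)).
  rewrite -subr_ge0 (_ : _ - _ = (H - (1 + e) * b) * ((1 + e) * b - e * H)); last by ring.
  by rewrite mulr_ge0 ?subr_ge0 //; nra.
have p1 : 0 < p - 1 by move: p2; lra.
rewrite -(ler_pM2l p1); apply: (@le_trans _ _ (c * ((p - 1) * (2 * (b ^+ 2 * t))))); last first.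
  by rewrite [leLHS]mulrCA ler_wpM2l ?(ltW p1) // ler_wpM2l.
have e4 : 0 < (1 + e) ^+ 4 by rewrite exprn_gt0 //; lra.
rewrite -(ler_pM2l e4).
apply: (@le_trans _ _ (2 * c * (e * H ^+ 2) ^+ 2)).
  rewrite (_ : 2 * c * _ = (2 * e ^+ 2 * c) * H ^+ 4); last by ring.
  by rewrite mulrA ler_wpM2r // exprn_ge0.
apply: (@le_trans _ _ (2 * c * ((1 + e) ^+ 2 * (b * (H - b))) ^+ 2)).
  rewrite ler_wpM2l ?mulr_ge0 // lerXn2r ?nnegrE //.
    by rewrite mulr_ge0 ?sqr_ge0 // ltW.
  by apply: le_trans key; rewrite mulr_ge0 ?sqr_ge0 // ltW.
rewrite (_ : 2 * c * _ = 2 * c * (1 + e) ^+ 4 * b ^+ 2 * (H - b) ^+ 2); last by ring.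
rewrite (_ : (1 + e) ^+ 4 * _ = 2 * c * (1 + e) ^+ 4 * b ^+ 2 * ((p - 1) * t)); last by ring.
apply: ler_wpM2l => //; apply: mulr_ge0; last exact: sqr_ge0.
by apply: mulr_ge0; [rewrite mulr_ge0 | exact: ltW].
Qed.

End Broad.

(** * Finite conditional expectations between two subgroups *)

Section Averages.
Variables (R : rcfType) (V : zmodType).
Implicit Types (A H : pred V).

Definition subgrp H := H 0 /\ forall x y, H x -> H y -> H (x - y).

Lemma subgrpN H x : subgrp H -> H x -> H (- x).
Proof. by case=> H0 HB Hx; rewrite -sub0r; apply: HB. Qed.

Lemma subgrpD H x y : subgrp H -> H x -> H y -> H (x + y).
Proof. by move=> sH Hx Hy; rewrite -[y]opprK; apply: (proj2 sH) => //; apply: subgrpN. Qed.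

Definition periodic A (T : Type) (g : V -> T) := forall x a, A a -> g (x + a) = g x.

Lemma periodicS A A' (T : Type) (g : V -> T) :
  (forall x, A x -> A' x) -> periodic A' g -> periodic A g.
Proof. by move=> sub pg x a /sub; apply: pg. Qed.

Variables (X : seq V) (D B : pred V).

(** A finite model of [B / D]: up to the measure of a coset of [D], sums over [X] are integrals over
    [B] of [D]-periodic functions. *)
Definition coset_reps :=
  [/\ uniq X, forall x, x \in X -> B x,
      forall y, B y -> exists2 x, x \in X & D (y - x) &
      forall x x', x \in X -> x' \in X -> D (x - x') -> x = x'].

Hypotheses (sD : subgrp D) (sB : subgrp B) (sDB : forall x, D x -> B x)
  (trX : coset_reps).

Definition intermediate H :=
  [/\ subgrp H, forall x, D x -> H x & forall x, H x -> B x].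

Let rep y := nth 0 X (find (fun x => D (y - x)) X).

Let repP y : B y -> rep y \in X /\ D (y - rep y).
Proof.
case: trX => _ _ ex _ By.
have hy : has (fun x => D (y - x)) X.
  by have [x xX Dx] := ex y By; apply/hasP; exists x.
by split; [rewrite mem_nth // -has_find | exact: (nth_find 0 hy)].
Qed.

Lemma intermediateD : intermediate D. Proof. by split. Qed.
Lemma intermediateB : intermediate B. Proof. by split. Qed.

(** Adding [a] and returning to the representative permutes the elements of [X] in [H]: this is
    injective because [X] is separated modulo [D], and it stays in [H] because [H] contains [D]. *)
Lemma sum_shift_in (W : nmodType) (g : V -> W) H a :
  intermediate H -> periodic D g -> H a ->
  \sum_(x <- X | H x) g (x + a) = \sum_(x <- X | H x) g x.
Proof.
move=> [sH sDH sHB] pg Ha; have [uX XB _ injX] := trX.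
rewrite -!(big_filter X H); set s := seq.filter _ _.
have sP x : x \in s -> [/\ x \in X, H x & B (x + a)].
  rewrite mem_filter => /andP[Hx xX]; split=> //.
  by apply: sHB; apply: subgrpD.
pose t := [seq rep (x + a) | x <- s].
have us : uniq s by apply: filter_uniq.
have ut : uniq t.
  rewrite map_inj_in_uniq // => x x' /sP[xX Hx Bx] /sP[x'X Hx' Bx'] e.
  apply: injX => //; have [_ d] := repP Bx; have [_ d'] := repP Bx'.
  have -> : x - x' = (x + a - rep (x + a)) - (x' + a - rep (x' + a)).
    by rewrite e !opprB addrA subrK opprD [- x' - a]addrC addrA addrK.
  exact: (proj2 sD).
have ts : {subset t <= s}.
  move=> y /mapP[x /sP[xX Hx Bx] ->]; have [rX d] := repP Bx.
  rewrite mem_filter rX andbT.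
  rewrite -[rep _](subKr (x + a)); apply: (proj2 sH); last exact: sDH.
  exact: subgrpD.
have [_ ets] := uniq_min_size ut ts (eq_leq (esym (size_map _ _))).
rewrite -[RHS](perm_big _ (uniq_perm ut us ets)) /= big_map big_seq [RHS]big_seq.
apply: eq_bigr => x /sP[xX Hx Bx]; have [rX d] := repP Bx.
by rewrite -[in LHS](subrK (rep (x + a)) (x + a)) addrC pg.
Qed.

Lemma sum_shift (W : nmodType) (g : V -> W) a :
  periodic D g -> B a -> \sum_(x <- X) g (x + a) = \sum_(x <- X) g x.
Proof.
move=> pg Ba; have := sum_shift_in intermediateB pg Ba; have [_ XB _ _] := trX.
rewrite big_seq_cond [in RHS]big_seq_cond => e.
rewrite big_seq [RHS]big_seq.
have eqB : (fun x => (x \in X) && B x) =1 (fun x => x \in X).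
  by move=> x; case xX: (x \in X) => //=; apply: XB.
by rewrite -!(eq_bigl _ _ eqB).
Qed.

Lemma sum_equivariant0 (g : V -> R[i]) (c : R[i]) a :
  periodic D g -> B a -> (forall x, g (x + a) = c * g x) -> c != 1 ->
  \sum_(x <- X) g x = 0.
Proof.
move=> pg Ba ga c1; have := sum_shift pg Ba.
under eq_bigr do rewrite ga.
rewrite -mulr_sumr => /eqP; rewrite -subr_eq0 -[X in _ - X]mul1r -mulrBl mulf_eq0.
by rewrite subr_eq0 (negbTE c1) => /eqP.
Qed.

(** The conditional expectation onto [H]-periodic functions; in Fourier terms, the restriction to
    frequencies trivial on [H], so a larger [H] means a lower cutoff. *)
Definition mean H (g : V -> R) x := (count H X)%:R^-1 * \sum_(y <- X | H y) g (x + y).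

Lemma count_gt0 H : intermediate H -> (0 < count H X)%N.
Proof.
move=> [sH sDH _]; rewrite -has_count; apply/hasP.
have [rX d] := repP (proj1 sB); exists (rep 0) => //.
by rewrite -[rep 0]opprK; apply: subgrpN => //; apply: sDH; rewrite -sub0r.
Qed.

Let countN0 H : intermediate H -> (count H X)%:R != 0 :> R.
Proof. by move=> /count_gt0; rewrite pnatr_eq0 -lt0n. Qed.

Let perD g x : periodic D g -> periodic D (fun y : V => (g (x + y) : R)).
Proof. by move=> pg y d Dd; rewrite addrA; apply: pg. Qed.

Lemma mean_shift H g x a : intermediate H -> periodic D g -> H a ->
  mean H g (x + a) = mean H g x.
Proof.
move=> iH pg Ha; congr (_ * _); under eq_bigr do rewrite -addrA [a + _]addrC.
exact: (sum_shift_in iH (perD x pg)).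
Qed.

Lemma mean_periodic H g : intermediate H -> periodic D g -> periodic H (mean H g).
Proof. by move=> iH pg x a Ha; apply: mean_shift. Qed.

Lemma mean_periodic_in A H g : periodic A g -> periodic A (mean H g).
Proof.
move=> pg x a Aa; congr (_ * _); apply: eq_bigr => y _.
by rewrite -addrA [a + y]addrC addrA; apply: pg.
Qed.

Lemma mean_id H g x : intermediate H -> periodic H g -> mean H g x = g x.
Proof.
move=> iH pg; rewrite /mean (eq_bigr (fun=> g x)) => [|y Hy]; last exact: pg.
by rewrite sum_const_count mulKf // countN0.
Qed.

Lemma mean_ext H g g' x : (forall y, H y -> g (x + y) = g' (x + y)) ->
  mean H g x = mean H g' x.
Proof. by move=> e; congr (_ * _); apply: eq_bigr => y /e. Qed.

Lemma mean_eq H g g' : g =1 g' -> mean H g =1 mean H g'.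
Proof. by move=> e x; apply: mean_ext => y _; apply: e. Qed.

Lemma mean_le H g g' x : (forall y, H y -> g (x + y) <= g' (x + y)) ->
  mean H g x <= mean H g' x.
Proof. by move=> e; rewrite ler_wpM2l ?invr_ge0 //; apply: ler_sum => y /e. Qed.

Lemma mean_ge0 H g x : (forall y, H y -> 0 <= g (x + y)) -> 0 <= mean H g x.
Proof. by move=> g0; rewrite mulr_ge0 ?invr_ge0 // sumr_ge0. Qed.

Lemma mean_mull H f g x : periodic H f ->
  mean H (fun y => f y * g y) x = f x * mean H g x.
Proof.
move=> pf; rewrite /mean [RHS]mulrCA; congr (_ * _); rewrite mulr_sumr.
by apply: eq_bigr => y Hy; rewrite pf.
Qed.

Lemma mean_sum H (I : Type) (s : seq I) (P : pred I) (F : I -> V -> R) x :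
  mean H (fun y => \sum_(i <- s | P i) F i y) x = \sum_(i <- s | P i) mean H (F i) x.
Proof. by rewrite /mean exchange_big mulr_sumr. Qed.

Lemma sum_mean H g : intermediate H -> periodic D g ->
  \sum_(x <- X) mean H g x = \sum_(x <- X) g x.
Proof.
move=> iH pg; have [sH sDH sHB] := iH.
rewrite -mulr_sumr exchange_big /=.
rewrite (eq_bigr (fun=> \sum_(x <- X) g x)) => [|y Hy].
  by rewrite sum_const_count mulKf // countN0.
by apply: sum_shift => //; apply: sHB.
Qed.

Lemma mean_mean H1 H2 g x : intermediate H1 -> intermediate H2 ->
  (forall y, H1 y -> H2 y) -> periodic D g ->
  mean H2 (mean H1 g) x = mean H2 g x.
Proof.
move=> i1 i2 sub pg.
rewrite {1}/mean -mulr_sumr exchange_big /= mulrCA.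
rewrite (eq_bigr (fun=> \sum_(y <- X | H2 y) g (x + y))) => [|y /sub Hy].
  by rewrite sum_const_count mulrCA mulKf // countN0.
under eq_bigr do rewrite -addrA.
exact: (sum_shift_in i2 (perD x pg)).
Qed.

(** [mean H2 f] is constant on cosets of [H2], so pairing with it only sees the [H2]-average of the
    other factor. *)
Lemma sum_mean_mean H1 H2 f g : intermediate H1 -> intermediate H2 ->
  (forall y, H1 y -> H2 y) -> periodic D f -> periodic D g ->
  \sum_(x <- X) mean H2 f x * mean H1 g x = \sum_(x <- X) mean H2 f x * mean H2 g x.
Proof.
move=> i1 i2 sub pf pg; have [s2 D2 _] := i2; have [s1 D1 _] := i1.
have p2 := mean_periodic i2 pf.
rewrite -(sum_mean i2 (g := fun x => mean H2 f x * mean H1 g x)); last first.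
  move=> x d Dd; rewrite (periodicS D2 p2) //.
  by rewrite (periodicS D1 (mean_periodic i1 pg)).
by apply: eq_bigr => x _; rewrite mean_mull // mean_mean.
Qed.

(** Pythagoras: for nested subgroups the coarser average is an orthogonal projection of the finer
    one. *)
Lemma energy_diff H1 H2 g : intermediate H1 -> intermediate H2 ->
  (forall y, H1 y -> H2 y) -> periodic D g ->
  \sum_(x <- X) (mean H1 g x - mean H2 g x) ^+ 2 =
  \sum_(x <- X) mean H1 g x ^+ 2 - \sum_(x <- X) mean H2 g x ^+ 2.
Proof.
move=> i1 i2 sub pg.
rewrite (eq_bigr (fun x => mean H1 g x ^+ 2 + (mean H2 g x ^+ 2
    - 2 * (mean H2 g x * mean H1 g x)))) => [|x _]; last by ring.
rewrite !big_split /= sumrN -mulr_sumr (sum_mean_mean i1 i2) //.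
under [in X in 2 * X]eq_bigr do rewrite -expr2.
ring.
Qed.

Lemma energy_diff1 H g : intermediate H -> periodic D g ->
  \sum_(x <- X) (g x - mean H g x) ^+ 2 =
  \sum_(x <- X) g x ^+ 2 - \sum_(x <- X) mean H g x ^+ 2.
Proof.
move=> iH pg; have [_ DH _] := iH; have := energy_diff intermediateD iH DH pg.
have e x : mean D g x = g x by apply: mean_id => //; exact: intermediateD.
by under eq_bigr do rewrite e; under [X in _ = X - _ -> _]eq_bigr do rewrite e.
Qed.

Lemma energy_le H g : intermediate H -> periodic D g ->
  \sum_(x <- X) mean H g x ^+ 2 <= \sum_(x <- X) g x ^+ 2.
Proof.
move=> iH pg; rewrite -subr_ge0 -energy_diff1 //.
by apply: sumr_ge0 => x _; apply: sqr_ge0.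
Qed.

(* In Fourier terms, the supports of [f] and [g] only meet at frequencies trivial on [H]. *)
Lemma sum_mean_transverse A A' H f g : intermediate H ->
  periodic D f -> periodic D g -> periodic A f -> periodic A' g ->
  (forall z, H z -> exists a b, [/\ A a, A' b, B b & z = b + a]) ->
  \sum_(x <- X) mean H f x * mean H g x = \sum_(x <- X) f x * g x.
Proof.
move=> iH pf pg Af Ag sub; have [_ DH _] := iH.
rewrite -(sum_mean_mean intermediateD iH DH pf pg).
have e x : mean D g x = g x by apply: mean_id => //; exact: intermediateD.
under eq_bigr do rewrite e /mean -mulrA mulr_suml.
rewrite -mulr_sumr exchange_big /=.
rewrite (eq_bigr (fun=> \sum_(x <- X) f x * g x)) => [|z Hz].
  by rewrite sum_const_count mulKf // countN0.
have [a [b [Aa Ab Bb ->]]] := sub z Hz.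
under eq_bigr do rewrite addrA Af // -(Ag _ _ Ab).
apply: (sum_shift (g := fun x => f x * g x)) => // x d Dd.
by rewrite pf // pg.
Qed.

(** [mean H1 - mean H2] isolates one frequency band. For a transverse pair, the correlations after
    averaging over [H1] and over [H2] both equal the unaveraged one, so the pair contributes nothing
    to the band; the other pairs go to Schur's test. *)
Lemma high_lemma (T : eqType) (s : seq T) (same_cap : rel T) (A : T -> pred V)
  (F : T -> V -> R) (M : R) H1 H2 :
  intermediate H1 -> intermediate H2 -> (forall y, H1 y -> H2 y) ->
  (forall i, i \in s -> periodic D (F i) /\ periodic (A i) (F i)) ->
  (forall i j, same_cap i j = same_cap j i) ->
  (forall i, i \in s -> (count (same_cap i) s)%:R <= M) ->
  (forall i j, i \in s -> j \in s -> ~~ same_cap i j ->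
    forall z, H2 z -> exists a b, [/\ A i a, A j b, B b & z = b + a]) ->
  \sum_(x <- X) mean H1 (fun y => \sum_(i <- s) F i y) x ^+ 2 -
  \sum_(x <- X) mean H2 (fun y => \sum_(i <- s) F i y) x ^+ 2 <=
  M * \sum_(i <- s) \sum_(x <- X) mean H1 (F i) x ^+ 2.
Proof.
move=> i1 i2 sub perF sym deg tr.
have pS : periodic D (fun y => \sum_(i <- s) F i y).
  move=> x d Dd; rewrite big_seq [RHS]big_seq; apply: eq_bigr => i /perF [pF _].
  exact: pF.
rewrite -energy_diff //.
pose E i x := mean H1 (F i) x - mean H2 (F i) x.
have E2 i j : i \in s -> j \in s -> \sum_(x <- X) E i x * E j x =
    \sum_(x <- X) mean H1 (F i) x * mean H1 (F j) x -
    \sum_(x <- X) mean H2 (F i) x * mean H2 (F j) x.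
  move=> /perF[pi _] /perF[pj _].
  rewrite (eq_bigr (fun x => mean H1 (F i) x * mean H1 (F j) x + (mean H2 (F i) x * mean H2 (F j) x
    - (mean H2 (F i) x * mean H1 (F j) x) - (mean H2 (F j) x * mean H1 (F i) x)))); last first.
    by move=> x _; rewrite /E; ring.
  rewrite !big_split /= !sumrN !(sum_mean_mean i1 i2) //.
  under [X in _ + (_ - _ - X)]eq_bigr do rewrite mulrC.
  ring.
apply: (@le_trans _ _ (M * \sum_(i <- s) \sum_(x <- X) E i x ^+ 2)); last first.
  have [->|s0] := eqVneq s [::]; first by rewrite !big_nil.
  have [i0 si0] : exists i, i \in s.
    by case: (s) s0 => // i s' _; exists i; apply: mem_head.
  have M0 : 0 <= M by apply: le_trans (deg _ si0).
  rewrite ler_wpM2l // big_seq [leRHS]big_seq; apply: ler_sum => i /perF[pF _].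
  rewrite energy_diff // gerBl; apply: sumr_ge0 => x _; exact: sqr_ge0.
have -> : \sum_(x <- X) (mean H1 (fun y => \sum_(i <- s) F i y) x -
     mean H2 (fun y => \sum_(i <- s) F i y) x) ^+ 2 =
  \sum_(i <- s) \sum_(j <- s) \sum_(x <- X) E i x * E j x.
  under [RHS]eq_bigr do rewrite exchange_big /=.
  rewrite exchange_big /=; apply: eq_bigr => x _.
  rewrite !mean_sum -sumrB expr2 mulr_suml; apply: eq_bigr => i _.
  by rewrite mulr_sumr.
apply: (@schur_test _ _ s same_cap) => //.
- by move=> i; apply: sumr_ge0 => x _; apply: sqr_ge0.
- move=> i j; rewrite -big_split mulr_suml; apply: ler_sum => x _ /=.
  by have := sqr_ge0 (E i x - E j x); nra.
- move=> i j si sj nij; rewrite E2 //.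
  have [pi Ai] := perF i si; have [pj Aj] := perF j sj.
  rewrite !(sum_mean_transverse _ pi pj Ai Aj) ?subrr //; first exact: tr.
  by move=> z /sub; apply: tr.
Qed.

Lemma mean_equivariant0 H (g : V -> R[i]) (c : R[i]) a x :
  intermediate H -> periodic D g -> H a -> (forall y, g (y + a) = c * g y) ->
  c != 1 -> mean H (fun y => complex.Re (g y)) x = 0.
Proof.
move=> iH pg Ha ga c1; rewrite /mean.
have -> : \sum_(y <- X | H y) complex.Re (g (x + y)) =
    complex.Re (\sum_(y <- X | H y) g (x + y)).
  by elim/big_rec2: _ => // y u v _ ->; rewrite ReD.
have pxg : periodic D (fun y => g (x + y)) by move=> y d Dd; rewrite addrA; apply: pg.
have /eqP := sum_shift_in iH pxg Ha.
under eq_bigr do rewrite addrA ga.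
rewrite -mulr_sumr -subr_eq0 -[X in _ - X]mul1r -mulrBl mulf_eq0.
by rewrite subr_eq0 (negbTE c1) => /eqP -> /=; rewrite mulr0.
Qed.

End Averages.

(** * Ultrametric geometry of planks *)

Section Ultrametric.
Variables (R : rcfType) (K : fieldType) (absv : K -> R).

Definition ultrametric_abs :=
  [/\ forall x, absv x = 0 <-> x = 0, forall x, 0 <= absv x,
      forall x y, absv (x * y) = absv x * absv y &
      forall x y, absv (x + y) <= Num.max (absv x) (absv y)].

Hypothesis na : ultrametric_abs.

Lemma abs0 : absv 0 = 0. Proof. by case: na => e _ _ _; apply/e. Qed.
Lemma abs_ge0 x : 0 <= absv x. Proof. by case: na. Qed.
Lemma absM x y : absv (x * y) = absv x * absv y. Proof. by case: na. Qed.

Lemma abs_eq0 x : (absv x == 0) = (x == 0).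
Proof. by case: na => e _ _ _; apply/eqP/eqP => /e. Qed.

Lemma abs_gt0 x : (0 < absv x) = (x != 0).
Proof. by rewrite lt_neqAle abs_ge0 andbT eq_sym abs_eq0. Qed.

Lemma abs1 : absv 1 = 1.
Proof.
have n1 : absv 1 != 0 by rewrite abs_eq0 oner_neq0.
by apply: (mulfI n1); rewrite -absM !mulr1.
Qed.

Lemma absN x : absv (- x) = absv x.
Proof.
have e : absv (-1) = 1.
  have : absv (-1) ^+ 2 = 1 by rewrite expr2 -absM mulrNN mulr1 abs1.
  by move/eqP; rewrite sqrf_eq1 => /orP[/eqP //|/eqP e]; have := abs_ge0 (-1); rewrite e; lra.
by rewrite -mulN1r absM e mul1r.
Qed.

Lemma absBC x y : absv (x - y) = absv (y - x).
Proof. by rewrite -opprB absN. Qed.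

Lemma absV x : absv x^-1 = (absv x)^-1.
Proof.
have [->|x0] := eqVneq x 0; first by rewrite invr0 abs0 invr0.
have n0 : absv x != 0 by rewrite abs_eq0.
by apply: (mulfI n0); rewrite -absM !divff // abs1.
Qed.

Lemma absX x n : absv (x ^+ n) = absv x ^+ n.
Proof. by elim: n => [|n IH]; rewrite ?expr0 ?abs1 // !exprS absM IH. Qed.

Lemma absD_le x y r : absv x <= r -> absv y <= r -> absv (x + y) <= r.
Proof. by case: na => _ _ _ na4 hx hy; apply: le_trans (na4 x y) _; rewrite ge_max hx hy. Qed.

Lemma absB_le x y r : absv x <= r -> absv y <= r -> absv (x - y) <= r.
Proof. by move=> hx hy; apply: absD_le => //; rewrite absN. Qed.

Lemma absM_le x y r s : absv x <= r -> absv y <= s -> absv (x * y) <= r * s.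
Proof. by move=> hx hy; rewrite absM ler_pM ?abs_ge0. Qed.

Lemma abs2_le1 : absv 2 <= 1.
Proof. by rewrite (_ : 2 = 1 + 1) // absD_le ?abs1. Qed.

Lemma abs2M_le x r : absv x <= r -> absv (2 * x) <= r.
Proof. by move=> hx; rewrite -[r]mul1r absM_le ?abs2_le1. Qed.

Definition absV2 (a : K * K) : R := Num.max (absv a.1) (absv a.2).

Lemma absV2_le a r : (absV2 a <= r) = (absv a.1 <= r) && (absv a.2 <= r).
Proof. by rewrite /absV2 ge_max. Qed.

Definition ballV (r : R) : pred (K * K) := fun a => absV2 a <= r.

Lemma ballVP r a : reflect (absv a.1 <= r /\ absv a.2 <= r) (ballV r a).
Proof. by rewrite /ballV absV2_le; apply: andP. Qed.

Lemma subgrp_ballV r : 0 <= r -> subgrp (ballV r).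
Proof.
move=> r0; split; first by apply/ballVP; rewrite /= abs0.
by move=> x y /ballVP[x1 x2] /ballVP[y1 y2]; apply/ballVP; rewrite !absB_le.
Qed.

Lemma ballV_le r s a : r <= s -> ballV r a -> ballV s a.
Proof. by move=> rs ar; apply: le_trans ar rs. Qed.

(* The tile [U_tau^0] above the ball of radius [s] about [c] is [plank c (s * R) R]. *)
Definition plank (c : K) (r s : R) : pred (K * K) :=
  fun a => (absv (a.1 + 2 * c * a.2) <= r) && (absv a.2 <= s).

Lemma subgrp_plank c r s : 0 <= r -> 0 <= s -> subgrp (plank c r s).
Proof.
move=> r0 s0; split; first by rewrite /plank /= mulr0 addr0 abs0 r0.
move=> x y /andP[x1 x2] /andP[y1 y2]; apply/andP; split; last exact: absB_le.
rewrite (_ : _ + _ = (x.1 + 2 * c * x.2) - (y.1 + 2 * c * y.2)) ?absB_le //=; ring.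
Qed.

(** Turning the axis from [c] to [c'] changes the transverse coordinate by [2 (c - c') a.2], and
    [|2| <= 1]. *)
Lemma plank_shift c c' r s r' s' a : absv (c - c') * s <= r' -> r <= r' -> s <= s' ->
  plank c r s a -> plank c' r' s' a.
Proof.
move=> cc rr ss /andP[a1 a2]; apply/andP; split; last exact: le_trans ss.
rewrite (_ : _ + _ = (a.1 + 2 * c * a.2) - 2 * ((c - c') * a.2)); last by ring.
apply: absB_le; first exact: le_trans rr.
by apply: abs2M_le; apply: le_trans cc; rewrite absM ler_wpM2l ?abs_ge0.
Qed.

Lemma ballV_plank c r s a : absv c <= 1 -> r <= s -> ballV r a -> plank c r s a.
Proof.
move=> c1 rs /ballVP[a1 a2]; apply/andP; split; last exact: le_trans rs.
by apply: absD_le => //; rewrite -mulrA -[r]mul1r absM_le ?abs2_le1 // -[r]mul1r absM_le.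
Qed.

Lemma plank_ballV c r s a : absv c <= 1 -> r <= s -> plank c r s a -> ballV s a.
Proof.
move=> c1 rs /andP[a1 a2]; apply/ballVP; split=> //.
rewrite -[a.1](addrK (2 * c * a.2)) absB_le //; first exact: le_trans rs.
by rewrite -mulrA abs2M_le // -[s]mul1r absM_le.
Qed.

(** Points on the two axes already suffice: the directions [(2c, -1)] and [(2c', -1)] are
    independent because [2 (c - c')] is nonzero, and [t <= |2 (c - c')| s] bounds the
    coordinates. *)
Lemma plank_span c c' r s r' s' t z : absv c <= 1 -> absv c' <= 1 ->
  0 <= r -> 0 <= s -> 0 <= r' -> t <= s -> t <= s' -> t <= absv (2 * (c - c')) * s ->
  s <= s' -> (2 : K) != 0 -> c != c' -> ballV t z ->
  exists a b, [/\ plank c r s a, plank c' r' s' b & z = b + a].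
Proof.
move=> c1 c1' r0 s0 r0' ts ts' tcs ss' n2 cc' /ballVP[z1 z2].
have d0 : 2 * (c - c') != 0 by rewrite mulf_neq0 // subr_eq0.
(* The coordinate along the first axis for which the remainder [b = z - a] satisfies
   [b.1 + 2 c' b.2 = 0]. *)
pose u := (z.1 + 2 * c' * z.2) / (2 * (c - c')).
have u_le : absv u <= s.
  rewrite absM absV ler_pdivrMr ?abs_gt0 // [leRHS]mulrC; apply: le_trans tcs.
  by apply: absD_le => //; rewrite -mulrA abs2M_le // -[t]mul1r absM_le.
exists (2 * c * u, - u), (z.1 - 2 * c * u, z.2 + u); split.
- rewrite /plank /= (_ : _ + _ = 0); last by ring.
  by rewrite abs0 r0 absN.
- rewrite /plank /= (_ : _ + _ = 0); last first.
    by rewrite /u; field; rewrite subr_eq0 cc'.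
  by rewrite abs0 r0' /= absD_le // ?(le_trans z2 ts') // (le_trans u_le ss').
- by case: z z1 z2 @u u_le => z1 z2 /= _ _ _; congr pair => /=; ring.
Qed.

End Ultrametric.

(** * Additive characters *)

Section Characters.
Variables (R : rcfType) (K : fieldType) (absv : K -> R) (ch : K -> R[i]).

(** Nontriviality is stated in a form that rescales: it gives [ch_nontriv], a nontrivial value on
    every ball on which the frequency [t] is large enough, without mention of a uniformizer. *)
Definition unitary_character :=
  [/\ forall x y, ch (x + y) = ch x * ch y, forall x, normc (ch x) = 1,
      forall x, absv x <= 1 -> ch x = 1 &
      forall t, 1 < absv t -> exists2 y, absv y <= 1 & ch (t * y) != 1].

Hypothesis na : ultrametric_abs absv.
Hypothesis uc : unitary_character.

Lemma chD x y : ch (x + y) = ch x * ch y. Proof. by case: uc. Qed.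
Lemma ch_triv x : absv x <= 1 -> ch x = 1. Proof. by case: uc => _ _ + _; apply. Qed.
Lemma ch0 : ch 0 = 1. Proof. by rewrite ch_triv // abs0. Qed.

Lemma normc2_ch x : normc2 (ch x) = 1.
Proof. by case: uc => _ n1 _ _; rewrite -normc2E n1 expr1n. Qed.

Lemma chN x : ch (- x) = conjc (ch x).
Proof.
have n0 : ch x != 0 by rewrite -normc2_eq0 normc2_ch oner_neq0.
apply: (mulfI n0); rewrite -chD subrr ch0.
have := normc2_ch x; rewrite /normc2 /cdot; case: (ch x) => a b /= e.
by rewrite /GRing.mul /=; congr (Complex _ _); rewrite -?e; ring.
Qed.

Lemma ch_eq1 x y : absv (x - y) <= 1 -> ch x = ch y.
Proof. by move=> xy; rewrite -[x](subrK y) chD ch_triv // mul1r. Qed.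

Lemma ch_nontriv t b : 1 < absv (t * b) -> exists2 a, absv a <= absv b & ch (t * a) != 1.
Proof.
case: uc => _ _ _ nt /nt[y y1 n1]; exists (b * y); last by rewrite mulrA.
by rewrite -[absv b]mulr1 absM_le.
Qed.

End Characters.

(** * Caps at all scales and sums over them *)

Section Caps.
Variables (R : rcfType) (K : fieldType) (absv : K -> R) (p : R) (C : nat -> seq K).

Definition same_cap l c c' := absv (c - c') <= p ^- l.

Definition cap_centers :=
  [/\ forall l, uniq (C l), forall l c, c \in C l -> absv c <= 1,
      forall l z, absv z <= 1 -> exists2 c, c \in C l & same_cap l z c &
      forall l c c', c \in C l -> c' \in C l -> same_cap l c c' -> c = c'].

Hypothesis na : ultrametric_abs absv.
Hypothesis p2 : 2 <= p.
Hypothesis capC : cap_centers.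

Lemma p_gt0 : 0 < p. Proof. by move: p2; lra. Qed.
Lemma p_ge1 : 1 <= p. Proof. by move: p2; lra. Qed.
Lemma pX_gt0 l : 0 < p ^+ l. Proof. exact: exprn_gt0 p_gt0. Qed.
Lemma pX_ge1 l : 1 <= p ^+ l. Proof. exact: exprn_ege1 p_ge1. Qed.
Lemma pX_neq0 l : p ^+ l != 0. Proof. by rewrite gt_eqF // pX_gt0. Qed.
Lemma pV_gt0 l : 0 < p ^- l. Proof. by rewrite invr_gt0 pX_gt0. Qed.
Lemma pX_le l m : (l <= m)%N -> p ^+ l <= p ^+ m.
Proof. by move=> lm; rewrite ler_weXn2l ?p_ge1. Qed.
Lemma pV_le l m : (l <= m)%N -> p ^- m <= p ^- l.
Proof. by move=> lm; rewrite lef_pV2 ?posrE ?pX_gt0 // pX_le. Qed.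
Lemma pV_le1 l : p ^- l <= 1.
Proof. by rewrite invf_le1 ?pX_gt0 // pX_ge1. Qed.

Lemma same_cap_refl l c : same_cap l c c.
Proof. by rewrite /same_cap subrr abs0 // ltW // pV_gt0. Qed.

Lemma same_cap_sym l c c' : same_cap l c c' = same_cap l c' c.
Proof. by rewrite /same_cap absBC. Qed.

Lemma same_cap_trans l c c' c'' : same_cap l c c' -> same_cap l c' c'' -> same_cap l c c''.
Proof.
move=> h1 h2; rewrite /same_cap (_ : c - c'' = (c - c') + (c' - c'')); last by ring.
exact: absD_le.
Qed.

Lemma same_cap_le l m c c' : (l <= m)%N -> same_cap m c c' -> same_cap l c c'.
Proof. by move=> lm h; apply: le_trans h (pV_le lm). Qed.

Lemma same_cap_congr l c c' z : same_cap l c c' -> same_cap l z c = same_cap l z c'.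
Proof.
move=> h; apply/idP/idP => h'; first exact: same_cap_trans h' h.
by apply: same_cap_trans h' _; rewrite same_cap_sym.
Qed.

Lemma C_uniq l : uniq (C l). Proof. by case: capC. Qed.
Lemma C_le1 l c : c \in C l -> absv c <= 1. Proof. by case: capC => _ + _ _; apply. Qed.
Lemma C_ex l z : absv z <= 1 -> exists2 c, c \in C l & same_cap l z c.
Proof. by case: capC => _ _ + _; apply. Qed.
Lemma C_inj l c c' : c \in C l -> c' \in C l -> same_cap l c c' -> c = c'.
Proof. by case: capC => _ _ _; apply. Qed.

Lemma sum_center (W : nmodType) l (F : K -> W) (Q : pred K) c : c \in C l ->
  \sum_(c' <- C l | Q c' && same_cap l c' c) F c' = if Q c then F c else 0.
Proof.
move=> cC; rewrite big_mkcond (bigD1_seq c) //= ?C_uniq // same_cap_refl andbT.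
rewrite big_seq_cond big1 ?addr0 // => c' /andP[c'C cc'].
case: ifP => // /andP[_ /(C_inj c'C cC) e]; by rewrite e eqxx in cc'.
Qed.

(** In an ultrametric space [same_cap l] is an equivalence, so each center of [C N] lies in exactly
    one cap of scale [l]; no bounded overlap has to be counted. *)
Lemma sum_caps (W : nmodType) l N (F : K -> W) (Q : pred K) :
  (forall c c', same_cap l c c' -> Q c = Q c') ->
  \sum_(c' <- C l | Q c') \sum_(c <- C N | same_cap l c' c) F c = \sum_(c <- C N | Q c) F c.
Proof.
move=> Qn; rewrite (exchange_big_dep Q) /=; last first.
  by move=> c' c Qc' /Qn <-.
rewrite big_seq_cond [RHS]big_seq_cond; apply: eq_bigr => c /andP[cC Qc].
have [c0 c0C c0c] := C_ex l (C_le1 cC).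
rewrite (eq_bigl (fun c' => predT c' && same_cap l c' c0)); last first.
  move=> c'; rewrite /= (same_cap_congr _ c0c); case c'c: (same_cap l c' c0); rewrite ?andbF // andbT.
  by rewrite (Qn _ _ c'c) -(Qn _ _ c0c) Qc.
by rewrite sum_center.
Qed.

Lemma sum_caps_same_cap (W : nmodType) k l N (F : K -> W) c0 : (k <= l)%N ->
  \sum_(c' <- C l | same_cap k c0 c') \sum_(c <- C N | same_cap l c' c) F c =
  \sum_(c <- C N | same_cap k c0 c) F c.
Proof. by move=> kl; apply: sum_caps => c c' /(same_cap_le kl) /same_cap_congr; apply. Qed.

Lemma sum_caps_all (W : nmodType) l N (F : K -> W) :
  \sum_(c' <- C l) \sum_(c <- C N | same_cap l c' c) F c = \sum_(c <- C N) F c.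
Proof. exact: (@sum_caps _ _ _ _ predT). Qed.

Section CapSums.
Variables (ch : K -> R[i]) (N : nat) (h : K -> K * K -> R[i]).
Hypothesis uc : unitary_character absv ch.

Definition dotp (a : K * K) c := a.1 * c + a.2 * c ^+ 2.

(* Translation form of: [h c] is Fourier supported in the cap of diameter [p ^- N] at [(c, c ^ 2)]. *)
Definition equivariant := forall c x a, c \in C N ->
  plank absv c (p ^+ N) (p ^+ (2 * N)) a -> h c (x + a) = ch (- dotp a c) * h c x.

Definition capsum l c x := \sum_(c' <- C N | same_cap l c c') h c' x.

Hypothesis eq_h : equivariant.

Lemma pV2 l : p ^- l * p ^+ (2 * l) = p ^+ l.
Proof. by rewrite mul2n -addnn exprD mulKf // pX_neq0. Qed.

(** The plank dual to a cap lies in the planks dual to the smaller caps inside it, and on it the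
    phases of two centers of the cap differ by an element of the unit ball, which [ch] does not
    see. *)
Lemma capsum_equivariant l c x a : (l <= N)%N -> absv c <= 1 ->
  plank absv c (p ^+ l) (p ^+ (2 * l)) a -> capsum l c (x + a) = ch (- dotp a c) * capsum l c x.
Proof.
move=> lN c1 pa; rewrite /capsum mulr_sumr big_seq_cond [RHS]big_seq_cond.
apply: eq_bigr => c' /andP[c'C cc'].
rewrite eq_h //; last first.
  apply: plank_shift pa; rewrite ?pX_le ?leq_mul2l //.
  by apply: le_trans (pX_le lN); rewrite -[leRHS]pV2 ler_wpM2r // ltW // pX_gt0.
congr (_ * _); apply: (ch_eq1 uc); move: pa => /andP[a1 a2].
(* Expanding the phase around [c] leaves a linear term bounded by [p^-l * p^l] and a quadratic one
   bounded by [p^(-2l) * p^(2l)]. *)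
rewrite (_ : _ - _ = (c - c') * (a.1 + 2 * c * a.2) - (c - c') * ((c - c') * a.2)).
  have e : p ^- l * p ^+ l = 1 by rewrite mulVf // pX_neq0.
  apply: absB_le => //; first by rewrite -e absM_le.
  by rewrite -e absM_le // -[leRHS]pV2 absM_le.
by rewrite /dotp; ring.
Qed.

Lemma capsum_same_cap l c c' x : same_cap l c c' -> capsum l c x = capsum l c' x.
Proof. by move=> cc'; apply: eq_bigl => z; rewrite same_cap_sym (same_cap_congr _ cc') same_cap_sym. Qed.

Lemma capsum_split k l c x : (k <= l)%N ->
  capsum k c x = \sum_(c' <- C l | same_cap k c c') capsum l c' x.
Proof. by move=> kl; rewrite /capsum sum_caps_same_cap. Qed.

Lemma capsumN c x : c \in C N -> capsum N c x = h c x.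
Proof.
move=> cC; rewrite /capsum (eq_bigl (fun c' => predT c' && same_cap N c' c)) ?sum_center //.
by move=> c'; rewrite /= same_cap_sym.
Qed.

Lemma capsum_periodic l c : (l <= N)%N -> absv c <= 1 ->
  periodic (ballV absv 1) (capsum l c).
Proof.
move=> lN c1 x a a1; rewrite capsum_equivariant //.
  rewrite (ch_triv uc) ?mul1r // absN //; move/ballVP: a1 => [a1 a2].
  by apply: absD_le => //; rewrite -[1]mulr1 absM_le // absX // exprn_ile1 ?abs_ge0.
by apply: (@ballV_plank _ _ _ na _ (p ^+ l)); rewrite ?pX_le ?leq_pmull ?(ballV_le _ a1) ?pX_ge1.
Qed.

End CapSums.
End Caps.

(** * High and low frequencies of square functions *)

Section HighLow.
Variables (R : rcfType) (K : fieldType) (absv : K -> R) (p : R) (C : nat -> seq K).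
Variables (ch : K -> R[i]) (N : nat) (P0 : K) (M delta rho : R) (X : seq (K * K)).
Hypothesis na : ultrametric_abs absv.
Hypothesis uc : unitary_character absv ch.
Hypothesis p2 : 2 <= p.
Hypothesis capC : cap_centers absv p C.
Hypothesis absP0 : absv P0 = p.
Hypothesis abs2p : 1 <= p * absv 2.
Hypothesis M1 : 1 <= M.
Hypothesis countM : forall l c, c \in C l ->
  (count (fun c' => (absv (c - c') < p ^+ 2 * p ^- l)) (C l))%:R <= M.
Hypothesis countp : forall l c, absv c <= 1 ->
  (count (fun c' => absv (c - c') <= p * p ^- l) (C l))%:R <= p.
Hypotheses (delta0 : 0 <= delta) (delta1 : delta <= 1) (rho1 : p ^+ (2 * N) <= rho).
Hypothesis trX : coset_reps X (ballV absv delta) (ballV absv rho).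

Local Notation D := (ballV absv delta).
Local Notation B := (ballV absv rho).
Local Notation cball l := (ballV absv (p ^+ l)).
Local Notation same_cap := (same_cap absv p).
Local Notation tile m c := (plank absv c (p ^+ (2 * N - m)) (p ^+ (2 * N))).
Local Notation pXgt0 := (pX_gt0 p2).
Local Notation pXle := (pX_le p2).
Local Notation C_le1 := (C_le1 capC).

Lemma rho_ge0 : 0 <= rho. Proof. by apply: le_trans rho1; apply: ltW; apply: pXgt0. Qed.
Lemma delta_rho : delta <= rho.
Proof. by apply: le_trans delta1 (le_trans _ rho1); apply: pX_ge1. Qed.

Let sD : subgrp D. Proof. exact: subgrp_ballV. Qed.
Let sB : subgrp B. Proof. exact: subgrp_ballV rho_ge0. Qed.
Let sDB x : D x -> B x. Proof. exact: ballV_le delta_rho. Qed.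

Lemma two_neq0 : (2 : K) != 0.
Proof. by rewrite -(abs_gt0 na); move: p2 abs2p; nra. Qed.

Lemma intermediate_ball l : (l <= 2 * N)%N -> intermediate D B (cball l).
Proof.
move=> lN; split; first by apply: subgrp_ballV => //; apply: ltW; apply: pXgt0.
  by move=> x; apply: ballV_le; apply: le_trans delta1 _; apply: pX_ge1.
by move=> x; apply: ballV_le; apply: le_trans rho1; apply: pXle.
Qed.

Lemma intermediate_plank c r s : (r <= s)%N -> (s <= 2 * N)%N -> absv c <= 1 ->
  intermediate D B (plank absv c (p ^+ r) (p ^+ s)).
Proof.
move=> rs sN c1; split; first by apply: subgrp_plank => //; apply: ltW; apply: pXgt0.
  move=> x Dx; apply: (@ballV_plank _ _ _ na _ (p ^+ r)); rewrite ?pXle //.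
  by apply: ballV_le Dx; apply: le_trans delta1 _; apply: pX_ge1.
move=> x /(plank_ballV na c1 (pXle rs)); apply: ballV_le.
by apply: le_trans rho1; apply: pXle.
Qed.

Lemma intermediate_tile m c : absv c <= 1 -> intermediate D B (tile m c).
Proof. by move=> c1; apply: intermediate_plank => //; apply: leq_subr. Qed.

Lemma ball1D (T : Type) (g : K * K -> T) : periodic (ballV absv 1) g -> periodic D g.
Proof. by apply: periodicS => x; apply: ballV_le. Qed.

Section Family.
Variable h : K -> K * K -> R[i].
Hypothesis eq_h : equivariant absv p C ch N h.

Local Notation capsum := (capsum absv p C N h).

Definition cap_sqfun l c x := normc2 (capsum l c x).
Definition cap_energy m c x := \sum_(c' <- C N | same_cap m c c') normc2 (h c' x).
Definition sqfun_in k j c0 x := \sum_(c <- C k | same_cap j c0 c) cap_sqfun k c x.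

Lemma cap_sqfun_ge0 l c x : 0 <= cap_sqfun l c x. Proof. exact: normc2_ge0. Qed.
Lemma cap_energy_ge0 l c x : 0 <= cap_energy l c x.
Proof. by apply: sumr_ge0 => *; exact: normc2_ge0. Qed.
Lemma sqfun_in_ge0 k j c x : 0 <= sqfun_in k j c x.
Proof. by apply: sumr_ge0 => *; exact: normc2_ge0. Qed.

Lemma capsum_D l c : (l <= N)%N -> absv c <= 1 -> periodic D (capsum l c).
Proof. by move=> lN c1; apply: ball1D; exact: (capsum_periodic na p2 uc eq_h lN c1). Qed.

Lemma cap_sqfun_plank l c : (l <= N)%N -> absv c <= 1 ->
  periodic (plank absv c (p ^+ l) (p ^+ (2 * l))) (cap_sqfun l c).
Proof.
move=> lN c1 x a pa; rewrite /cap_sqfun (capsum_equivariant na p2 uc eq_h) //.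
by rewrite normc2M (normc2_ch uc) mul1r.
Qed.

Lemma cap_sqfun_D l c : (l <= N)%N -> absv c <= 1 -> periodic D (cap_sqfun l c).
Proof. by move=> lN c1 x a Da; rewrite /cap_sqfun capsum_D. Qed.

Lemma cap_sqfun_ball l c : (l <= N)%N -> absv c <= 1 -> periodic (cball l) (cap_sqfun l c).
Proof.
move=> lN c1; apply: periodicS (cap_sqfun_plank lN c1) => a.
by apply: ballV_plank => //; apply: pXle; rewrite leq_pmull.
Qed.

Lemma sum_D (T : eqType) (s : seq T) (P : pred T) (F : T -> K * K -> R) A :
  (forall i, i \in s -> periodic A (F i)) ->
  periodic A (fun x => \sum_(i <- s | P i) F i x).
Proof.
move=> pF x a Da; rewrite big_seq_cond [RHS]big_seq_cond; apply: eq_bigr.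
by move=> i /andP[si _]; apply: pF.
Qed.

Lemma sqfun_in_D k j c0 : (k <= N)%N -> periodic D (sqfun_in k j c0).
Proof. by move=> kN; apply: sum_D => c /C_le1; apply: cap_sqfun_D. Qed.

Lemma sqfun_in_ball k j c0 : (k <= N)%N -> periodic (cball k) (sqfun_in k j c0).
Proof. by move=> kN; apply: sum_D => c /C_le1; apply: cap_sqfun_ball. Qed.

Lemma normc2_h_plank c : c \in C N ->
  periodic (plank absv c (p ^+ N) (p ^+ (2 * N))) (fun x => normc2 (h c x)).
Proof. by move=> cC x a pa; rewrite eq_h // normc2M (normc2_ch uc) mul1r. Qed.

Lemma normc2_h_ball c : c \in C N -> periodic (cball N) (fun x => normc2 (h c x)).
Proof.
move=> cC; apply: periodicS (normc2_h_plank cC) => a.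
by apply: ballV_plank; rewrite ?(C_le1 cC) ?pXle ?leq_pmull.
Qed.

Lemma cap_energy_ball m c : periodic (cball N) (cap_energy m c).
Proof. by apply: sum_D => c' /normc2_h_ball. Qed.

Lemma cap_energy_D m c : periodic D (cap_energy m c).
Proof.
apply: periodicS (cap_energy_ball m c) => x; apply: ballV_le.
by apply: le_trans delta1 _; apply: pX_ge1.
Qed.

Lemma sqfun_inN j c : sqfun_in N j c =1 cap_energy j c.
Proof.
move=> x; rewrite /sqfun_in /cap_energy big_seq_cond [RHS]big_seq_cond.
apply: eq_bigr => c' /andP[c'C _].
by rewrite /cap_sqfun (capsumN na p2 capC).
Qed.

(** A horizontal translation [(a, 0)] with [|a| <= p^l] lies in both dual planks and in the
    averaging ball, and multiplies the product by [ch ((c' - c) * a)], which is nontrivial for a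
    suitable [a] since [|c - c'| > p^-l]. *)
Lemma low_orthogonality l i c c' x : (l <= N)%N -> (l <= i <= 2 * N)%N ->
  absv c <= 1 -> absv c' <= 1 -> ~~ same_cap l c c' ->
  mean X (cball i) (fun y => cdot (capsum l c y) (capsum l c' y)) x = 0.
Proof.
move=> lN /andP[li iN] c1 c1' ncc'.
have [a a_le cha] : exists2 a, absv a <= absv (P0 ^+ l) & ch ((c' - c) * a) != 1.
  apply: (ch_nontriv na uc); rewrite absM // absX // absP0.
  move: ncc'; rewrite /same_cap absBC // -ltNge => lt1.
  by rewrite -(ltr_pdivrMr _ _ (pXgt0 l)) mul1r.
rewrite absX // absP0 in a_le.
have ba : cball l (a, 0) by apply/ballVP; rewrite /= a_le abs0 // ltW // pXgt0.
pose G y := capsum l c y * conjc (capsum l c' y).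
have G_D : periodic D G by move=> y d Dd; rewrite /G !capsum_D.
have pl d : absv d <= 1 -> plank absv d (p ^+ l) (p ^+ (2 * l)) (a, 0).
  by move=> d1; apply: ballV_plank ba; rewrite ?pXle ?leq_pmull.
rewrite -[RHS](@mean_equivariant0 _ _ X D B sD trX (cball i) G (ch ((c' - c) * a)) (a, 0) x) //.
- by apply: mean_ext => // y _; rewrite cdotE.
- exact: intermediate_ball.
- by apply: ballV_le ba; apply: pXle.
move=> y; rewrite /G !(capsum_equivariant na p2 uc eq_h) // ?pl //.
rewrite conjcM -(chN na uc) opprK mulrACA -(chD uc); congr (ch _ * _).
by rewrite /dotp /=; ring.
Qed.

Lemma sum_cdot_orthogonal c c' : c \in C N -> c' \in C N -> c != c' ->
  \sum_(x <- X) cdot (h c x) (h c' x) = 0.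
Proof.
move=> cC c'C ne; have [c1 c1'] := (C_le1 cC, C_le1 c'C).
rewrite (eq_bigr (fun x => cdot (capsum N c x) (capsum N c' x))) => [|x _]; last first.
  by rewrite !(capsumN na p2 capC).
rewrite -(sum_mean sD sB sDB trX (H := cball N)); last 2 first.
- by apply: intermediate_ball; rewrite leq_pmull.
- by move=> x d Dd; rewrite !capsum_D.
apply: big1 => x _; apply: low_orthogonality => //; first by rewrite leqnn leq_pmull.
by apply: contra ne => /(C_inj capC cC c'C) ->.
Qed.

(** The caps of scale [N] are orthogonal in L^2, so a vanishing sum has vanishing terms. This
    compares activity, defined by the smallest caps, with the number [ncaps] of caps whose own
    projection is nonzero. *)
Lemma capsum_eq0 l c c' : (forall x, x \in X -> capsum l c x = 0) -> c' \in C N ->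
  same_cap l c c' -> forall x, x \in X -> h c' x = 0.
Proof.
move=> z c'C cc'; have : \sum_(x <- X) cdot (capsum l c x) (h c' x) = 0.
  by rewrite big_seq big1 // => x /z ->; rewrite cdot0l.
under eq_bigr do rewrite cdot_suml.
rewrite exchange_big -big_filter (bigD1_seq c') /=; last 2 first.
- by rewrite mem_filter cc'.
- by apply: filter_uniq; apply: (C_uniq capC).
rewrite [X in _ + X]big_seq_cond [X in _ + X]big1 ?addr0 => [/eqP|d]; last first.
  by rewrite mem_filter => /andP[/andP[_ dC] ne]; apply: sum_cdot_orthogonal.
rewrite psumr_eq0 => [/allP h0 x xX|x _]; last exact: normc2_ge0.
by have := h0 x xX; rewrite /= -/(normc2 _) normc2_eq0 => /eqP.
Qed.

Lemma normc2_sum (T : eqType) (s : seq T) (P : pred T) (F : T -> R[i]) :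
  normc2 (\sum_(i <- s | P i) F i) =
  \sum_(i <- s | P i) \sum_(j <- s | P j) cdot (F i) (F j).
Proof. by rewrite /normc2 cdot_suml; apply: eq_bigr => i _; rewrite cdot_sumr. Qed.

(** Expanding the square, the average kills all off-diagonal terms; as balls are groups, this is an
    identity and not just an estimate. *)
Lemma low_lemma k l i c x : (k <= l <= N)%N -> (l <= i <= 2 * N)%N -> absv c <= 1 ->
  mean X (cball i) (cap_sqfun k c) x = mean X (cball i) (sqfun_in l k c) x.
Proof.
move=> /andP[kl lN] li c1.
rewrite (@mean_ext _ _ _ _ _ (fun y => \sum_(c1 <- C l | same_cap k c c1)
  \sum_(c2 <- C l | same_cap k c c2) cdot (capsum l c1 y) (capsum l c2 y))); last first.
  by move=> y _; rewrite /cap_sqfun (capsum_split na p2 capC _ _ _ _ kl) normc2_sum.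
rewrite /sqfun_in !mean_sum -!(big_filter (C l)); set s := seq.filter _ _.
have us : uniq s by apply: filter_uniq; apply: (C_uniq capC).
have sC a : a \in s -> a \in C l by rewrite mem_filter => /andP[].
rewrite big_seq [RHS]big_seq; apply: eq_bigr => a sa.
rewrite mean_sum -big_filter -/s (bigD1_seq a) //= big_seq_cond big1 ?addr0 // => b /andP[sb ba].
apply: (low_orthogonality x lN li); rewrite ?(C_le1 (sC _ _)) //.
apply: contra ba => /(C_inj capC) -> //; exact: sC.
Qed.

(** Since [|2| >= 1 / p], separation [p^2 * p^-l] gives [|2 (c - c')| >= p * p^-l]: exactly what
    [plank_span] needs to fill the ball of radius [p^(l+1)], one step beyond the width [p^l] of the
    planks. *)
Lemma far_separated l c c' : ~~ (absv (c - c') < p ^+ 2 * p ^- l) ->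
  p ^+ l.+1 <= absv (2 * (c - c')) * p ^+ (2 * l) /\ c != c'.
Proof.
rewrite -leNgt => far; split; last first.
  apply: contraTneq far => ->; rewrite subrr abs0 // -ltNge mulr_gt0 ?pXgt0 ?pV_gt0 //.
rewrite absM // (_ : p ^+ l.+1 = 1 * (p * p ^+ l)); last by rewrite mul1r exprS.
have -> : absv 2 * absv (c - c') * p ^+ (2 * l) =
  (p * absv 2) * (absv (c - c') / p * p ^+ (2 * l)) by field; rewrite gt_eqF ?p_gt0.
have p0 := p_gt0 p2; have pl := pXgt0 l.
rewrite ler_pM ?mulr_ge0 ?(ltW p0) ?(ltW pl) //.
rewrite (_ : p ^+ (2 * l) = p ^+ l * p ^+ l); last by rewrite mul2n -addnn exprD.
rewrite mulrA ler_pM2r // mulrAC ler_pdivlMr //.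
by rewrite -(ler_pM2r (pV_gt0 p2 l)) mulfK ?gt_eqF // -expr2.
Qed.

Lemma count_far l c j c0 : c \in [seq c <- C l | same_cap j c0 c] ->
  (count (fun c' => absv (c - c') < p ^+ 2 * p ^- l) [seq c <- C l | same_cap j c0 c])%:R <= M.
Proof.
rewrite mem_filter => /andP[_ cC]; apply: le_trans (countM cC).
by rewrite ler_nat count_filter; apply: sub_count => z /andP[].
Qed.

Lemma C0_same_cap c c' : c \in C 0 -> c' \in C 0 -> absv (c - c') < p ^+ 2 * p ^- 0.
Proof.
move=> cC c'C; apply: (@le_lt_trans _ _ 1); first by apply: absB_le; rewrite ?(C_le1 cC) ?(C_le1 c'C).
by rewrite expr0 divr1 expr2; move: p2; nra.
Qed.

(** [high_lemma] for the band between the radii [p^l] and [p^(l+1)]: each [cap_sqfun l c] is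
    constant along its dual plank, and planks of far caps are transverse there. *)
Lemma high_step l j c0 : (l < N)%N ->
  \sum_(x <- X) mean X (cball l) (sqfun_in l j c0) x ^+ 2 -
  \sum_(x <- X) mean X (cball l.+1) (sqfun_in l j c0) x ^+ 2 <=
  M * \sum_(c <- C l | same_cap j c0 c) \sum_(x <- X) cap_sqfun l c x ^+ 2.
Proof.
move=> lN; have lN' := ltnW lN.
have i1 : intermediate D B (cball l) by apply: intermediate_ball; lia.
have i2 : intermediate D B (cball l.+1) by apply: intermediate_ball; lia.
have e : sqfun_in l j c0 =1 fun y => \sum_(c <- [seq c <- C l | same_cap j c0 c]) cap_sqfun l c y.
  by move=> y; rewrite big_filter.
under eq_bigr do rewrite (mean_eq X _ e).
under [X in _ - X]eq_bigr do rewrite (mean_eq X _ e).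
rewrite -(big_filter (C l)); set s := seq.filter _ _.
have sC c : c \in s -> c \in C l by rewrite mem_filter => /andP[].
apply: le_trans (@high_lemma _ _ X D B sD sB sDB trX _ s
  (fun c c' => absv (c - c') < p ^+ 2 * p ^- l)
  (fun c => plank absv c (p ^+ l) (p ^+ (2 * l))) (cap_sqfun l) M (cball l) (cball l.+1)
  i1 i2 _ _ _ _ _) _.
- by move=> y; apply: ballV_le; apply: pXle.
- move=> c /sC /C_le1 c1; split; [exact: cap_sqfun_D | exact: cap_sqfun_plank].
- by move=> c c'; rewrite absBC.
- by move=> c cs; apply: (@count_far l c j c0 cs).
- move=> c c' cs cs' far z bz.
  have [c1 c1'] := (C_le1 (sC _ cs), C_le1 (sC _ cs')).
  (* Far pairs do not exist at scale 0; for positive [l] the inequality [l + 1 <= 2 l] keeps the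
     ball within the length of the planks. *)
  have l0 : (0 < l)%N.
    rewrite lt0n; apply: contraNneq far => l0; move: (sC _ cs) (sC _ cs'); rewrite l0.
    exact: C0_same_cap.
  have [sep ne] := far_separated far.
  have ll : (l.+1 <= 2 * l)%N by move: l0; clear; lia.
  have lN2 : (2 * l <= 2 * N)%N by rewrite leq_mul2l.
  have pp : p ^+ l.+1 <= p ^+ (2 * l) by apply: pXle.
  have [a [b [pa pb ->]]] := plank_span na c1 c1' (ltW (pXgt0 l)) (ltW (pXgt0 (2 * l)))
    (ltW (pXgt0 l)) pp pp sep (lexx _) two_neq0 ne bz.
  exists a, b; split=> //; apply: ballV_le (plank_ballV na c1' _ pb).
    by apply: le_trans rho1; apply: pXle.
  by apply: pXle; rewrite leq_pmull.
rewrite ler_wpM2l ?(le_trans _ M1) // big_seq [leRHS]big_seq; apply: ler_sum => c /sC /C_le1 c1.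
by apply: (energy_le sD sB sDB trX i1); apply: cap_sqfun_D.
Qed.

Lemma tile_sub_ball m c a : absv c <= 1 -> cball (2 * N - m) a -> tile m c a.
Proof. by move=> c1; apply: ballV_plank => //; apply: pXle; apply: leq_subr. Qed.

(** For each small cap [c'] a tile vector splits into a horizontal part, absorbed by the averaging
    ball, and a part along the axis of [c'], under which [normc2 (h c')] is invariant. Hence, by
    [wave_mean], averaging over the ball is the same as averaging over the tile. *)
Lemma mean_cap_energy_tile m c : (m <= N)%N -> absv c <= 1 ->
  periodic (tile m c) (mean X (cball (2 * N - m)) (cap_energy m c)).
Proof.
move=> mN c1 x a Ua; rewrite !mean_sum big_seq_cond [RHS]big_seq_cond.
apply: eq_bigr => c' /andP[c'C cc'].
have c'1 := C_le1 c'C.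
have Ua' : tile m c' a.
  apply: plank_shift Ua => //.
  have -> : p ^+ (2 * N - m) = p ^- m * p ^+ (2 * N).
    have mN2 : (m <= 2 * N)%N by apply: leq_trans mN _; rewrite leq_pmull.
    by rewrite -{2}(subnKC mN2) exprD mulKf // gt_eqF // pXgt0.
  by rewrite ler_wpM2r // ltW // pXgt0.
have -> : x + a = x + (a.1 + 2 * c' * a.2, 0) + (- (2 * c' * a.2), a.2).
  case: x a {Ua Ua'} => x1 x2 [a1 a2]; congr pair => /=; ring.
have [u1 u2] := andP Ua'.
rewrite (mean_periodic_in X _ (normc2_h_plank c'C)); last first.
  rewrite /plank /= (_ : _ + _ = 0); last by ring.
  by rewrite abs0 // ltW // pXgt0.
apply: (mean_shift sD trX).
- by apply: intermediate_ball; rewrite leq_subr.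
- apply: periodicS (normc2_h_ball c'C) => y; apply: ballV_le.
  by apply: le_trans delta1 _; apply: pX_ge1.
- by apply/ballVP; rewrite /= abs0 // u1 ltW // pXgt0.
Qed.

Lemma wave_mean m c x : (m <= N)%N -> absv c <= 1 ->
  mean X (cball (2 * N - m)) (cap_energy m c) x = mean X (tile m c) (cap_energy m c) x.
Proof.
move=> mN c1; have iU := intermediate_tile m c1.
have iB : intermediate D B (cball (2 * N - m)) by apply: intermediate_ball; rewrite leq_subr.
rewrite -(mean_mean sD sB trX x iB iU _ (@cap_energy_D m c)); last by move=> y; apply: tile_sub_ball.
by rewrite (mean_id sB trX _ iU) //; apply: mean_cap_energy_tile.
Qed.

Definition wave_sum j c0 m :=
  \sum_(c <- C m | same_cap j c0 c) \sum_(x <- X) mean X (tile m c) (cap_energy m c) x ^+ 2.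

Definition low_energy j c0 m := \sum_(x <- X) mean X (cball (2 * N - m)) (cap_energy j c0) x ^+ 2.

(** One band of the square function of the smallest caps. Grouped by caps of scale [m + 1], the
    averaged energies are constant along the tiles of that scale, and the tiles of far caps are
    transverse. *)
Lemma low_energy_step j c0 m : (j <= m.+1)%N -> (m < N)%N ->
  low_energy j c0 m.+1 - low_energy j c0 m <= M * wave_sum j c0 m.+1.
Proof.
move=> jm mN; have mN2 : (m.+1 <= 2 * N)%N by apply: leq_trans mN _; rewrite leq_pmull.
have e2 : (2 * N - m)%N = (2 * N - m.+1).+1 by rewrite subnSK.
rewrite /low_energy e2; set n := (2 * N - m.+1)%N.
have nN : (n.+1 <= 2 * N)%N by rewrite /n -e2 leq_subr.
have i1 : intermediate D B (cball n) by apply: intermediate_ball; apply: ltnW.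
have i2 : intermediate D B (cball n.+1) by apply: intermediate_ball.
have sub y : cball n y -> cball n.+1 y by apply: ballV_le; apply: pXle.
rewrite /wave_sum -(big_filter (C m.+1)); set s := seq.filter _ _.
have sC c : c \in s -> c \in C m.+1 by rewrite mem_filter => /andP[].
pose F c := mean X (cball n) (cap_energy m.+1 c).
have sumF y : \sum_(c <- s) F c y = mean X (cball n) (cap_energy j c0) y.
  rewrite -(mean_sum X _ _ predT) /=; apply: mean_ext => z _.
  by rewrite big_filter /cap_energy (sum_caps_same_cap na p2 capC).
have pE := @cap_energy_D j c0.
(* Averaging first over [cball n] changes no average over a larger subgroup, and makes each group
   constant along its tile. *)
have e1 H (iH : intermediate D B H) (subH : forall y, cball n y -> H y) :
    \sum_(x <- X) mean X H (cap_energy j c0) x ^+ 2 =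
    \sum_(x <- X) mean X H (fun y => \sum_(c <- s) F c y) x ^+ 2.
  apply: eq_bigr => x _.
  by rewrite -(mean_mean sD sB trX x i1 iH subH pE) (mean_eq X H sumF).
rewrite (e1 _ i1 (fun y h => h)) (e1 _ i2 sub).
apply: le_trans (@high_lemma _ _ X D B sD sB sDB trX _ s
  (fun c c' => absv (c - c') < p ^+ 2 * p ^- m.+1)
  (fun c => tile m.+1 c) F M (cball n) (cball n.+1) i1 i2 sub _ _ _ _) _.
- move=> c /sC /C_le1 c1; split; last exact: mean_cap_energy_tile.
  by apply: mean_periodic_in; apply: cap_energy_D.
- by move=> c c'; rewrite absBC.
- by move=> c cs; apply: (@count_far m.+1 c j c0 cs).
- move=> c c' cs cs' far z bz.
  have [c1 c1'] := (C_le1 (sC _ cs), C_le1 (sC _ cs')).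
  have [sep ne] := far_separated far.
  have pp : p ^+ n.+1 <= p ^+ (2 * N) by apply: pXle.
  (* [far_separated] at scale [m + 1], multiplied by [p^(2N - 2(m+1))]. *)
  have sep' : p ^+ n.+1 <= absv (2 * (c - c')) * p ^+ (2 * N).
    have e3 : (2 * N = 2 * m.+1 + (2 * N - 2 * m.+1))%N by rewrite subnKC // leq_mul2l.
    have e4 : (n.+1 = m.+2 + (2 * N - 2 * m.+1))%N by rewrite /n; move: mN; clear; lia.
    by rewrite e3 e4 !exprD mulrA ler_wpM2r // ltW // pXgt0.
  have [a [b [pa pb ->]]] := plank_span na c1 c1' (ltW (pXgt0 n)) (ltW (pXgt0 (2 * N)))
    (ltW (pXgt0 n)) pp pp sep' (lexx _) two_neq0 ne bz.
  exists a, b; split=> //; apply: ballV_le rho1 (plank_ballV na c1' _ pb).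
  by apply: pXle; rewrite leq_subr.
rewrite ler_wpM2l ?(le_trans _ M1) // big_seq [leRHS]big_seq; apply: ler_sum => c /sC /C_le1 c1.
apply: ler_sum => x _; rewrite /F (mean_mean sD sB trX x i1 i1 (fun y h => h) (@cap_energy_D _ _)).
by rewrite /n wave_mean.
Qed.

Lemma low_energyN j c0 : low_energy j c0 N = \sum_(x <- X) cap_energy j c0 x ^+ 2.
Proof.
rewrite /low_energy (_ : (2 * N - N = N)%N); last by rewrite mul2n -addnn addnK.
apply: eq_bigr => x _; rewrite (mean_id sB trX) //; last exact: cap_energy_ball.
by apply: intermediate_ball; rewrite leq_pmull.
Qed.

Lemma low_energy_tile k c : (k <= N)%N -> absv c <= 1 ->
  low_energy k c k = \sum_(x <- X) mean X (tile k c) (cap_energy k c) x ^+ 2.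
Proof. by move=> kN c1; apply: eq_bigr => x _; rewrite wave_mean. Qed.

Lemma low_energy_telescope j c0 k : (j <= k <= N)%N ->
  low_energy j c0 N - low_energy j c0 k <= M * \sum_(k.+1 <= m < N.+1) wave_sum j c0 m.
Proof.
move=> /andP[jk kN]; rewrite -(telescope_sumr _ kN) big_add1 /= mulr_sumr.
rewrite big_nat [leRHS]big_nat; apply: ler_sum => m /andP[km mN].
by apply: low_energy_step => //; apply: leq_trans jk _; apply: leqW.
Qed.

Definition cap_L4 l c := \sum_(x <- X) cap_sqfun l c x ^+ 2.

(** Square functions of different scales agree after averaging. This lets the scale of the square
    function follow the radius in [high_energy]. *)
Lemma sqfun_in_mean j k l i c0 x : (j <= k <= l)%N -> (l <= N)%N -> (l <= i <= 2 * N)%N ->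
  mean X (cball i) (sqfun_in k j c0) x = mean X (cball i) (sqfun_in l j c0) x.
Proof.
move=> /andP[jk kl] lN li; rewrite mean_sum big_seq_cond.
rewrite (eq_bigr (fun c => mean X (cball i) (sqfun_in l k c) x)) => [|c /andP[cC _]]; last first.
  by rewrite (@low_lemma k l i) ?kl // (C_le1 cC).
rewrite -big_seq_cond -mean_sum; apply: mean_ext => y _.
by rewrite /sqfun_in (sum_caps_same_cap na p2 capC).
Qed.

(** Two regimes of radii. From [p^k] to [p^N] the scale of the square function increases with the
    radius, and each band costs L^4 norms of caps. From [p^N] to [p^(2N - k)] the square function is
    that of the smallest caps, and each band costs wave envelope sums. *)
Lemma high_energy j k c0 : (j <= k <= N)%N ->
  \sum_(x <- X) (sqfun_in k j c0 x - mean X (cball (2 * N - k)) (sqfun_in k j c0) x) ^+ 2 <=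
  M * \sum_(k <= l < N) \sum_(c <- C l | same_cap j c0 c) cap_L4 l c +
  M * \sum_(k.+1 <= m < N.+1) wave_sum j c0 m.
Proof.
move=> /andP[jk kN].
have kN2 : (2 * N - k <= 2 * N)%N by rewrite leq_subr.
have Nk : (N <= 2 * N - k)%N by rewrite mul2n -addnn -addnBA // leq_addr.
rewrite (energy_diff1 sD sB sDB trX (intermediate_ball kN2)); last exact: sqfun_in_D.
have -> : \sum_(x <- X) mean X (cball (2 * N - k)) (sqfun_in k j c0) x ^+ 2 = low_energy j c0 k.
  apply: eq_bigr => x _; rewrite (@sqfun_in_mean j k N) ?jk ?kN ?Nk //.
  by rewrite (mean_eq X _ (sqfun_inN j c0)).
have jkN : (j <= k <= N)%N by rewrite jk.
have tel := low_energy_telescope c0 jkN.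
pose E l := \sum_(x <- X) mean X (cball l) (sqfun_in l j c0) x ^+ 2.
have Ek : \sum_(x <- X) sqfun_in k j c0 x ^+ 2 = E k.
  apply: eq_bigr => x _; rewrite (mean_id sB trX) //; last exact: sqfun_in_ball.
  by apply: intermediate_ball; apply: leq_trans kN _; rewrite leq_pmull.
have EN : low_energy j c0 N = E N.
  rewrite low_energyN; apply: eq_bigr => x _; rewrite (mean_id sB trX).
  - by rewrite sqfun_inN.
  - by apply: intermediate_ball; rewrite leq_pmull.
  - exact: sqfun_in_ball.
have : E k - E N <= M * \sum_(k <= l < N) \sum_(c <- C l | same_cap j c0 c) cap_L4 l c.
  rewrite -opprB -(telescope_sumr _ kN) -sumrN mulr_sumr big_nat [leRHS]big_nat.
  apply: ler_sum => l /andP[kl lN]; rewrite opprB.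
  apply: le_trans (high_step _ _ lN).
  rewrite lerB // le_eqVlt; apply/orP; left; apply/eqP; apply: eq_bigr => x _.
  have ll : (l.+1 <= l.+1 <= 2 * N)%N by rewrite leqnn (leq_trans lN) // leq_pmull.
  (* The end of one band is the start of the next once [sqfun_in l] is replaced by [sqfun_in l.+1]
     under the average. *)
  rewrite -(@sqfun_in_mean j l l.+1) // ?(leq_trans jk kl) ?leqnSn //.
move=> hE; move: tel; rewrite Ek EN => tel; lra.
Qed.

(** * Products of two caps: bilinear estimates and Cordoba's inequality *)

Lemma pair_schur (T : eqType) (s1 s2 : seq T) (rel : rel (T * T)) (f : T -> K * K -> R[i])
  (W : pred (K * K)) (M' : R) :
  let s := [seq (a, b) | a <- s1, b <- s2] in
  (forall i j, i \in s -> j \in s -> rel i j = rel j i) ->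
  (forall i, i \in s -> (count (rel i) s)%:R <= M') ->
  (forall i j, i \in s -> j \in s -> ~~ rel i j ->
     \sum_(x <- X | W x) cdot (f i.1 x * f i.2 x) (f j.1 x * f j.2 x) = 0) ->
  \sum_(x <- X | W x) normc2 (\sum_(a <- s1) f a x) * normc2 (\sum_(b <- s2) f b x) <=
  M' * \sum_(x <- X | W x) (\sum_(a <- s1) normc2 (f a x)) * (\sum_(b <- s2) normc2 (f b x)).
Proof.
move=> s sym deg orth; pose g i x := f i.1 x * f i.2 x.
have -> : \sum_(x <- X | W x) normc2 (\sum_(a <- s1) f a x) * normc2 (\sum_(b <- s2) f b x) =
    \sum_(i <- s) \sum_(j <- s) \sum_(x <- X | W x) cdot (g i x) (g j x).
  under [RHS]eq_bigr do rewrite exchange_big /=.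
  rewrite exchange_big /=; apply: eq_bigr => x _.
  rewrite -normc2M -normc2_sum; congr normc2.
  rewrite /s big_allpairs mulr_suml; apply: eq_bigr => a _; by rewrite mulr_sumr.
have -> : \sum_(x <- X | W x) (\sum_(a <- s1) normc2 (f a x)) * (\sum_(b <- s2) normc2 (f b x)) =
    \sum_(i <- s) \sum_(x <- X | W x) normc2 (g i x).
  rewrite exchange_big /=; apply: eq_bigr => x _.
  rewrite /s big_allpairs mulr_suml; apply: eq_bigr => a _.
  by rewrite mulr_sumr; apply: eq_bigr => b _; rewrite normc2M.
apply: (schur_test sym deg) => // [i|i j].
  by apply: sumr_ge0 => x _; apply: normc2_ge0.
rewrite -big_split mulr_suml; apply: ler_sum => x _; exact: cdot_le.
Qed.

(** The restriction to [W] does no harm because [W] is invariant under the translation that produces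
    the nontrivial phase; this is what makes local bilinear estimates possible. *)
Lemma quad_orthogonal l c1 c2 c3 c4 (W : pred (K * K)) a : (l <= N)%N ->
  absv c1 <= 1 -> absv c2 <= 1 -> absv c3 <= 1 -> absv c4 <= 1 ->
  plank absv c1 (p ^+ l) (p ^+ (2 * l)) a -> plank absv c2 (p ^+ l) (p ^+ (2 * l)) a ->
  plank absv c3 (p ^+ l) (p ^+ (2 * l)) a -> plank absv c4 (p ^+ l) (p ^+ (2 * l)) a ->
  periodic D W -> (forall x, W (x + a) = W x) ->
  ch (dotp a c3 + dotp a c4 - dotp a c1 - dotp a c2) != 1 ->
  \sum_(x <- X | W x) cdot (capsum l c1 x * capsum l c2 x) (capsum l c3 x * capsum l c4 x) = 0.
Proof.
move=> lN c1l c2l c3l c4l a1 a2 a3 a4 WD Wa cha.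
pose G x := if W x then capsum l c1 x * capsum l c2 x * conjc (capsum l c3 x * capsum l c4 x) else 0.
rewrite big_mkcond (eq_bigr (fun x => complex.Re (G x))) => [|x _]; last first.
  by rewrite /G; case: (W x) => //; rewrite cdotE.
have -> : \sum_(x <- X) complex.Re (G x) = complex.Re (\sum_(x <- X) G x).
  by elim/big_rec2: _ => // y u v _ ->; rewrite ReD.
have Ba : B a.
  apply: ballV_le (plank_ballV na c1l _ a1); last by apply: pXle; rewrite leq_pmull.
  by apply: le_trans rho1; apply: pXle; rewrite leq_mul2l.
rewrite (@sum_equivariant0 _ _ X D B sD sB sDB trX G _ a _ Ba _ cha) //.
  by move=> x d Dd; rewrite /G WD // !capsum_D.
move=> x; rewrite /G Wa; case: (W x); last by rewrite mulr0.
rewrite !(capsum_equivariant na p2 uc eq_h) // !conjcM -!(chN na uc) !opprK.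
have -> : dotp a c3 + dotp a c4 - dotp a c1 - dotp a c2 =
  (- dotp a c1) + (- dotp a c2) + (dotp a c3 + dotp a c4) by ring.
by rewrite !(chD uc); ring.
Qed.

(** Horizontal translations detect the first coordinates of the frequencies only, hence the
    difference of the two sums. *)
Lemma quad_orthogonal_sum l c1 c2 c3 c4 (W : pred (K * K)) : (l <= N)%N ->
  absv c1 <= 1 -> absv c2 <= 1 -> absv c3 <= 1 -> absv c4 <= 1 ->
  periodic (cball l) W -> ~~ same_cap l (c1 + c2) (c3 + c4) ->
  \sum_(x <- X | W x) cdot (capsum l c1 x * capsum l c2 x) (capsum l c3 x * capsum l c4 x) = 0.
Proof.
move=> lN c1l c2l c3l c4l Wl; rewrite /same_cap -ltNge => far.
have [a a_le cha] : exists2 a, absv a <= absv (P0 ^+ l) & ch ((c3 + c4 - (c1 + c2)) * a) != 1.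
  apply: (ch_nontriv na uc); rewrite absM // absX // absP0 absBC //.
  by rewrite -(ltr_pdivrMr _ _ (pXgt0 l)) mul1r.
rewrite absX // absP0 in a_le.
have ba : cball l (a, 0) by apply/ballVP; rewrite /= a_le abs0 // ltW // pXgt0.
have pl d : absv d <= 1 -> plank absv d (p ^+ l) (p ^+ (2 * l)) (a, 0).
  by move=> d1; apply: ballV_plank ba; rewrite ?pXle ?leq_pmull.
apply: (@quad_orthogonal _ _ _ _ _ _ (a, 0)); rewrite ?pl //.
- by apply: periodicS Wl => x; apply: ballV_le; apply: le_trans delta1 _; apply: pX_ge1.
- by move=> x; apply: Wl.
- by apply: contra cha => /eqP <-; apply/eqP; congr ch; rewrite /dotp /=; ring.
Qed.

(* When [c1 + c2 = c3 + c4], the second coordinates of the frequencies differ by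
   [2 (c1 - c3) (c1 - c4)]. *)
Lemma quad_orthogonal_prod l c1 c2 c3 c4 (W : pred (K * K)) b : (l <= N)%N ->
  absv c1 <= 1 -> absv c2 <= 1 -> absv c3 <= 1 -> absv c4 <= 1 ->
  periodic D W -> (forall x d, absv d <= absv b -> W (x + (- (2 * c1 * d), d)) = W x) ->
  absv (2 * (c1 - c3) * b) <= p ^+ l -> absv (2 * (c1 - c4) * b) <= p ^+ l ->
  absv b <= p ^+ (2 * l) -> 1 < absv (2 * (c1 - c3) * (c1 - c4) * b) ->
  same_cap l (c1 + c2) (c3 + c4) ->
  \sum_(x <- X | W x) cdot (capsum l c1 x * capsum l c2 x) (capsum l c3 x * capsum l c4 x) = 0.
Proof.
move=> lN c1l c2l c3l c4l WD Wb ub yb bl big nr.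
(* Moving [c2] within its cap makes the sum condition exact, so only the second coordinates
   contribute to the phase. *)
pose c2' := c3 + c4 - c1.
have c2n : same_cap l c2 c2' by move: nr; rewrite /same_cap /c2'; congr (absv _ <= _); ring.
have c2'l : absv c2' <= 1 by apply: absB_le => //; apply: absD_le.
under eq_bigr do rewrite (capsum_same_cap C na N h _ c2n).
have [d d_le chd] := ch_nontriv na uc big.
have small e : absv (2 * e * b) <= p ^+ l -> absv (2 * e * d) <= p ^+ l.
  by apply: le_trans; rewrite !(absM na) ler_wpM2l ?mulr_ge0 ?abs_ge0.
have pl e : absv (2 * (c1 - e) * d) <= p ^+ l ->
    plank absv e (p ^+ l) (p ^+ (2 * l)) (- (2 * c1 * d), d).
  move=> he; rewrite /plank /= (le_trans d_le bl) andbT -absN //.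
  by rewrite (_ : - _ = 2 * (c1 - e) * d) //; ring.
apply: (@quad_orthogonal _ _ _ _ _ _ (- (2 * c1 * d), d)) => //.
- by apply: pl; rewrite subrr mulr0 mul0r abs0 // ltW // pXgt0.
- apply: pl; rewrite (_ : _ * d = 2 * (c1 - c3) * d + 2 * (c1 - c4) * d).
    by apply: absD_le => //; apply: small.
  by rewrite /c2'; ring.
- by apply: pl; apply: small.
- by apply: pl; apply: small.
- by move=> x; apply: Wb.
apply: contra chd => /eqP e; apply/eqP; rewrite -[RHS]conjc1 -e -(chN na uc).
by congr ch; rewrite /dotp /c2' /=; ring.
Qed.

Lemma count_le1 (T : eqType) (s : seq T) (P : pred T) : uniq s ->
  (forall a b, a \in s -> b \in s -> P a -> P b -> a = b) -> (count P s <= 1)%N.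
Proof.
move=> us inj; have [/hasP[a as_ Pa]|/hasPn nP] := boolP (has P s); last first.
  by rewrite (eq_in_count (a2 := pred0)) ?count_pred0 // => x /nP /negbTE.
by rewrite (eq_in_count (a2 := pred1 a)) ?count_uniq_mem ?leq_b1 // => x xs /=;
  apply/idP/eqP => [Px|->//]; apply: inj.
Qed.

Lemma count_allpairs_le (s1 s2 : seq K) (P : pred K) (rel : rel K) (M' : R) :
  uniq s2 -> (count P s1)%:R <= M' ->
  (forall a b b', a \in s1 -> b \in s2 -> b' \in s2 -> rel a b -> rel a b' -> b = b') ->
  (count (fun i => P i.1 && rel i.1 i.2) [seq (a, b) | a <- s1, b <- s2])%:R <= M'.
Proof.
move=> u2 cP inj; apply: le_trans cP; rewrite ler_nat.
rewrite -!sum1_count big_mkcond big_allpairs /= [leqRHS]big_mkcond big_seq [leqRHS]big_seq.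
apply: leq_sum => a as1; case: (P a) => /=; last by rewrite big1.
by rewrite -big_mkcond sum1_count count_le1 // => b b' bs bs'; apply: inj as1 bs bs'.
Qed.

Lemma count_allpairs_swap (s1 s2 : seq K) (P : pred (K * K)) :
  count P [seq (a, b) | a <- s1, b <- s2] =
  count (fun i => P (i.2, i.1)) [seq (b, a) | b <- s2, a <- s1].
Proof.
by rewrite -!sum1_count big_mkcond [RHS]big_mkcond !big_allpairs exchange_big.
Qed.

(** If the sums agree, the phase is governed by [2 (c1 - c3) (c1 - c4)]. Since [c1] and [c4] lie in
    distinct children, [|c1 - c4| > p^-(j+1)], so only the [c3] close to [c1] survive: at most [M]
    of them, and the sum then fixes [c4]. *)
Lemma local_bilinear j k c0 a1 a2 (W : pred (K * K)) : (j < k <= N)%N -> absv c0 <= 1 ->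
  a1 \in C j.+1 -> a2 \in C j.+1 -> same_cap j c0 a1 -> same_cap j c0 a2 -> a1 != a2 ->
  periodic (plank absv c0 (p ^+ k) (p ^+ (k + j))) W ->
  \sum_(x <- X | W x) cap_sqfun j.+1 a1 x * cap_sqfun j.+1 a2 x <=
  M * \sum_(x <- X | W x) sqfun_in k j.+1 a1 x * sqfun_in k j.+1 a2 x.
Proof.
move=> /andP[jk kN] c01 a1C a2C na1 na2 ne WQ.
pose s a := [seq c <- C k | same_cap j.+1 a c].
have sP a c : c \in s a -> [/\ c \in C k, absv c <= 1 & same_cap j.+1 a c].
  by rewrite mem_filter => /andP[nac cC]; rewrite (C_le1 cC).
have e a x : cap_sqfun j.+1 a x = normc2 (\sum_(c <- s a) capsum k c x).
  by rewrite /cap_sqfun (capsum_split na p2 capC _ _ _ _ jk) big_filter.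
have e' a x : sqfun_in k j.+1 a x = \sum_(c <- s a) normc2 (capsum k c x).
  by rewrite big_filter.
under eq_bigr do rewrite !e; under [X in _ <= _ * X]eq_bigr do rewrite !e'.
have us a : uniq (s a) by apply: filter_uniq; apply: (C_uniq capC).
pose rel (i i' : K * K) := (absv (i.1 - i'.1) < p ^+ 2 * p ^- k) && same_cap k (i.1 + i.2) (i'.1 + i'.2).
apply: (@pair_schur _ _ _ rel).
- by move=> i i' _ _; rewrite /rel absBC // (same_cap_sym p na).
- move=> i /allpairsP[[u v] /= [us1 vs2 ->]].
  apply: (count_allpairs_le (P := fun c => absv (u - c) < p ^+ 2 * p ^- k)
    (rel := fun c c' => same_cap k (u + v) (c + c'))) => //=.
    have [uC _ _] := sP _ _ us1.
    apply: le_trans (countM uC); rewrite ler_nat count_filter.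
    by apply: sub_count => z /andP[].
  move=> a b b' _ /sP[bC _ _] /sP[b'C _ _] h1 h2; apply: (C_inj capC bC b'C).
  rewrite /same_cap (_ : b - b' = (u + v - (a + b')) - (u + v - (a + b))); last by ring.
  exact: absB_le.
move=> i i' /allpairsP[[c1 c2] /= [/sP[c1C c1l n1] /sP[c2C c2l n2] ->]].
move=> /allpairsP[[c3 c4] /= [/sP[c3C c3l n3] /sP[c4C c4l n4] ->]] /=.
rewrite /rel /= negb_and; case nr : (same_cap k _ _) => /=; last first.
  move=> _; apply: quad_orthogonal_sum => //; last by rewrite nr.
  apply: periodicS WQ => x; apply: ballV_plank => //; apply: pXle; exact: leq_addr.
rewrite orbF -leNgt => far.
have nj1 : same_cap j c1 c3.
  by apply: same_cap_trans (same_cap_le p2 (leqnSn j) n3) => //; rewrite (same_cap_sym p na) (same_cap_le p2 (leqnSn j)).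
have nj0 : same_cap j c0 c1 by apply: same_cap_trans na1 _ => //; apply: same_cap_le n1.
have nj2 : same_cap j c1 c4.
  rewrite (same_cap_sym p na) in nj0; apply: same_cap_trans nj0 _ => //.
  by apply: same_cap_trans na2 _ => //; apply: same_cap_le n4.
(* Otherwise [a1] and [a2] would be the same child. *)
have sep : p ^- j.+1 < absv (c1 - c4).
  rewrite ltNge; apply: contra ne => h14; apply/eqP; apply: (C_inj capC a1C a2C).
  apply: same_cap_trans n1 _ => //; apply: same_cap_trans h14 _ => //; by rewrite (same_cap_sym p na).
have b_abs : absv (P0 ^+ (k + j)) = p ^+ (k + j) by rewrite absX // absP0.
have pj : p ^- j * p ^+ (k + j) = p ^+ k by rewrite exprD mulrC mulfK // gt_eqF // pXgt0.
have jb z : same_cap j c1 z -> absv (2 * (c1 - z) * P0 ^+ (k + j)) <= p ^+ k.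
  by move=> h1; rewrite -pj -b_abs (absM na (2 * _)) ler_wpM2r ?abs_ge0 // abs2M_le.
apply: (@quad_orthogonal_prod k c1 c2 c3 c4 W (P0 ^+ (k + j))) => //.
- apply: periodicS WQ => x Dx; apply: ballV_plank (ballV_le _ Dx) => //; last first.
    by apply: le_trans delta1 _; apply: (pX_ge1 p2 k).
  by apply: pXle; rewrite leq_addr.
- move=> x d; rewrite b_abs => dl; apply: WQ; rewrite /plank /= dl andbT.
  rewrite (_ : _ + _ = 2 * ((c0 - c1) * d)); last by ring.
  by rewrite abs2M_le // -pj absM_le.
- exact: jb.
- exact: jb.
- by rewrite b_abs; apply: pXle; rewrite mul2n -addnn leq_add2l ltnW.
rewrite !(absM na) b_abs.
(* The separations [p^2 * p^-k] and [p^-(j+1)] times [|2|] and the length [p^(k+j)] multiply to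
   [p * |2| >= 1]. *)
apply: (@le_lt_trans _ _ (absv 2 * (p ^+ 2 * p ^- k) * p ^- j.+1 * p ^+ (k + j))).
  rewrite (_ : _ * p ^+ (k + j) = p * absv 2) //; rewrite exprD (exprS p j).
  by field; rewrite !gt_eqF ?pXgt0 ?(p_gt0 p2).
rewrite ltr_pM2r ?pXgt0 //.
have a20 : 0 < absv 2 by rewrite abs_gt0 // two_neq0.
have pk : 0 < p ^+ 2 * p ^- k by rewrite mulr_gt0 ?pXgt0 ?pV_gt0.
apply: (@lt_le_trans _ _ (absv 2 * (p ^+ 2 * p ^- k) * absv (c1 - c4))).
  by rewrite ltr_pM2l // mulr_gt0.
by rewrite ler_wpM2r ?abs_ge0 // ler_wpM2l // ltW.
Qed.

(** Equal sums and a nontrivial product [(c1 - c3) (c1 - c4)] cannot coexist with correlation, so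
    [{c3, c4}] must nearly equal [{c1, c2}]. Each of the two matchings leaves at most [p] choices,
    whence [2 * p]. *)
Lemma cordoba l c0 : (l <= N)%N -> absv c0 <= 1 ->
  cap_L4 l c0 <= 2 * p * \sum_(x <- X) cap_energy l c0 x ^+ 2.
Proof.
move=> lN c01; pose s := [seq c <- C N | same_cap l c0 c].
have sP c : c \in s -> c \in C N /\ absv c <= 1.
  by rewrite mem_filter => /andP[nac cC]; rewrite (C_le1 cC).
have e x : cap_sqfun l c0 x = normc2 (\sum_(c <- s) capsum N c x).
  by rewrite /cap_sqfun (capsum_split na p2 capC _ _ _ _ lN) big_filter.
have e' x : cap_energy l c0 x = \sum_(c <- s) normc2 (capsum N c x).
  rewrite /cap_energy -big_filter -/s big_seq [RHS]big_seq; apply: eq_bigr => c /sP[cC _].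
  by rewrite (capsumN na p2 capC).
rewrite /cap_L4; under eq_bigr do rewrite expr2 !e.
under [X in _ <= _ * X]eq_bigr do rewrite expr2 !e'.
have us : uniq s by apply: filter_uniq; apply: (C_uniq capC).
pose close (a b : K) := absv (a - b) <= p * p ^- N.
pose rel (i i' : K * K) := same_cap N (i.1 + i.2) (i'.1 + i'.2) && (close i.1 i'.1 || close i.1 i'.2).
have closeN a b : same_cap N a b -> close a b.
  by move=> h1; apply: le_trans h1 _; rewrite ler_peMl ?(p_ge1 p2) // ltW // pV_gt0.
have rel_imp i i' : rel i i' -> rel i' i.
  case: i i' => [a b] [a' b']; rewrite /rel /= (same_cap_sym p na) => /andP[h1 h2].
  rewrite h1 /=; case/orP: h2 => h2; first by rewrite {1}/close absBC // -/(close a a') h2.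
  apply/orP; right; rewrite /close (_ : a' - b = (a' + b' - (a + b)) + (a - b')); last by ring.
  by apply: absD_le => //; apply: closeN.
apply: (@pair_schur _ _ _ rel _ predT).
- by move=> i i' _ _; apply/idP/idP; apply: rel_imp.
- move=> i /allpairsP[[u v] /= [us1 vs2 ->]].
  have [uC u1] := sP _ us1.
  have cP : (count (close u) s)%:R <= p.
    apply: le_trans (countp N u1); rewrite ler_nat count_filter.
    by apply: sub_count => z /andP[].
  have uq b b' a : b \in s -> b' \in s -> same_cap N (u + v) (a + b) -> same_cap N (u + v) (a + b') -> b = b'.
    move=> /sP[bC _] /sP[b'C _] h1 h2; apply: (C_inj capC bC b'C).
    rewrite /same_cap (_ : b - b' = (u + v - (a + b')) - (u + v - (a + b))); last by ring.
    exact: absB_le.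
  apply: (@le_trans _ _ ((count (fun i => close u i.1 && same_cap N (u + v) (i.1 + i.2))
        [seq (a, b) | a <- s, b <- s])%:R +
      (count (fun i => close u i.2 && same_cap N (u + v) (i.1 + i.2))
        [seq (a, b) | a <- s, b <- s])%:R)).
    rewrite -natrD ler_nat -count_predUI; apply: leq_trans (leq_addr _ _).
    apply: sub_count => -[a b]; rewrite /rel /= => /andP[-> /orP[]->]; by rewrite ?orbT.
  rewrite (_ : 2 * p = p + p); last by ring.
  apply: lerD.
    by apply: (count_allpairs_le (P := close u) (rel := fun a b => same_cap N (u + v) (a + b))) => // a b b' _ bs bs'; apply: uq.
  rewrite count_allpairs_swap.
  apply: (count_allpairs_le (P := close u) (rel := fun b a => same_cap N (u + v) (a + b))) => //.
  by move=> a b b' _ bs bs' /=; rewrite ![_ + a]addrC; apply: uq.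
move=> i i' /allpairsP[[c1 c2] /= [/sP[c1C c1l] /sP[c2C c2l] ->]].
move=> /allpairsP[[c3 c4] /= [/sP[c3C c3l] /sP[c4C c4l] ->]] /=.
rewrite /rel /= negb_and; case nr : (same_cap N _ _) => /=; last first.
  by move=> _; apply: quad_orthogonal_sum => //; rewrite nr.
rewrite negb_or -!ltNge => /andP[u_far y_far].
have p0 := p_gt0 p2; have pN0 := pXgt0 N.
have a20 : 0 < absv 2 by rewrite abs_gt0 // two_neq0.
have pos z : p * p ^- N < absv z -> 0 < absv z by apply: lt_trans; rewrite mulr_gt0 ?pV_gt0.
(* The shift [P0^N / (2z)] uses the larger difference [z], so that both widths stay within [p^N];
   the phase is then [z' * P0^N], of size greater than [p]. *)
have main z z' : absv z' <= absv z -> p * p ^- N < absv z -> p * p ^- N < absv z' ->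
    [/\ absv (2 * z * (P0 ^+ N / (2 * z))) <= p ^+ N,
        absv (2 * z' * (P0 ^+ N / (2 * z))) <= p ^+ N,
        absv (P0 ^+ N / (2 * z)) <= p ^+ (2 * N) &
        1 < absv (2 * z * z' * (P0 ^+ N / (2 * z)))].
  move=> zz zf z'f; have z0 := pos z zf.
  have n0 : 0 < absv 2 * absv z by rewrite mulr_gt0.
  rewrite !(absM na, absV na, absX na) absP0; split.
  - by rewrite mulrC divfK // gt_eqF.
  - by rewrite mulrCA ger_pMr // ler_pdivrMr // mul1r ler_pM2l.
  - rewrite ler_pdivrMr // mul2n -addnn exprD -mulrA ler_peMr ?(ltW pN0) //.
    apply: (@le_trans _ _ (p ^+ N * (absv 2 * (p * p ^- N)))).
      by rewrite (_ : _ * _ = p * absv 2) //; field; rewrite gt_eqF.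
    by rewrite ler_pM2l // ler_pM2l // ltW.
  - rewrite (_ : _ * _ = p ^+ N * absv z'); last by field; rewrite !gt_eqF.
    apply: (@lt_trans _ _ (p ^+ N * (p * p ^- N))); last by rewrite ltr_pM2l.
    by rewrite (_ : _ * _ = p); [move: p2; lra | field; rewrite gt_eqF].
have [yu|/ltW uy] := leP (absv (c1 - c4)) (absv (c1 - c3)).
  have [h1 h2 h3 h4] := main _ _ yu u_far y_far.
  exact: (@quad_orthogonal_prod N c1 c2 c3 c4 predT _ _ _ _ _ _ _ _ h1 h2 h3 h4).
have [h1 h2 h3 h4] := main _ _ uy y_far u_far.
apply: (@quad_orthogonal_prod N c1 c2 c3 c4 predT _ _ _ _ _ _ _ _ h2 h1 h3) => //.
by rewrite [2 * _ * _]mulrAC.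
Qed.

(** * Broad-narrow reduction *)

Definition total x := \sum_(c <- C N) h c x.

Lemma capsum0 c x : c \in C 0 -> capsum 0 c x = total x.
Proof.
move=> cC; rewrite /capsum /total big_seq_cond [RHS]big_seq; apply: eq_bigl => c'.
case c'C: (c' \in C N) => //=; rewrite /same_cap expr0 invr1.
by apply: absB_le; rewrite ?(C_le1 cC) ?(C_le1 c'C).
Qed.

(** The factor [(1 + e)^j] pays for [j] descents. At [j = k] the descent stops in any case, so
    absence of a dominating child is asked only for [j < k]. *)
Definition selected k e t j c x :=
  (t <= (1 + e) ^+ j * normc (capsum j c x)) &&
  ((j < k)%N ==> all (fun c' => same_cap j c c' ==>
     ((1 + e) * normc (capsum j.+1 c' x) <= normc (capsum j c x))) (C j.+1)).

(* Descend to a dominating child as long as there is one. *)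
Lemma broad_narrow k e t x : 0 <= e -> t <= normc (total x) ->
  exists j c, [/\ (j <= k)%N, c \in C j & selected k e t j c x].
Proof.
move=> e0 tx.
have [c [cC ct]] : exists c, c \in C 0 /\ t <= (1 + e) ^+ 0 * normc (capsum 0 c x).
  have z1 : absv 0 <= 1 by rewrite abs0.
  have [c cC _] := C_ex capC 0 z1; exists c; split=> //.
  by rewrite expr0 mul1r capsum0.
have step i : (i <= k)%N ->
    (exists j c, [/\ (j <= k)%N, c \in C j & selected k e t j c x]) \/
    exists c, c \in C i /\ t <= (1 + e) ^+ i * normc (capsum i c x).
  elim: i => [_|i IH ik]; first by right; exists c.
  have [?|{c cC ct}[c [cC ct]]] := IH (ltnW ik); first by left.
  case all_c : (all (fun c' => same_cap i c c' ==>
     ((1 + e) * normc (capsum i.+1 c' x) <= normc (capsum i c x))) (C i.+1)).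
    by left; exists i, c; split; [exact: ltnW | | rewrite /selected ct ik all_c].
  right; have /allPn[c' c'C] := negbT all_c.
  rewrite negb_imply -ltNge => /andP[_ lt']; exists c'; split=> //.
  apply: le_trans ct _; rewrite exprSr -mulrA ler_wpM2l ?ltW //.
  by rewrite exprn_gt0 //; move: e0; lra.
have [//|[{}c [{}cC {}ct]]] := step k (leqnn k); exists k, c.
by split=> //; rewrite /selected ct ltnn.
Qed.

(** * Scale [k] with small averages on all tiles *)

Section Dominance.
Variables (k : nat) (act : pred K) (n thr : R).
Hypotheses (kN : (k <= N)%N) (n0 : 0 < n).
Hypothesis inactive : forall c c' x, c \in C k -> ~~ act c -> c' \in C N -> same_cap k c c' ->
  B x -> h c' x = 0.
Hypothesis act_n : (count act (C k))%:R <= n.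
Hypothesis thr_le : forall c x, c \in C k -> B x ->
  mean X (tile k c) (cap_energy k c) x <= thr / n ^+ 2.

Lemma thr_ge0 : 0 <= thr.
Proof.
have z1 : absv 0 <= 1 by rewrite abs0.
have [c cC _] := C_ex capC k z1.
have B0 : B 0 by case: sB.
have := thr_le cC B0; rewrite ler_pdivlMr ?exprn_gt0 //; apply: le_trans.
rewrite mulr_ge0 ?sqr_ge0 // mean_ge0 // => y _; exact: cap_energy_ge0.
Qed.

Lemma sum_active (F : K -> R) j c0 (a : R) : 0 <= a ->
  (forall c, c \in C k -> ~~ act c -> F c = 0) -> (forall c, c \in C k -> F c <= a) ->
  \sum_(c <- C k | same_cap j c0 c) F c <= n * a.
Proof.
move=> a0 F0 Fa; apply: (@le_trans _ _ (\sum_(c <- C k | same_cap j c0 c && act c) a)).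
  rewrite (bigID act) /= [X in _ + X]big_seq_cond [X in _ + X]big1 ?addr0.
    by rewrite big_seq_cond [leRHS]big_seq_cond; apply: ler_sum => c /andP[/Fa].
  by move=> c /andP[cC /andP[_]]; apply: F0.
rewrite sum_const_count ler_wpM2r // (le_trans _ act_n) // ler_nat.
by apply: sub_count => c /andP[].
Qed.

(** By [low_lemma] and [wave_mean] each active cap contributes its tile average, at most
    [thr / n^2], and there are at most [n] of them. *)
Lemma low_small j c0 x : (j <= k)%N -> B x ->
  mean X (cball (2 * N - k)) (sqfun_in k j c0) x <= thr / n.
Proof.
move=> jk Bx.
have iN : (N <= 2 * N - k <= 2 * N)%N by rewrite leq_subr andbT mul2n -addnn -addnBA ?leq_addr.
rewrite mean_sum big_seq_cond (eq_bigr (fun c => mean X (tile k c) (cap_energy k c) x)).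
  rewrite -big_seq_cond (_ : thr / n = n * (thr / n ^+ 2)); last first.
    by field; rewrite gt_eqF.
  apply: sum_active.
  - by rewrite divr_ge0 ?sqr_ge0 ?thr_ge0.
  - move=> c cC nact; rewrite -(mean_id sB trX x (intermediate_tile k (C_le1 cC))
      (g := fun=> 0)) //; apply: mean_ext => y Uy.
    rewrite /cap_energy big_seq_cond big1 // => c' /andP[c'C cc'].
    rewrite (inactive cC nact c'C cc') ?normc2_0 //.
    apply: subgrpD => //; apply: ballV_le rho1 (plank_ballV na (C_le1 cC) _ Uy).
    by apply: pXle; rewrite leq_subr.
  - by move=> c cC; apply: thr_le.
move=> c /andP[cC _]; rewrite (@low_lemma k N) ?kN ?leqnn // ?(C_le1 cC) //.
by rewrite (mean_eq X _ (sqfun_inN k c)) wave_mean // (C_le1 cC).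
Qed.

Lemma cap_sqfun_le j c0 x : (j <= k)%N -> B x ->
  cap_sqfun j c0 x <= n * sqfun_in k j c0 x.
Proof.
move=> jk Bx; rewrite /cap_sqfun (capsum_split na p2 capC _ _ _ _ jk).
have -> : \sum_(c <- C k | same_cap j c0 c) capsum k c x =
    \sum_(c <- C k | same_cap j c0 c && act c) capsum k c x.
  rewrite (bigID act) /= [X in _ + X]big_seq_cond [X in _ + X]big1 ?addr0 //.
  move=> c /andP[cC /andP[_ nact]]; rewrite /capsum big_seq_cond big1 // => c' /andP[c'C cc'].
  exact: (inactive cC nact c'C cc').
apply: le_trans (normc2_sum_le _ _ _) _; apply: ler_pM => //.
- by apply: sumr_ge0 => c _; apply: normc2_ge0.
- apply: le_trans act_n; rewrite ler_nat; apply: sub_count => c /andP[] //.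
rewrite /sqfun_in [leRHS](bigID act) /= lerDl; apply: sumr_ge0 => c _; exact: normc2_ge0.
Qed.

(** The selected set has no invariance, so it is enlarged to [W], where [g] is at least twice its
    low-frequency part. [W] is constant along the plank common to the caps of scale [k] inside [c0],
    hence admissible in [local_bilinear]. *)
Lemma selected_L4 j c0 e t cb : (j <= k)%N -> c0 \in C j -> 0 < t -> 0 < e <= 1 ->
  2 * thr * (1 + e) ^+ (2 * k) <= t ^+ 2 ->
  4 * p ^+ 2 <= cb -> (1 + e) ^+ 4 * (p - 1) <= 2 * e ^+ 2 * cb ->
  \sum_(x <- X | selected k e t j c0 x) cap_sqfun j c0 x ^+ 2 <=
  4 * (cb * M) *
  \sum_(x <- X) (sqfun_in k j c0 x - mean X (cball (2 * N - k)) (sqfun_in k j c0) x) ^+ 2.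
Proof.
move=> jk c0C t0 e01 ht cb1 cb2; have [e0 e1] := andP e01; have c01 := C_le1 c0C.
have cb_ge1 : 1 <= cb by move: p2 cb1; nra.
pose g := sqfun_in k j c0; pose Pg := mean X (cball (2 * N - k)) g.
pose W x := 2 * Pg x <= g x.
have XB x : x \in X -> B x by case: trX => _ + _ _; apply.
have e1_gt0 i : 0 < (1 + e) ^+ i by rewrite exprn_gt0 //; lra.
(* Cauchy-Schwarz over the [n] active caps gives [2 * thr <= n * g x], while the low part of [g] is
   at most [thr / n]; the powers of [n] match exactly. *)
have selW x : x \in X -> selected k e t j c0 x -> W x.
  move=> /XB Bx /andP[tx _]; rewrite /W.
  have h1 := low_small c0 jk Bx; have h2 := cap_sqfun_le c0 jk Bx.
  have h3 : t ^+ 2 <= (1 + e) ^+ (2 * k) * cap_sqfun j c0 x.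
    apply: (@le_trans _ _ ((1 + e) ^+ (2 * j) * cap_sqfun j c0 x)).
      rewrite /cap_sqfun -normc2E mulnC exprM -exprMn.
      by rewrite lerXn2r ?nnegrE ?(ltW t0) // mulr_ge0 ?normc_ge0 // ltW.
    rewrite ler_wpM2r ?cap_sqfun_ge0 // ler_weXn2l ?leq_mul2l //; lra.
  have h4 : 2 * thr <= n * g x.
    apply: le_trans h2; rewrite -(ler_pM2r (e1_gt0 (2 * k)%N)) [leRHS]mulrC.
    exact: le_trans ht h3.
  rewrite -(ler_pM2l n0); apply: le_trans h4; rewrite mulrCA ler_pM2l // mulrC.
  by rewrite -ler_pdivlMr.
have WE : \sum_(x <- X | W x) g x ^+ 2 <= 4 * \sum_(x <- X) (g x - Pg x) ^+ 2.
  rewrite mulr_sumr big_mkcond; apply: ler_sum => x _; case: ifP => [Wx|_].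
    have g0 : 0 <= g x by apply: sqfun_in_ge0.
    by move: Wx; rewrite /W; nra.
  by rewrite mulr_ge0 // sqr_ge0.
rewrite -/g -/Pg (_ : 4 * (cb * M) * _ = cb * (M * (4 * \sum_(x <- X) (g x - Pg x) ^+ 2))); last by ring.
apply: (@le_trans _ _ (cb * (M * \sum_(x <- X | W x) g x ^+ 2))); last first.
  by rewrite ler_wpM2l ?(le_trans _ cb_ge1) // ler_wpM2l ?(le_trans _ M1).
have Wsum0 : 0 <= \sum_(x <- X | W x) g x ^+ 2 by apply: sumr_ge0 => x _; apply: sqr_ge0.
have sel_le (F : K * K -> R) : (forall x, 0 <= F x) ->
    \sum_(x <- X | selected k e t j c0 x) F x <= \sum_(x <- X | W x) F x.
  move=> F0; rewrite big_seq_cond [leRHS]big_seq_cond (big_mkcond (fun x => _ && selected _ _ _ _ _ _)).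
  rewrite [leRHS]big_mkcond; apply: ler_sum => x _; case: ifP => [/andP[xX sx]|_].
    by rewrite xX selW.
  by case: ifP.
(* For [j = k] the square function is [cap_sqfun k c0] itself, and no bilinear argument is
   needed. *)
move: jk; rewrite leq_eqVlt => /predU1P[jk|jk].
  apply: le_trans (sel_le _ _) _ => [x|]; first exact: sqr_ge0.
  apply: (@le_trans _ _ (\sum_(x <- X | W x) g x ^+ 2)); last first.
    by rewrite mulrA ler_peMl // mulr_ege1.
  rewrite le_eqVlt; apply/orP; left; apply/eqP; apply: eq_bigr => x _; congr (_ ^+ 2).
  rewrite /g /sqfun_in -jk (eq_bigl (fun c => predT c && same_cap j c c0)) ?sum_center //.
  by move=> c; rewrite /= (same_cap_sym p na).
pose s := [seq c <- C j.+1 | same_cap j c0 c].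
have us : uniq s by apply: filter_uniq; apply: (C_uniq capC).
have sP c : c \in s -> c \in C j.+1 /\ same_cap j c0 c by rewrite mem_filter => /andP[].
pose P2 x := \sum_(c <- s) \sum_(c' <- s | c != c') cap_sqfun j.+1 c x * cap_sqfun j.+1 c' x.
have P20 x : 0 <= P2 x.
  by apply: sumr_ge0 => c _; apply: sumr_ge0 => c' _; rewrite mulr_ge0 ?cap_sqfun_ge0.
have broad x : selected k e t j c0 x -> cap_sqfun j c0 x ^+ 2 <= cb * P2 x.
  move=> /andP[_ /implyP/(_ jk)/allP dom].
  rewrite /cap_sqfun -normc2E -exprM.
  have -> : P2 x = \sum_(c <- s) \sum_(c' <- s | c != c')
      normc (capsum j.+1 c x) ^+ 2 * normc (capsum j.+1 c' x) ^+ 2.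
    by apply: eq_bigr => c _; apply: eq_bigr => c' _; rewrite !normc2E.
  apply: (broad_pairs (p := p) (e := e)) => //.
  - apply: le_trans (countp j.+1 c01); rewrite ler_nat size_filter; apply: sub_count => c.
    rewrite /same_cap => /le_trans; apply; rewrite exprS invfM mulrA divff ?mul1r // gt_eqF //.
    exact: p_gt0 p2.
  - by move=> c; apply: normc_ge0.
  - exact: normc_ge0.
  - by rewrite (capsum_split na p2 capC _ _ _ _ (leqnSn j)) -big_filter normc_sum.
  - by move=> c /sP[cC nc]; have := dom _ cC; rewrite nc.
apply: (@le_trans _ _ (\sum_(x <- X | selected k e t j c0 x) cb * P2 x)).
  by apply: ler_sum => x; apply: broad.
rewrite -mulr_sumr ler_wpM2l ?(le_trans _ cb_ge1) //.
apply: le_trans (sel_le _ P20) _.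
have WQ : periodic (plank absv c0 (p ^+ k) (p ^+ (k + j))) W.
  have pg : periodic (plank absv c0 (p ^+ k) (p ^+ (k + j))) g.
    rewrite /g /sqfun_in => x a Qa; rewrite big_seq_cond [RHS]big_seq_cond.
    apply: eq_bigr => c /andP[cC nc]; apply: (cap_sqfun_plank kN (C_le1 cC)).
    apply: plank_shift Qa => //; last by apply: pXle; rewrite mul2n -addnn leq_add2l ltnW.
    have -> : p ^+ k = p ^- j * p ^+ (k + j) by rewrite exprD mulrC mulfK // gt_eqF // pXgt0.
    by rewrite ler_wpM2r // ltW // pXgt0.
  by move=> x a Qa; rewrite /W /Pg (mean_periodic_in X _ pg) // pg.
apply: (@le_trans _ _ (\sum_(c <- s) \sum_(c' <- s | c != c')
    (M * \sum_(x <- X | W x) sqfun_in k j.+1 c x * sqfun_in k j.+1 c' x))).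
  rewrite exchange_big /= big_seq [leRHS]big_seq; apply: ler_sum => c cs.
  rewrite exchange_big /= big_seq_cond [leRHS]big_seq_cond; apply: ler_sum => c' /andP[cs' ne].
  have [[cC nc] [c'C nc']] := (sP _ cs, sP _ cs').
  by apply: (@local_bilinear j k c0); rewrite ?jk.
under eq_bigr do rewrite -mulr_sumr.
rewrite -mulr_sumr ler_wpM2l ?(le_trans _ M1) //.
(* The off-diagonal products of the children are part of the expansion of [g^2]. *)
have ge x : g x = \sum_(c <- s) sqfun_in k j.+1 c x.
  by rewrite /g big_filter /sqfun_in (sum_caps_same_cap na p2 capC _ _ _ (leqnSn j)).
rewrite [leRHS](eq_bigr (fun x => \sum_(c <- s) \sum_(c' <- s)
    sqfun_in k j.+1 c x * sqfun_in k j.+1 c' x)) => [|x _]; last first.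
  rewrite ge expr2 mulr_suml; apply: eq_bigr => c _; by rewrite mulr_sumr.
rewrite [leRHS]exchange_big; apply: ler_sum => c _ /=.
rewrite [leRHS]exchange_big /= [leRHS](bigID (fun c' => c != c')) /= lerDl.
by apply: sumr_ge0 => c' _; apply: sumr_ge0 => x _; rewrite mulr_ge0 // sqfun_in_ge0.
Qed.

End Dominance.

(** * Summation over caps and scales *)

Definition wave_total m :=
  \sum_(c <- C m) \sum_(x <- X) mean X (tile m c) (cap_energy m c) x ^+ 2.

Lemma wave_total_ge0 m : 0 <= wave_total m.
Proof. by apply: sumr_ge0 => c _; apply: sumr_ge0 => x _; apply: sqr_ge0. Qed.

Lemma sum_wave_sum j m : \sum_(c0 <- C j) wave_sum j c0 m = wave_total m.
Proof. exact: (sum_caps_all na p2 capC). Qed.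

(** Cordoba bounds the L^4 norms by the full energy of the smallest caps. Its bands give the scales
    above [l], and the part below the last band is exactly the wave sum of scale [l]. *)
Lemma L4_total l : (l <= N)%N ->
  \sum_(c <- C l) cap_L4 l c <= 2 * p * (M * \sum_(l <= m < N.+1) wave_total m).
Proof.
move=> lN; have p0 := p_gt0 p2.
apply: (@le_trans _ _ (2 * p * \sum_(c <- C l) low_energy l c N)).
  rewrite mulr_sumr big_seq [leRHS]big_seq; apply: ler_sum => c /C_le1 c1.
  by rewrite low_energyN; apply: cordoba.
rewrite ler_wpM2l ?mulr_ge0 ?(ltW p0) //.
apply: (@le_trans _ _ (\sum_(c <- C l) (low_energy l c l +
    M * \sum_(l.+1 <= m < N.+1) wave_sum l c m))).
  apply: ler_sum => c _; rewrite -lerBlDl; apply: low_energy_telescope.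
  by rewrite leqnn.
rewrite big_split /= -mulr_sumr [X in _ + M * X]exchange_big /=.
rewrite [in leRHS]big_ltn ?ltnS // mulrDr; apply: lerD.
  rewrite big_seq (eq_bigr (fun c => \sum_(x <- X) mean X (tile l c) (cap_energy l c) x ^+ 2)).
    by rewrite -big_seq ler_peMl // wave_total_ge0.
  by move=> c /C_le1 c1; apply: low_energy_tile.
by rewrite ler_wpM2l ?(le_trans _ M1) //; under eq_bigr do rewrite sum_wave_sum.
Qed.

(** [L4_total] at scale [k] would involve tiles of scale [k], on which nothing is known for the part
    removed there. Passing to the children costs [p^3] and only needs scales above [k]. *)
Lemma L4_child k : (k < N)%N ->
  \sum_(c <- C k) cap_L4 k c <= p ^+ 3 * \sum_(c <- C k.+1) cap_L4 k.+1 c.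
Proof.
move=> kN; have p0 := p_gt0 p2.
rewrite -(sum_caps_all na p2 capC k k.+1) mulr_sumr big_seq [leRHS]big_seq.
apply: ler_sum => c cC; rewrite /cap_L4 exchange_big mulr_sumr; apply: ler_sum => x _ /=.
have cnt : (count (same_cap k c) (C k.+1))%:R <= p.
  apply: le_trans (countp k.+1 (C_le1 cC)); rewrite ler_nat; apply: sub_count => c'.
  rewrite /same_cap => /le_trans; apply; rewrite exprS invfM mulrA divff ?mul1r // gt_eqF //.
have S0 : 0 <= \sum_(c' <- C k.+1 | same_cap k c c') cap_sqfun k.+1 c' x ^+ 2.
  by apply: sumr_ge0 => c' _; apply: sqr_ge0.
have T0 : 0 <= \sum_(c' <- C k.+1 | same_cap k c c') cap_sqfun k.+1 c' x.
  by apply: sumr_ge0 => c' _; apply: cap_sqfun_ge0.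
have h1 : cap_sqfun k c x <= p * \sum_(c' <- C k.+1 | same_cap k c c') cap_sqfun k.+1 c' x.
  rewrite /cap_sqfun (capsum_split na p2 capC _ _ _ _ (leqnSn k)).
  by apply: le_trans (normc2_sum_le _ _ _) _; rewrite ler_wpM2r.
apply: (@le_trans _ _ ((p * \sum_(c' <- C k.+1 | same_cap k c c') cap_sqfun k.+1 c' x) ^+ 2)).
  by rewrite lerXn2r ?nnegrE ?cap_sqfun_ge0 ?mulr_ge0 // ltW.
rewrite exprMn (exprSr p 2) -mulrA ler_wpM2l ?sqr_ge0 //.
by apply: le_trans (sqr_sum_le _ _ _) _; rewrite ler_wpM2r.
Qed.

(** The three summands of the constant: [l = k] treated through the children, the at most [N - 1]
    scales [k < l < N], and the wave envelope bands. *)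
Lemma high_total j k W : (j <= k)%N -> (k < N)%N ->
  \sum_(k.+1 <= m < N.+1) wave_total m <= W ->
  \sum_(c0 <- C j) \sum_(x <- X)
     (sqfun_in k j c0 x - mean X (cball (2 * N - k)) (sqfun_in k j c0) x) ^+ 2 <=
  M * ((2 * p ^+ 4 * M + 2 * p * M * N.-1%:R + 1) * W).
Proof.
move=> jk kN leW; have p0 := p_gt0 p2; have M0 : 0 <= M := le_trans ler01 M1.
apply: (@le_trans _ _ (\sum_(c0 <- C j)
    (M * \sum_(k <= l < N) \sum_(c <- C l | same_cap j c0 c) cap_L4 l c +
     M * \sum_(k.+1 <= m < N.+1) wave_sum j c0 m))).
  by apply: ler_sum => c0 _; apply: high_energy; rewrite jk ltnW.
rewrite big_split /= -!mulr_sumr -mulrDr ler_wpM2l //.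
rewrite exchange_big /= [X in _ + X]exchange_big /=.
under eq_bigr do rewrite (sum_caps_all na p2 capC).
under [X in _ + X]eq_bigr do rewrite sum_wave_sum.
rewrite mulrDl mul1r lerD //.
have tail l : (k < l)%N -> (l < N)%N -> \sum_(c <- C l) cap_L4 l c <= 2 * p * (M * W).
  move=> kl lN; apply: le_trans (L4_total (ltnW lN)) _.
  rewrite ler_wpM2l ?mulr_ge0 ?(ltW p0) // ler_wpM2l //; apply: le_trans leW.
  rewrite [leRHS](@big_cat_nat _ _ _ l) //=; last by rewrite ltnW // ltnS ltnW.
  by rewrite lerDr; apply: sumr_ge0 => m _; apply: wave_total_ge0.
have W0 : 0 <= W by apply: le_trans leW; apply: sumr_ge0 => m _; apply: wave_total_ge0.
rewrite big_ltn // mulrDl; apply: lerD.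
  apply: le_trans (L4_child kN) _; apply: (@le_trans _ _ (p ^+ 3 * (2 * p * (M * W)))).
    rewrite ler_wpM2l ?exprn_ge0 ?(ltW p0) //; apply: le_trans (L4_total kN) _.
    by rewrite ler_wpM2l ?mulr_ge0 ?(ltW p0) // ler_wpM2l.
  by rewrite le_eqVlt; apply/orP; left; apply/eqP; ring.
apply: (@le_trans _ _ (\sum_(k.+1 <= l < N) 2 * p * (M * W))).
  by rewrite big_nat [leRHS]big_nat; apply: ler_sum => l /andP[]; apply: tail.
rewrite big_const_nat iter_addr_0 -[leLHS]mulr_natl.
rewrite (_ : 2 * p * M * _ * W = N.-1%:R * (2 * p * (M * W))); last by ring.
rewrite ler_wpM2r ?ler_nat; [by [] | | by rewrite -subn1 leq_sub2l].
by rewrite !mulr_ge0 // ltW.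
Qed.

Lemma level_set_high k (act : pred K) (n thr e t cb W : R) : (k < N)%N -> 0 < n ->
  (forall c c' x, c \in C k -> ~~ act c -> c' \in C N -> same_cap k c c' -> B x -> h c' x = 0) ->
  (count act (C k))%:R <= n ->
  (forall c x, c \in C k -> B x -> mean X (tile k c) (cap_energy k c) x <= thr / n ^+ 2) ->
  0 < t -> 0 < e <= 1 -> 2 * thr * (1 + e) ^+ (2 * k) <= t ^+ 2 ->
  4 * p ^+ 2 <= cb -> (1 + e) ^+ 4 * (p - 1) <= 2 * e ^+ 2 * cb ->
  \sum_(k.+1 <= m < N.+1) wave_total m <= W ->
  t ^+ 4 * (count (fun x => t <= normc (total x)) X)%:R <=
  (1 + e) ^+ (4 * k) * (k.+1%:R * (4 * (cb * M) *
    (M * ((2 * p ^+ 4 * M + 2 * p * M * N.-1%:R + 1) * W)))).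
Proof.
move=> kN n0 inact act_n thr_le t0 e01 ht cb1 cb2 leW; have [e0 e1] := andP e01.
have e1_ge1 : 1 <= 1 + e by lra.
have e1_gt0 i : 0 < (1 + e) ^+ i by rewrite exprn_gt0 //; lra.
rewrite -sum1_count natr_sum mulr_sumr.
(* The stopping pair depends on the point, so it is replaced by the sum over all scales [j <= k] and
   all caps. *)
apply: (@le_trans _ _ (\sum_(x <- X) \sum_(0 <= j < k.+1) \sum_(c <- C j)
    if selected k e t j c x then (1 + e) ^+ (4 * k) * cap_sqfun j c x ^+ 2 else 0)).
  rewrite big_mkcond; apply: ler_sum => x _.
  have nn j c : 0 <= if selected k e t j c x then (1 + e) ^+ (4 * k) * cap_sqfun j c x ^+ 2 else 0.
    by case: ifP => // _; rewrite mulr_ge0 ?sqr_ge0 // ltW.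
  case: ifP => [tx|_]; last by apply: sumr_ge0 => j _; apply: sumr_ge0.
  have [j [c [jk cC sel]]] := broad_narrow k (ltW e0) tx.
  rewrite (bigD1_seq j) ?mem_index_iota ?iota_uniq //= (bigD1_seq c) ?(C_uniq capC) //= sel.
  rewrite -addrA; apply: (@le_trans _ _ ((1 + e) ^+ (4 * k) * cap_sqfun j c x ^+ 2)).
    rewrite mulr1; have /andP[tj _] := sel.
    apply: (@le_trans _ _ (((1 + e) ^+ j * normc (capsum j c x)) ^+ 4)).
      by rewrite lerXn2r ?nnegrE ?(ltW t0) // mulr_ge0 ?normc_ge0 // ltW.
    rewrite exprMn -exprM mulnC /cap_sqfun -normc2E -exprM ler_wpM2r ?exprn_ge0 ?normc_ge0 //.
    by rewrite ler_weXn2l // leq_mul2l.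
  by rewrite lerDl addr_ge0 //; apply: sumr_ge0 => // i _; apply: sumr_ge0.
rewrite exchange_big /=.
apply: (@le_trans _ _ (\sum_(0 <= j < k.+1) (1 + e) ^+ (4 * k) * (4 * (cb * M) *
    (M * ((2 * p ^+ 4 * M + 2 * p * M * N.-1%:R + 1) * W))))); last first.
  by rewrite big_const_nat subn0 iter_addr_0 -[leLHS]mulr_natl mulrCA.
rewrite big_nat [leRHS]big_nat; apply: ler_sum => j /andP[_ jk]; rewrite ltnS in jk.
rewrite exchange_big /=.
rewrite (eq_bigr (fun c => (1 + e) ^+ (4 * k) *
    \sum_(x <- X | selected k e t j c x) cap_sqfun j c x ^+ 2)) => [|c _]; last first.
  by rewrite -big_mkcond mulr_sumr.
rewrite -mulr_sumr ler_wpM2l ?(ltW (e1_gt0 _)) //.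
apply: (@le_trans _ _ (4 * (cb * M) * \sum_(c0 <- C j) \sum_(x <- X)
     (sqfun_in k j c0 x - mean X (cball (2 * N - k)) (sqfun_in k j c0) x) ^+ 2)).
  rewrite mulr_sumr big_seq [leRHS]big_seq; apply: ler_sum => c cC.
  exact: (selected_L4 (ltnW kN) n0 inact act_n thr_le jk cC t0 e01 ht cb1 cb2).
rewrite ler_wpM2l //; last exact: high_total.
rewrite mulr_ge0 // mulr_ge0 ?(le_trans _ M1) //; apply: le_trans cb1.
by rewrite mulr_ge0 // sqr_ge0.
Qed.

Lemma level_set_low t W : 0 < t -> \sum_(0 <= m < N.+1) wave_total m <= W ->
  t ^+ 4 * (count (fun x => t <= normc (total x)) X)%:R <= 2 * p * (M * W).
Proof.
move=> t0 leW; have p0 := p_gt0 p2.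
apply: (@le_trans _ _ (\sum_(c <- C 0) cap_L4 0 c)); last first.
  apply: le_trans (L4_total (leq0n N)) _; rewrite ler_wpM2l ?mulr_ge0 ?(ltW p0) //.
  by rewrite ler_wpM2l ?(le_trans _ M1).
rewrite -sum1_count natr_sum mulr_sumr big_mkcond exchange_big; apply: ler_sum => x _ /=.
have nn c : 0 <= cap_sqfun 0 c x ^+ 2 by apply: sqr_ge0.
case: ifP => [tx|_]; last by apply: sumr_ge0.
have z1 : absv 0 <= 1 by rewrite abs0.
have [c cC _] := C_ex capC 0 z1.
rewrite (bigD1_seq c) ?(C_uniq capC) //= mulr1.
apply: (@le_trans _ _ (cap_sqfun 0 c x ^+ 2)); last by rewrite lerDl; apply: sumr_ge0.
rewrite /cap_sqfun capsum0 // -normc2E -exprM.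
by rewrite lerXn2r ?nnegrE ?(ltW t0) ?normc_ge0.
Qed.

End Family.

(** * Pruning bad tiles *)

Section Pruning.
Variables (F : K -> K * K -> R[i]) (alpha kappa : R) (n : nat -> R).
Hypothesis eq_F : equivariant absv p C ch N F.
Hypotheses (alpha0 : 0 < alpha) (N0 : (0 < N)%N) (kappaN : 14 * N%:R ^+ 2 <= kappa).

Local Notation energy := (cap_energy F).

Definition good m c x :=
  alpha ^+ 2 / n m ^+ 2 <= kappa * mean X (tile m c) (energy m c) x.

Definition active m c := has (fun c' => same_cap m c c' && has (fun x => F c' x != 0) X) (C N).

Hypothesis n_gt0 : forall m, (m <= N)%N -> 0 < n m.
Hypothesis active_n : forall m, (m <= N)%N -> (count (active m) (C m))%:R <= n m.

Definition good_wave m :=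
  \sum_(c <- C m) \sum_(x <- X | good m c x) mean X (tile m c) (energy m c) x ^+ 2.

Lemma tile_same_cap m c c' : (m <= N)%N -> same_cap m c c' -> tile m c =1 tile m c'.
Proof.
move=> mN.
have imp d d' a : same_cap m d d' -> tile m d a -> tile m d' a.
  move=> dd'; apply: plank_shift => //.
  have -> : p ^+ (2 * N - m) = p ^- m * p ^+ (2 * N).
    have mN2 : (m <= 2 * N)%N by apply: leq_trans mN _; rewrite leq_pmull.
    by rewrite -{2}(subnKC mN2) exprD mulKf // gt_eqF // pXgt0.
  by rewrite ler_wpM2r // ltW // pXgt0.
move=> cc' a; apply/idP/idP; first exact: imp.
by apply: imp; rewrite (same_cap_sym p na).
Qed.

Lemma good_same_cap m c c' x : (m <= N)%N -> same_cap m c c' -> good m c x = good m c' x.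
Proof.
move=> mN cc'; rewrite /good; congr (_ <= _ * _).
have t := tile_same_cap mN cc'; rewrite /mean (eq_count t) (eq_bigl _ _ t); congr (_ * _).
apply: eq_bigr => y _; apply: eq_bigl => z.
by rewrite (same_cap_sym p na) (same_cap_congr na _ cc') (same_cap_sym p na).
Qed.

Lemma good_periodic m c : absv c <= 1 -> periodic (tile m c) (good m c).
Proof.
move=> c1 x a Ua; rewrite /good (mean_shift sD trX) //; first exact: intermediate_tile.
exact: cap_energy_D.
Qed.

(** The planks dual to the smallest caps lie in the tiles of every scale [m <= N]. Cutting off by
    goodness therefore preserves equivariance, that is, does not enlarge Fourier supports. *)
Lemma good_plank m c : (m <= N)%N -> absv c <= 1 ->
  periodic (plank absv c (p ^+ N) (p ^+ (2 * N))) (good m c).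
Proof.
move=> mN c1; apply: periodicS (good_periodic c1) => a /andP[a1 a2].
apply/andP; split=> //; apply: le_trans a1 _; apply: pXle.
by rewrite mul2n -addnn -addnBA // leq_addr.
Qed.

Definition all_good k c x := all (fun m => good m c x) (index_iota k N.+1).
Definition kept k c x := if all_good k c x then F c x else 0.
Definition removed k c x := if all_good k.+1 c x && ~~ good k c x then F c x else 0.

Lemma all_good_plank k c : absv c <= 1 ->
  periodic (plank absv c (p ^+ N) (p ^+ (2 * N))) (all_good k c).
Proof.
move=> c1 x a pa; apply: eq_in_all => m; rewrite mem_index_iota => /andP[_ mN].
by apply: good_plank pa.
Qed.

Lemma kept_equivariant k : equivariant absv p C ch N (kept k).
Proof.
move=> c x a cC pa; rewrite /kept (all_good_plank _ (C_le1 cC)) // eq_F //.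
by case: ifP; rewrite ?mulr0.
Qed.

Lemma removed_equivariant k : (k <= N)%N -> equivariant absv p C ch N (removed k).
Proof.
move=> kN c x a cC pa; rewrite /removed (all_good_plank _ (C_le1 cC)) //.
rewrite (good_plank kN (C_le1 cC)) // eq_F //.
by case: ifP; rewrite ?mulr0.
Qed.

Lemma F_decomposition c x : F c x = kept 0 c x + \sum_(0 <= k < N.+1) removed k c x.
Proof.
have step k : (k < N.+1)%N -> removed k c x = kept k.+1 c x - kept k c x.
  move=> kN; rewrite /removed /kept {3}/all_good /index_iota subSn //= -/(index_iota k.+1 N.+1).
  rewrite -/(all_good k.+1 c x); case: (all_good k.+1 c x); case: (good k c x) => /=;
    by rewrite ?subrr ?subr0.
rewrite (eq_big_nat _ _ (F2 := fun k => kept k.+1 c x - kept k c x)) => [|k /andP[_]]; last exact: step.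
rewrite telescope_sumr // addrC subrK.
(* [kept N.+1] is [F], the range of scales to test being empty. *)
by rewrite /kept /all_good /index_iota subnn.
Qed.

Lemma inactive_F m c c' x : c \in C m -> ~~ active m c -> c' \in C N -> same_cap m c c' ->
  B x -> F c' x = 0.
Proof.
move=> cC /hasPn/(_ c') nact c'C cc' Bx; have := nact c'C.
rewrite cc' /= => /hasPn F0; have [_ _ ex _] := trX; have [x0 x0X Dx] := ex x Bx.
have /negbNE/eqP e := F0 _ x0X; rewrite -e.
have -> : x = x0 + (x - x0) by rewrite addrC subrK.
have c'1 := C_le1 c'C.
rewrite eq_F //; last first.
  apply: ballV_plank (ballV_le _ Dx) => //; last by apply: le_trans delta1 (pX_ge1 p2 N).
  by apply: pXle; rewrite leq_pmull.
rewrite e mulr0 //.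
Qed.

Lemma kept_le k c x : normc2 (kept k c x) <= normc2 (F c x).
Proof. by rewrite /kept; case: ifP => // _; rewrite normc2_0 normc2_ge0. Qed.

Lemma removed_le k c x : normc2 (removed k c x) <= normc2 (F c x).
Proof. by rewrite /removed; case: ifP => // _; rewrite normc2_0 normc2_ge0. Qed.

(** Goodness is the same for all centers of a cap and all points of a tile, so on a bad tile every
    small cap inside [c] vanishes and the average is zero. *)
Lemma wave_total_le h m : (m <= N)%N ->
  (forall c x, normc2 (h c x) <= normc2 (F c x)) ->
  (forall c x, ~~ good m c x -> h c x = 0) -> wave_total h m <= good_wave m.
Proof.
move=> mN hF hgood; rewrite /wave_total /good_wave big_seq [leRHS]big_seq.
apply: ler_sum => c /C_le1 c1; rewrite [leRHS]big_mkcond; apply: ler_sum => x _.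
case: ifP => [_|/negbT bad].
  rewrite lerXn2r ?nnegrE ?mean_ge0 //; try by move=> y _; apply: cap_energy_ge0.
  by apply: mean_le => y _; apply: ler_sum => c' _.
rewrite -(mean_id sB trX x (intermediate_tile m c1) (g := fun=> 0)) //.
rewrite (@mean_ext _ _ _ _ _ (fun=> 0)) => [|y Uy].
  by rewrite (mean_id sB trX x (intermediate_tile m c1)) // expr0n.
rewrite /cap_energy big1 // => c' cc'; rewrite hgood ?normc2_0 //.
by rewrite -(good_same_cap _ mN cc') good_periodic.
Qed.

Lemma all_good_in k m c x : (k <= m <= N)%N -> ~~ good m c x -> all_good k c x = false.
Proof.
move=> kmN; apply: contraNF => /allP; apply.
by rewrite mem_index_iota ltnS.
Qed.

Let W := \sum_(0 <= m < N.+1) good_wave m.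

Lemma good_wave_ge0 m : 0 <= good_wave m.
Proof. by apply: sumr_ge0 => c _; apply: sumr_ge0 => x _; apply: sqr_ge0. Qed.

Lemma kept_wave : \sum_(0 <= m < N.+1) wave_total (kept 0) m <= W.
Proof.
rewrite big_nat [leRHS]big_nat; apply: ler_sum => m /andP[_ mN].
apply: wave_total_le => // [c x|c x bad]; first exact: kept_le.
by rewrite /kept (@all_good_in 0 m).
Qed.

Lemma removed_wave k : \sum_(k.+1 <= m < N.+1) wave_total (removed k) m <= W.
Proof.
apply: (@le_trans _ _ (\sum_(k.+1 <= m < N.+1) good_wave m)).
  rewrite big_nat [leRHS]big_nat; apply: ler_sum => m /andP[km mN].
  apply: wave_total_le => // [c x|c x bad]; first exact: removed_le.
  by rewrite /removed (@all_good_in k.+1 m) // km.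
have [kN|kN] := leqP k.+1 N.+1.
  by rewrite /W [leRHS](@big_cat_nat _ _ _ k.+1) //= lerDr; apply: sumr_ge0 => m _; apply: good_wave_ge0.
rewrite big_geq ?(ltnW kN) //; apply: sumr_ge0 => m _; apply: good_wave_ge0.
Qed.

Lemma kappa_gt0 : 0 < kappa.
Proof. by apply: lt_le_trans kappaN; rewrite mulr_gt0 // exprn_gt0 // ltr0n. Qed.

(** A tile is either good, and nothing was removed there at scale [k], or bad, and the failed
    inequality is the required bound. *)
Lemma removed_thr k c x : (k <= N)%N -> absv c <= 1 ->
  mean X (tile k c) (cap_energy (removed k) k c) x <= alpha ^+ 2 / kappa / n k ^+ 2.
Proof.
move=> kN c1; have k0 := kappa_gt0; have nk := n_gt0 kN.
have [gd|bad] := boolP (good k c x).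
  rewrite (@mean_ext _ _ _ _ _ (fun=> 0)) => [|y Uy].
    rewrite (mean_id sB trX x (intermediate_tile k c1)) //.
    by rewrite !divr_ge0 ?sqr_ge0 // ltW.
  rewrite /cap_energy big1 // => c' cc'; rewrite /removed.
  by rewrite -(good_same_cap _ kN cc') (good_periodic c1) // gd andbF normc2_0.
apply: (@le_trans _ _ (mean X (tile k c) (energy k c) x)).
  by apply: mean_le => y _; apply: ler_sum => c' _; apply: removed_le.
move: bad; rewrite /good -ltNge => /ltW bad.
by rewrite mulrAC ler_pdivlMr // mulrC.
Qed.

(** At scale [N] the energy is constant on tiles, so badness is a pointwise bound. There is no
    high-frequency part to study, and the at most [n N] active caps are simply added up. *)
Lemma removed_small x : B x -> normc (total (removed N) x) <= 3 / 10 * alpha.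
Proof.
move=> Bx; have nN := n_gt0 (leqnn N).
apply: le_trans (normc_sum _ _ _) _.
apply: (@le_trans _ _ (\sum_(c <- C N | active N c) (3 / 10 * alpha / n N))).
  rewrite (bigID (active N)) /= [X in _ + X]big_seq_cond [X in _ + X]big1 ?addr0.
    rewrite big_seq_cond [leRHS]big_seq_cond; apply: ler_sum => c /andP[cC _].
    have c1 := C_le1 cC.
    have tN : (2 * N - N = N)%N by rewrite mul2n -addnn addnK.
    have := removed_thr x (leqnn N) c1; rewrite tN (mean_id sB trX); last 2 first.
    - by rewrite -{1}tN; apply: intermediate_tile.
    - move=> y a Ua; rewrite /cap_energy big_seq_cond [RHS]big_seq_cond; apply: eq_bigr => c' /andP[c'C cc'].
      rewrite -(C_inj capC cC c'C cc').
      exact: (normc2_h_plank (removed_equivariant (leqnn N)) cC).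
    rewrite /cap_energy (eq_bigl (fun c' => predT c' && same_cap N c' c)) => [|c']; last first.
      by rewrite /= (same_cap_sym p na).
    rewrite (sum_center na p2 capC _ _ cC) /= -normc2E => h1.
    (* [1 / kappa <= (3/10)^2] because [kappa >= 14]. *)
    have h2 : alpha ^+ 2 / kappa / n N ^+ 2 <= (3 / 10 * alpha / n N) ^+ 2.
      rewrite !exprMn -!exprVn ler_wpM2r ?sqr_ge0 // mulrC ler_wpM2r ?sqr_ge0 //.
      have k14 : 14 <= kappa.
        by apply: le_trans kappaN; rewrite ler_peMr // exprn_ege1 // ler1n.
      by rewrite invf_ple ?posrE ?kappa_gt0 //; lra.
    have r0 : 0 <= 3 / 10 * alpha / n N.
      by apply: divr_ge0; [apply: mulr_ge0; [lra | exact: ltW] | exact: ltW].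
    by have := le_trans h1 h2; rewrite ler_pXn2r ?nnegrE ?normc_ge0.
  move=> c /andP[cC nact]; rewrite /removed (inactive_F cC nact cC) ?(same_cap_refl na p2) //.
  by rewrite if_same normc0.
rewrite sum_const_count mulrCA -[leRHS]mulr1 ler_wpM2l //.
  by apply: mulr_ge0; [lra | exact: ltW].
by rewrite ler_pdivrMr // mul1r active_n.
Qed.

Lemma total_decomposition x : total F x =
  total (kept 0) x + \sum_(0 <= k < N) total (removed k) x + total (removed N) x.
Proof.
rewrite -addrA -big_nat_recr //= /total exchange_big -big_split /=.
by apply: eq_bigr => c _; apply: F_decomposition.
Qed.

(** The three shares add up to the whole: [1/5 + N / (2 N) + 3/10 = 1]. *)
Lemma level_set_pigeonhole x : B x -> alpha < normc (total F x) ->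
  alpha / 5 <= normc (total (kept 0) x) \/
  exists2 k, (k < N)%N & alpha / (2 * N%:R) <= normc (total (removed k) x).
Proof.
move=> Bx; rewrite total_decomposition => big.
have [h1|h1] := leP (alpha / 5) (normc (total (kept 0) x)); first by left.
right; case: (boolP (has (fun k => alpha / (2 * N%:R) <= normc (total (removed k) x)) (index_iota 0 N))).
  by move=> /hasP[k]; rewrite mem_index_iota => /andP[_ kN] h2; exists k.
move=> /hasPn small; have h3 := removed_small Bx.
have h2 : normc (\sum_(0 <= k < N) total (removed k) x) <= alpha / 2.
  apply: le_trans (normc_sum _ _ _) _.
  apply: (@le_trans _ _ (\sum_(0 <= k < N) alpha / (2 * N%:R))).
    rewrite big_nat [leRHS]big_nat; apply: ler_sum => k kN.
    by have := small k; rewrite mem_index_iota => /(_ kN); rewrite -ltNge => /ltW.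
  rewrite big_const_nat subn0 iter_addr_0 -[leLHS]mulr_natl le_eqVlt; apply/orP; left.
  by apply/eqP; field; rewrite pnatr_eq0 -lt0n.
have := le_normcD (total (kept 0) x + \sum_(0 <= k < N) total (removed k) x) (total (removed N) x).
have := le_normcD (total (kept 0) x) (\sum_(0 <= k < N) total (removed k) x).
move=> h4 h5; exfalso; move: alpha0 big h1 h2 h3 h4 h5; lra.
Qed.

Lemma level_set_bound e cb : 0 < e <= 1 -> (1 + e) ^+ (4 * N) <= 3 ->
  4 * p ^+ 2 <= cb -> (1 + e) ^+ 4 * (p - 1) <= 2 * e ^+ 2 * cb ->
  alpha ^+ 4 * (count (fun x => alpha < normc (total F x)) X)%:R <=
  (48 * N%:R ^+ 6 * (4 * (cb * M) * (M * (2 * p ^+ 4 * M + 2 * p * M * N.-1%:R + 1))) +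
   1250 * p * M) * W.
Proof.
move=> e01 e3 cb1 cb2; have [e0 e1] := andP e01.
have e1_ge1 : 1 <= 1 + e by lra.
have e1_gt0 i : 0 < (1 + e) ^+ i by rewrite exprn_gt0 //; lra.
have nN0 : 0 < N%:R :> R by rewrite ltr0n.
have p0 := p_gt0 p2; have M0 : 0 <= M := le_trans ler01 M1.
have W0 : 0 <= W by apply: sumr_ge0 => m _; apply: good_wave_ge0.
have cb0 : 0 <= cb by apply: le_trans cb1; rewrite mulr_ge0 // sqr_ge0.
set Z := 4 * (cb * M) * (M * (2 * p ^+ 4 * M + 2 * p * M * N.-1%:R + 1)).
have Z0 : 0 <= Z.
  apply: mulr_ge0; first by rewrite !mulr_ge0.
  apply: mulr_ge0 => //; apply: addr_ge0 => //.
  by apply: addr_ge0; rewrite !mulr_ge0 ?exprn_ge0 // ltW.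
pose Q0 x := alpha / 5 <= normc (total (kept 0) x).
pose Q k x := alpha / (2 * N%:R) <= normc (total (removed k) x).
pose big x := alpha < normc (total F x).
pose c0 := count Q0 X; pose c_ k := count (Q k) X.
have cnt : (count big X <= c0 + \sum_(0 <= k < N) c_ k)%N.
  rewrite /c0 -!sum1_count (eq_bigr (fun k => \sum_(x <- X | Q k x) 1%N)) => [|k _];
    last by rewrite /c_ sum1_count.
  rewrite [X in (_ <= X + _)%N]big_mkcond /=.
  rewrite (eq_bigr (fun k => \sum_(x <- X) if Q k x then 1%N else 0%N)) => [|k _];
    last by rewrite big_mkcond.
  rewrite exchange_big -big_split big_mkcond big_seq [leqRHS]big_seq /=.
  apply: leq_sum => x xX; case: ifP => // bigx.
  have Bx : B x by case: trX => _ + _ _; apply.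
  have [h1|[k kN h1]] := level_set_pigeonhole Bx bigx; first by rewrite /Q0 h1.
  by rewrite addnC (bigD1_seq k) ?mem_index_iota ?iota_uniq //= /Q h1.
have h0 : alpha ^+ 4 * c0%:R <= 1250 * p * M * W.
  have t0 : 0 < alpha / 5 by rewrite divr_gt0.
  have := level_set_low (@kept_equivariant 0) t0 kept_wave; rewrite -/c0 exprMn exprVn => h.
  rewrite (_ : alpha ^+ 4 * c0%:R = 625 * (alpha ^+ 4 / 5 ^+ 4 * c0%:R)); last by field.
  rewrite (_ : 1250 * p * M * W = 625 * (2 * p * (M * W))); last by ring.
  by apply: ler_wpM2l h; apply: ler0n.
have hk k : (k < N)%N -> alpha ^+ 4 * (c_ k)%:R <= 48 * N%:R ^+ 5 * Z * W.
  move=> kN; have t0 : 0 < alpha / (2 * N%:R) by rewrite divr_gt0 // mulr_gt0.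
  have kN' := ltnW kN; have kap := kappa_gt0.
  (* As [(1 + e)^(2k)] is at most the square root of 3, below [7/4], the condition becomes
     [kappa >= 4 * (7/2) * N^2 = 14 * N^2]. *)
  have ht : 2 * (alpha ^+ 2 / kappa) * (1 + e) ^+ (2 * k) <= (alpha / (2 * N%:R)) ^+ 2.
    have e2 : (1 + e) ^+ (2 * k) <= 7 / 4.
      apply: (@le_trans _ _ ((1 + e) ^+ (2 * N))); first by rewrite ler_weXn2l // leq_mul2l ltnW.
      have n74 : 0 <= 7 / 4 :> R by rewrite divr_ge0.
      rewrite -(@ler_pXn2r _ 2) ?nnegrE ?(ltW (e1_gt0 _)) //.
      by rewrite -exprM mulnAC -[(2 * 2)%N]/4%N; apply: le_trans e3 _; rewrite expr2; lra.
    apply: (@le_trans _ _ (2 * (alpha ^+ 2 / kappa) * (7 / 4))).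
      by rewrite ler_wpM2l // mulr_ge0 // divr_ge0 ?sqr_ge0 // ltW.
    rewrite (_ : 2 * _ * _ = alpha ^+ 2 * (7 / 2) / kappa); last by field; rewrite gt_eqF.
    rewrite ler_pdivrMr // (_ : (alpha / _) ^+ 2 * kappa = alpha ^+ 2 * (kappa / (4 * N%:R ^+ 2))).
      rewrite ler_wpM2l ?sqr_ge0 // ler_pdivlMr ?mulr_gt0 ?exprn_gt0 //.
      by apply: le_trans kappaN; rewrite le_eqVlt; apply/orP; left; apply/eqP; field.
    by field; rewrite gt_eqF.
  have inact c c' x : c \in C k -> ~~ active k c -> c' \in C N -> same_cap k c c' -> B x ->
      removed k c' x = 0.
    move=> cC nact c'C cc' Bx; rewrite /removed (inactive_F cC nact c'C cc' Bx).
    by rewrite if_same.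
  have thr c x : c \in C k -> B x ->
      mean X (tile k c) (cap_energy (removed k) k c) x <= alpha ^+ 2 / kappa / n k ^+ 2.
    by move=> cC _; apply: removed_thr => //; apply: C_le1 cC.
  have := level_set_high (removed_equivariant kN') kN (n_gt0 kN') inact (active_n kN') thr t0
    e01 ht cb1 cb2 (removed_wave k).
  rewrite -/(c_ k) => h.
  rewrite (_ : alpha ^+ 4 * _ = (2 * N%:R) ^+ 4 * ((alpha / (2 * N%:R)) ^+ 4 * (c_ k)%:R)); last first.
    by field; rewrite gt_eqF.
  (* Undoing the threshold costs [(2 N)^4], the descents cost 3 and the stopping scales
     [k + 1 <= N]: together [48 * N^5] for each removed part. *)
  apply: (@le_trans _ _ ((2 * N%:R) ^+ 4 * (3 * (N%:R * (Z * W))))); last first.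
    by rewrite le_eqVlt; apply/orP; left; apply/eqP; ring.
  rewrite ler_wpM2l ?exprn_ge0 ?mulr_ge0 //; apply: le_trans h _.
  have ZW : 0 <= Z * W by apply: mulr_ge0.
  rewrite (_ : 4 * (cb * M) * _ = Z * W); last by rewrite /Z; ring.
  apply: ler_pM; [exact: ltW | exact: (mulr_ge0 (ler0n _ _) ZW) | | ].
    by apply: le_trans e3; rewrite ler_weXn2l // leq_mul2l ltnW.
  by rewrite ler_wpM2r // ler_nat.
apply: (@le_trans _ _ (alpha ^+ 4 * (c0 + \sum_(0 <= k < N) c_ k)%N%:R)).
  by rewrite ler_wpM2l ?exprn_ge0 ?(ltW alpha0) // ler_nat.
rewrite natrD mulrDr addrC natr_sum mulr_sumr mulrDl; apply: lerD => //.
apply: (@le_trans _ _ (\sum_(0 <= k < N) 48 * N%:R ^+ 5 * Z * W)).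
  by rewrite big_nat [leRHS]big_nat; apply: ler_sum => k /andP[_]; apply: hk.
rewrite big_const_nat subn0 iter_addr_0 -[leLHS]mulr_natl.
by rewrite le_eqVlt; apply/orP; left; apply/eqP; ring.
Qed.

End Pruning.
End HighLow.

(** * Collecting the constants *)

Section Constants.
Variables (R : rcfType) (p : R) (N : nat).
Hypotheses (p2 : 2 <= p) (N0 : (0 < N)%N).

Let n1 : 1 <= N%:R :> R. Proof. by rewrite ler1n. Qed.

(** With these choices [2 * e^2 * cb = 5/8 * p^2], and [(1 + e)^4 * (p - 1) <= (5/4)^4 * p^2 / 4] is
    just below it. *)
Lemma broad_constant : let e := (4 * N%:R)^-1 in let cb := 5 * N%:R ^+ 2 * p ^+ 2 in
  [/\ 0 < e <= 1, 4 * p ^+ 2 <= cb & (1 + e) ^+ 4 * (p - 1) <= 2 * e ^+ 2 * cb].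
Proof.
move=> e cb; have n0 : 0 < N%:R :> R by rewrite ltr0n.
have e0 : 0 < e by rewrite invr_gt0 mulr_gt0.
have e4 : e <= 1 / 4.
  by rewrite /e -[leLHS]div1r ler_pdivrMr ?mulr_gt0 //; move: n1; lra.
have pp : 0 <= p ^+ 2 by apply: sqr_ge0.
have nn : 1 <= N%:R ^+ 2 :> R by rewrite exprn_ege1.
split; first by apply/andP; split=> //; lra.
  by rewrite /cb; nra.
rewrite (_ : 2 * e ^+ 2 * cb = 5 / 8 * p ^+ 2); last by rewrite /e /cb; field; rewrite gt_eqF.
have h1 : (1 + e) ^+ 4 <= (5 / 4) ^+ 4 by rewrite lerXn2r ?nnegrE //; lra.
apply: (@le_trans _ _ ((5 / 4) ^+ 4 * (p - 1))); first by rewrite ler_wpM2r //; move: p2; lra.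
by have := sqr_ge0 (p - 2); lra.
Qed.

(** With [P = p^3 >= 8] the lower order terms are absorbed: [240 * 65/64 + 5/4 = 245]. *)
Lemma total_constant :
  48 * N%:R ^+ 6 * (4 * (5 * N%:R ^+ 2 * p ^+ 2 * (p ^+ 2 / 2)) * ((p ^+ 2 / 2) *
    (2 * p ^+ 4 * (p ^+ 2 / 2) + 2 * p * (p ^+ 2 / 2) * N.-1%:R + 1))) +
  1250 * p * (p ^+ 2 / 2) <= 245 * N%:R ^+ 10 * p ^+ 12.
Proof.
have -> : N.-1%:R = N%:R - 1 :> R by rewrite -subn1 natrB.
have := n1; set n := N%:R => n_1.
have p3 : 8 <= p ^+ 3 by rewrite (_ : 8 = 2 ^+ 3) ?lerXn2r ?nnegrE //; move: p2; lra.
set P := p ^+ 3 in p3.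
have -> : 48 * n ^+ 6 * (4 * (5 * n ^+ 2 * p ^+ 2 * (p ^+ 2 / 2)) * ((p ^+ 2 / 2) *
    (2 * p ^+ 4 * (p ^+ 2 / 2) + 2 * p * (p ^+ 2 / 2) * (n - 1) + 1))) +
  1250 * p * (p ^+ 2 / 2) = 240 * n ^+ 8 * P ^+ 2 * (P ^+ 2 + P * (n - 1) + 1) + 625 * P.
  by rewrite /P; field.
have -> : p ^+ 12 = P ^+ 4 by rewrite /P -exprM.
have P4 : P * 512 <= P ^+ 4.
  rewrite (exprS P 3); apply: ler_wpM2l; first by lra.
  have -> : 512 = 8 ^+ 3 :> R by ring.
  by rewrite lerXn2r ?nnegrE //; lra.
have n9 : 1 <= n ^+ 10 by rewrite exprn_ege1.
have br : P ^+ 2 + P * (n - 1) + 1 <= 65 / 64 * n ^+ 2 * P ^+ 2.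
  have h1 : P * (n - 1) <= P ^+ 2 * (n - 1) / 8 by rewrite ler_pdivlMr //; nra.
  have h2 : 64 <= P ^+ 2 by nra.
  have h3 : n <= n ^+ 2 by nra.
  have h4 : 0 <= P ^+ 2 by nra.
  have h5 : P ^+ 2 * n <= P ^+ 2 * n ^+ 2 by rewrite ler_wpM2l.
  have h6 : P ^+ 2 <= P ^+ 2 * n by rewrite ler_peMr.
  lra.
have n0 : 0 <= n by apply: le_trans n_1.
have P00 : 0 <= P by apply: le_trans p3.
have P0 : 0 <= P ^+ 4 by apply: exprn_ge0.
apply: (@le_trans _ _ (240 * n ^+ 8 * P ^+ 2 * (65 / 64 * n ^+ 2 * P ^+ 2) + 5 / 4 * (n ^+ 10 * P ^+ 4))).
  apply: lerD.
    apply: ler_wpM2l br; apply: mulr_ge0; last exact: exprn_ge0.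
    by apply: mulr_ge0; [exact: ler0n | exact: exprn_ge0].
  have : P ^+ 4 <= n ^+ 10 * P ^+ 4 by rewrite ler_peMl.
  by lra.
have : 0 <= n ^+ 10 * P ^+ 4 by apply: mulr_ge0 P0; apply: exprn_ge0.
rewrite (_ : 240 * n ^+ 8 * P ^+ 2 * _ = 975 / 4 * (n ^+ 10 * P ^+ 4)); last by field.
by rewrite -mulrA; lra.
Qed.

End Constants.

(** * Digit expansions in a local field *)

Section LocalField.
Variables (R : realType) (K : fieldType) (absv : K -> R) (w : K) (reps : seq K).
Hypothesis na : ultrametric_abs absv.
Hypothesis unif : is_uniformizer absv w.
Hypothesis repsP : [/\ forall r, r \in reps -> absv r <= 1,
  forall i j, (i < size reps)%N -> (j < size reps)%N -> i != j ->
    1 <= absv (nth 0 reps i - nth 0 reps j),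
  forall x, absv x <= 1 -> exists2 r, r \in reps & absv (x - r) < 1 &
  absv w = ((size reps)%:R)^-1].

Local Notation q := (size reps).

Lemma absw_gt0 : 0 < absv w. Proof. by case: unif => /andP[]. Qed.
Lemma absw_lt1 : absv w < 1. Proof. by case: unif => /andP[]. Qed.
Lemma w_neq0 : w != 0. Proof. by rewrite -(abs_gt0 na) absw_gt0. Qed.
Lemma absw_lt x : absv x < 1 -> absv x <= absv w. Proof. by case: unif => _; apply. Qed.
Lemma abswE : absv w = q%:R^-1. Proof. by case: repsP. Qed.

Lemma q_gt1 : (1 < q)%N.
Proof.
have := absw_gt0; have := absw_lt1; rewrite abswE invr_gt0 ltr0n => h q0.
by move: h; rewrite invf_lt1 ?ltr0n // ltr1n.
Qed.

Lemma abswX_gt0 n : 0 < absv w ^+ n. Proof. exact: exprn_gt0 absw_gt0. Qed.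

Lemma abswX_lt x n : absv x < absv w ^+ n -> absv x <= absv w ^+ n.+1.
Proof.
move=> xn; have wn0 : w ^+ n != 0 by rewrite expf_neq0 ?w_neq0.
have e : x = x / w ^+ n * w ^+ n by rewrite divfK.
rewrite e absM // absX // exprS ler_pM2r ?abswX_gt0 //; apply: absw_lt.
by rewrite absM // absV // absX // ltr_pdivrMr ?abswX_gt0 // mul1r.
Qed.

Lemma reps_inj r r' : r \in reps -> r' \in reps -> absv (r - r') < 1 -> r = r'.
Proof.
case: repsP => _ sep _ _ rR r'R lt1.
rewrite -(nth_index 0 rR) -(nth_index 0 r'R); congr nth; apply/eqP.
apply: contraTT lt1 => ne; rewrite -leNgt.
by have := sep _ _ _ _ ne; rewrite !index_mem !nth_index //; apply.
Qed.

Lemma reps_uniq : uniq reps.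
Proof.
apply/(uniqP 0) => i j; rewrite !inE => iq jq e; apply/eqP.
case: repsP => _ sep _ _; apply/negPn/negP => ne.
by have := sep _ _ iq jq ne; rewrite e subrr abs0 // ler10.
Qed.

(** Truncated expansions to base [w]: representatives of the unit ball modulo the ball of radius
    [|w|^n]. They serve both as cap centers and, rescaled, as the grid of [B / D]. *)
Fixpoint digits n : seq K :=
  if n is n'.+1 then [seq r + w * z | r <- reps, z <- digits n'] else [:: 0].

Lemma digits_le1 n z : z \in digits n -> absv z <= 1.
Proof.
elim: n z => [|n IH] z /=; first by rewrite inE => /eqP ->; rewrite abs0.
move=> /allpairsP[[r y] /= [rR yn ->]]; case: repsP => r1 _ _ _.
apply: absD_le => //; first exact: r1.
by rewrite -[leRHS]mulr1; apply: (absM_le na (ltW absw_lt1) (IH _ yn)).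
Qed.

Lemma digits_ex n x : absv x <= 1 -> exists2 z, z \in digits n & absv (x - z) <= absv w ^+ n.
Proof.
elim: n x => [|n IH] x x1 /=; first by exists 0; rewrite ?inE // subr0.
case: (repsP) => _ _ ex _; have [r rR xr] := ex x x1.
have [y yn xy] : exists2 y, y \in digits n & absv ((x - r) / w - y) <= absv w ^+ n.
  by apply: IH; rewrite absM // absV // ler_pdivrMr ?absw_gt0 // mul1r absw_lt.
exists (r + w * y); first by apply/allpairsP; exists (r, y).
have -> : x - (r + w * y) = w * ((x - r) / w - y) by field; exact: w_neq0.
by rewrite exprS absM_le.
Qed.

Lemma digit_split n r r' y y' : r \in reps -> r' \in reps ->
  y \in digits n -> y' \in digits n ->
  absv (r + w * y - (r' + w * y')) <= absv w ^+ n.+1 -> r = r' /\ absv (y - y') <= absv w ^+ n.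
Proof.
move=> rR r'R yn y'n h.
have yy : absv (w * (y - y')) <= absv w.
  by rewrite -[leRHS]mulr1 absM_le // absB_le ?(digits_le1 yn) ?(digits_le1 y'n).
have rr : r = r'.
  apply: reps_inj => //; apply: le_lt_trans absw_lt1.
  have -> : r - r' = (r + w * y - (r' + w * y')) - w * (y - y') by ring.
  apply: absB_le => //; apply: le_trans h _.
  by rewrite exprS ler_piMr ?(ltW absw_gt0) // exprn_ile1 ?(ltW absw_gt0) ?(ltW absw_lt1).
split=> //; move: h; rewrite -rr (_ : _ - _ = w * (y - y')); last by ring.
by rewrite absM // exprS ler_pM2l // absw_gt0.
Qed.

Lemma digits_inj n z z' : z \in digits n -> z' \in digits n ->
  absv (z - z') <= absv w ^+ n -> z = z'.
Proof.
elim: n z z' => [|n IH] z z' /=; first by rewrite !inE => /eqP -> /eqP ->.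
move=> /allpairsP[[r y] /= [rR yn ->]] /allpairsP[[r' y'] /= [r'R y'n ->]].
by move=> /(digit_split rR r'R yn y'n)[-> /(IH _ _ yn y'n) ->].
Qed.

Lemma size_digits n : size (digits n) = (q ^ n)%N.
Proof. by elim: n => //= n IH; rewrite size_allpairs IH expnS. Qed.

Lemma digits_uniq n : uniq (digits n).
Proof.
elim: n => //= n IH; apply: allpairs_uniq => //; first exact: reps_uniq.
move=> i i' /allpairsP[[r y] /= [rR yn ->]] /allpairsP[[r' y'] /= [r'R y'n ->]] /= e.
have [|-> yy] := @digit_split n r r' y y' rR r'R yn y'n.
  by rewrite e subrr abs0 // ltW // abswX_gt0.
by rewrite (digits_inj yn y'n yy).
Qed.

(* Pigeonhole: a separated family in a ball injects into the digits of the quotient. *)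
Lemma separated_size (s : seq K) c m n : (m <= n)%N -> uniq s ->
  (forall z z', z \in s -> z' \in s -> absv (z - z') <= absv w ^+ n -> z = z') ->
  (forall z, z \in s -> absv (z - c) <= absv w ^+ m) -> (size s <= q ^ (n - m))%N.
Proof.
move=> mn us sep ball_s; have wm0 : w ^+ m != 0 by rewrite expf_neq0 ?w_neq0.
pose D := digits (n - m).
pose P z y := absv ((z - c) / w ^+ m - y) <= absv w ^+ (n - m).
pose g z := nth 0 D (find (P z) D).
have gP z : z \in s -> g z \in D /\ P z (g z).
  move=> /ball_s zc; have [y yD Py] : exists2 y, y \in D & P z y.
    by apply: digits_ex; rewrite absM // absV // absX // ler_pdivrMr ?abswX_gt0 // mul1r.
  have hy : has (P z) D by apply/hasP; exists y.
  by split; [rewrite mem_nth // -has_find | exact: (nth_find 0 hy)].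
rewrite -(size_digits (n - m)) -(size_map g); apply: uniq_leq_size.
  rewrite map_inj_in_uniq // => z z' zs z's e; apply: sep => //.
  have [_ h] := gP z zs; have [_ h'] := gP z' z's; rewrite -e in h'.
  have -> : z - z' = ((z - c) / w ^+ m - g z - ((z' - c) / w ^+ m - g z)) * w ^+ m by field.
  by rewrite -(subnK mn) exprD (absM na) absX // ler_pM2r ?abswX_gt0 // absB_le.
by move=> y /mapP[z /gP[gD _] ->].
Qed.

Lemma separated_count (s : seq K) (P : pred K) c m n : (m <= n)%N -> uniq s ->
  (forall z z', z \in s -> z' \in s -> absv (z - z') <= absv w ^+ n -> z = z') ->
  (forall z, z \in s -> P z -> absv (z - c) <= absv w ^+ m) -> (count P s <= q ^ (n - m))%N.
Proof.
move=> mn us sep PB; rewrite -size_filter; apply: (separated_size (c := c)) => //.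
- exact: filter_uniq.
- by move=> z z'; rewrite !mem_filter => /andP[_ zs] /andP[_ z's]; apply: sep.
- by move=> z; rewrite mem_filter => /andP[Pz zs]; apply: PB.
Qed.

Definition grid L : seq (K * K) :=
  [seq (w ^- L * a, w ^- L * b) | a <- digits (2 * L), b <- digits (2 * L)].

Let wL L : absv (w ^- L) = absv w ^- L. Proof. by rewrite absV // absX. Qed.

Lemma size_grid L : size (grid L) = (q ^ (4 * L))%N.
Proof. by rewrite size_allpairs size_digits -expnD -mulnDl. Qed.

Lemma grid_coset_reps L :
  coset_reps (grid L) (ballV absv (absv w ^+ L)) (ballV absv (absv w ^- L)).
Proof.
have wL0 : w ^- L != 0 by rewrite invr_neq0 // expf_neq0 ?w_neq0.
have wL1 : w ^+ L != 0 by rewrite expf_neq0 ?w_neq0.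
have pos : 0 < absv w ^- L by rewrite invr_gt0 abswX_gt0.
have e2 : absv w ^+ L = absv w ^- L * absv w ^+ (2 * L).
  by rewrite mul2n -addnn exprD mulKf // gt_eqF // abswX_gt0.
have dle a : a \in digits (2 * L) -> absv (w ^- L * a) <= absv w ^- L.
  by move=> /digits_le1 a1; rewrite absM // wL ger_pMr.
have dex z : absv z <= absv w ^- L ->
    exists2 a, a \in digits (2 * L) & absv (z - w ^- L * a) <= absv w ^+ L.
  move=> zL; have [a aD ha] : exists2 a, a \in digits (2 * L) &
      absv (w ^+ L * z - a) <= absv w ^+ (2 * L).
    by apply: digits_ex; rewrite absM // absX // mulrC -ler_pdivlMr ?abswX_gt0 // div1r.
  exists a => //; rewrite (_ : _ - _ = w ^- L * (w ^+ L * z - a)); last by rewrite mulrBr mulKf.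
  by rewrite absM // wL [leRHS]e2 ler_pM2l.
have dinj a b : a \in digits (2 * L) -> b \in digits (2 * L) ->
    absv (w ^- L * a - w ^- L * b) <= absv w ^+ L -> a = b.
  by move=> aD bD; rewrite -mulrBr absM // wL [leRHS]e2 ler_pM2l //; apply: digits_inj.
split.
- apply: allpairs_uniq; try exact: digits_uniq.
  by move=> [a b] [a' b'] _ _ /= [/(mulfI wL0) -> /(mulfI wL0) ->].
- by move=> x /allpairsP[[a b] /= [aD bD ->]]; apply/ballVP; rewrite /= !dle.
- move=> [y1 y2] /ballVP /= [h1 h2].
  have [[a aD ha] [b bD hb]] := (dex _ h1, dex _ h2).
  by exists (w ^- L * a, w ^- L * b); [apply/allpairsP; exists (a, b) | apply/ballVP].
move=> x x' /allpairsP[[a b] /= [aD bD ->]] /allpairsP[[a' b'] /= [a'D b'D ->]].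
by move=> /ballVP /= [/dinj -> // /dinj ->].
Qed.

Lemma unit_coset_reps L :
  coset_reps [seq (a, b) | a <- digits L, b <- digits L] (ballV absv (absv w ^+ L)) (ballV absv 1).
Proof.
split.
- by apply: allpairs_uniq; try exact: digits_uniq; move=> [a b] [a' b'].
- by move=> x /allpairsP[[a b] /= [/digits_le1 a1 /digits_le1 b1 ->]]; apply/ballVP.
- move=> [y1 y2] /ballVP /= [h1 h2].
  have [[a aD ha] [b bD hb]] := (digits_ex L h1, digits_ex L h2).
  by exists (a, b); [apply/allpairsP; exists (a, b) | apply/ballVP].
move=> x x' /allpairsP[[a b] /= [aD bD ->]] /allpairsP[[a' b'] /= [a'D b'D ->]].
by move=> /ballVP /= [/(digits_inj aD a'D) -> /(digits_inj bD b'D) ->].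
Qed.

Section CapCenters.
Variable eta : nat.
Hypothesis eta0 : (0 < eta)%N.
Local Notation p := ((absv w)^-1 ^+ eta).

Definition centers l := digits (eta * l).

Lemma pVE l : p ^- l = absv w ^+ (eta * l).
Proof. by rewrite exprVn exprVn invrK exprM. Qed.

Lemma p_ge2 : 2 <= p.
Proof.
rewrite abswE invrK -natrX (ler_nat _ 2); apply: leq_trans q_gt1 _.
by rewrite -{1}[q]expn1 leq_pexp2l // ltnW // q_gt1.
Qed.

Lemma centers_cap_centers : cap_centers absv p centers.
Proof.
split=> [l|l c|l z z1|l c c' cC c'C]; first exact: digits_uniq.
- exact: digits_le1.
- have [c cC zc] := digits_ex (eta * l) z1; exists c => //.
  by rewrite /same_cap pVE.
by rewrite /same_cap pVE; apply: digits_inj.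
Qed.

Let pE : p = (q ^ eta)%:R. Proof. by rewrite abswE invrK natrX. Qed.

Lemma centers_count_close l c : absv c <= 1 ->
  (count (fun c' => absv (c - c') <= p * p ^- l) (centers l))%:R <= p.
Proof.
move=> c1; case: l => [|l].
  apply: le_trans (_ : (size (centers 0))%:R <= _); first by rewrite ler_nat count_size.
  by rewrite /centers muln0 /=; apply: le_trans p_ge2; rewrite ler1n.
rewrite [leRHS]pE ler_nat -[eta in leqRHS](_ : (eta * l.+1 - eta * l = eta)%N); last first.
  by rewrite mulnS addnK.
apply: (@separated_count _ _ c).
- by rewrite leq_mul2l leqnSn orbT.
- exact: digits_uniq.
- by move=> z z'; apply: digits_inj.
move=> z _; rewrite absBC // -pVE; move=> h; apply: le_trans h _.
by rewrite exprS invfM mulrA divff ?mul1r // gt_eqF // exprn_gt0 // invr_gt0 absw_gt0.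
Qed.

(** The factor [1/2] comes from the strict inequality: absolute values are discrete, so the distance
    is smaller by a further factor [q], leaving [p^2 / q <= p^2 / 2] centers. For [l <= 1] all
    centers together are few enough. *)
Lemma centers_count_far l c :
  (count (fun c' => absv (c - c') < p ^+ 2 * p ^- l) (centers l))%:R <= p ^+ 2 / 2.
Proof.
have p0 : 0 < p by rewrite exprn_gt0 // invr_gt0 absw_gt0.
have p2 := p_ge2.
have small : (l <= 1)%N -> (count (fun c' => absv (c - c') < p ^+ 2 * p ^- l) (centers l))%:R <= p ^+ 2 / 2.
  move=> l1; apply: le_trans (_ : (size (centers l))%:R <= _); first by rewrite ler_nat count_size.
  rewrite size_digits expnM natrX -pE.
  case: l l1 => [|[|//]] _; rewrite ?expr0 ?expr1; nra.
case: l small => [|[|l]] small; try exact: small.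
apply: (@le_trans _ _ ((q ^ (eta * 2 - 1))%:R)).
  rewrite ler_nat (_ : (eta * 2 - 1 = eta * l.+2 - (eta * l).+1)%N); last first.
    by rewrite -(addn2 l) mulnDr -[(eta * l).+1]addn1 subnDl.
  apply: (@separated_count _ _ c).
  - by rewrite -(addn2 l) mulnDr -[(eta * l).+1]addn1 leq_add2l muln_gt0 eta0.
  - exact: digits_uniq.
  - by move=> z z'; apply: digits_inj.
  move=> z _; rewrite absBC // => h; apply: abswX_lt; apply: lt_le_trans h _.
  rewrite -pVE -(addn2 l) exprD invfM [p ^- l * _]mulrC mulrA divff ?mul1r //.
  by rewrite expf_neq0 // gt_eqF.
rewrite ler_pdivlMr //.
have -> : (p ^+ 2) = (q ^ (eta * 2))%:R by rewrite pE -natrX -expnM.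
rewrite -natrM ler_nat (_ : (eta * 2 = (eta * 2 - 1).+1)%N) ?expnSr ?subSS ?subn0.
  by rewrite leq_mul2l q_gt1 orbT.
by rewrite subn1 prednK // muln_gt0 eta0.
Qed.

End CapCenters.
End LocalField.

(** * Integrals of step functions as finite sums *)

Section StepIntegral.
Variables (R : realType) (K : fieldType) (absv : K -> R).
Variable mu : {measure set (g_sigma_algebraType (balls2 absv)) -> \bar R}.
Hypothesis na : ultrametric_abs absv.
Hypothesis haar : haar_normalized mu.
Local Notation V := (g_sigma_algebraType (balls2 absv)).

Definition cell (delta : R) (c : K * K) : set V := ball2 absv c delta.

Lemma cellE delta c y : cell delta c y = ballV absv delta (y - c) :> Prop.
Proof. by case: y c => [y1 y2] [c1 c2]. Qed.

Lemma measurable_cell delta c : 0 < delta -> measurable (cell delta c).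
Proof. by move=> d0; apply: sub_sigma_algebra; exists c, delta. Qed.

Definition cell_measure delta : R := fine (mu (cell delta (0, 0))).

Lemma mu_cell delta c : 0 < delta <= 1 -> mu (cell delta c) = (cell_measure delta)%:E.
Proof.
move=> /andP[d0 d1]; have [inv O1] := haar.
have -> : mu (cell delta c) = mu (cell delta (0, 0)).
  rewrite -(inv c (cell delta (0, 0))); last exact: measurable_cell.
  congr (mu _); apply/seteqP; split => -[y1 y2];
    by rewrite /translate /= !cellE /ballV /absV2 /sub2 /= !subr0.
rewrite /cell_measure fineK // ge0_fin_numE //.
apply: (@le_lt_trans _ _ (mu (O2 absv))); last by rewrite O1 ltry.
rewrite le_measure ?inE //; first exact: measurable_cell.
  exact: (measurable_cell (delta := 1)).
by move=> y; rewrite /O2 -/(cell 1 (0, 0)) !cellE; apply: ballV_le.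
Qed.

Section Reps.
Variables (X : seq (K * K)) (delta rho : R).
Hypotheses (d01 : 0 < delta <= 1) (drho : delta <= rho).
Hypothesis trX : coset_reps X (ballV absv delta) (ballV absv rho).
Local Notation D := (ballV absv delta).
Local Notation B := (ballV absv rho).

Let sD : subgrp D. Proof. by apply: subgrp_ballV => //; case/andP: d01 => /ltW. Qed.
Let mcell c : measurable (cell delta c).
Proof. by apply: measurable_cell; case/andP: d01. Qed.
Let sB : subgrp B.
Proof. by apply: subgrp_ballV => //; apply: le_trans drho; case/andP: d01 => /ltW. Qed.

Lemma sum_cells (W : nmodType) (g : K * K -> W) y : periodic D g -> B y ->
  \sum_(x <- X | D (y - x)) g x = g y.
Proof.
move=> pg By; have [uX XB ex inj] := trX; have [x0 x0X Dx] := ex y By.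
rewrite big_mkcond (bigD1_seq x0) //= Dx big_seq_cond big1 ?addr0.
  have e : y = x0 + (y - x0) by rewrite addrC subrK.
  by rewrite [in RHS]e pg.
move=> x /andP[xX ne]; case: ifP => // Dx'; case/eqP: ne; apply: inj => //.
have -> : x - x0 = (y - x0) - (y - x) by rewrite opprB [RHS]addrC addrA subrK.
exact: (proj2 sD).
Qed.

Lemma step_decomposition (g : K * K -> R) y : periodic D g -> (forall z, ~~ B z -> g z = 0) ->
  g y = \sum_(x <- X) g x * \1_(cell delta x) y.
Proof.
move=> pg g0; have [uX XB _ _] := trX.
rewrite (eq_bigr (fun x => if D (y - x) then g x else 0)) => [|x _]; last first.
  rewrite indicE; case: ifP => h.
    by rewrite mem_set ?mulr1 // cellE.
  by rewrite memNset ?mulr0 // cellE h.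
rewrite -big_mkcond; have [By|nBy] := boolP (B y); first by rewrite sum_cells.
rewrite g0 // big_seq_cond big1 // => x /andP[/XB Bx Dx].
case/negP: nBy; rewrite -(subrK x y); apply: subgrpD => //.
exact: ballV_le Dx.
Qed.

Let int_cell (a : R) x : mu.-integrable setT (fun y => (a * \1_(cell delta x) y)%:E).
Proof.
apply: (@integrableZl _ _ _ mu setT measurableT a (fun y => (\1_(cell delta x) y)%:E)).
apply/integrableP; split.
  by apply/measurable_EFinP; apply: measurable_indic; apply: mcell.
rewrite (eq_integral (fun y => (\1_(cell delta x) y)%:E)) => [|y _]; last by rewrite gee0_abs.
by rewrite integral_indic ?setIT // mu_cell ?ltry.
Qed.

Lemma step_integral (g : K * K -> R) : periodic D g -> (forall z, ~~ B z -> g z = 0) ->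
  (\int[mu]_y (g y)%:E)%E = (cell_measure delta * \sum_(x <- X) g x)%:E.
Proof.
move=> pg g0.
under eq_integral do rewrite (step_decomposition _ pg g0) -sumEFin.
rewrite (integral_sum measurableT (f := fun x y => (g x * \1_(cell delta x) y)%:E)) //.
rewrite mulr_sumr -sumEFin; apply: eq_bigr => x _.
under eq_integral do rewrite EFinM.
rewrite integralZl //; last first.
  by have := int_cell 1 x; under eq_fun do rewrite mul1r.
by rewrite integral_indic // setIT mu_cell // -EFinM mulrC.
Qed.

Lemma step_Rintegral (g : K * K -> R) : periodic D g -> (forall z, ~~ B z -> g z = 0) ->
  Rintegral mu setT g = cell_measure delta * \sum_(x <- X) g x.
Proof. by move=> pg g0; rewrite /Rintegral step_integral. Qed.

Lemma step_measurable (U : pred (K * K)) : periodic D U -> (forall z, U z -> B z) ->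
  measurable ([set z | U z] : set V).
Proof.
move=> pU UB; have -> : [set z | U z] = \big[setU/set0]_(x <- X | U x) cell delta x.
  apply/seteqP; split => [y Uy|y] /=.
    have [_ XB ex _] := trX; have [x xX Dx] := ex y (UB y Uy).
    rewrite -bigcup_seq_cond; exists x; last by rewrite cellE.
    by rewrite /= xX /= -(pU x _ Dx) addrC subrK.
  rewrite -bigcup_seq_cond => -[x /= /andP[xX Ux]]; rewrite cellE => Dx.
  by rewrite -(subrK x y) addrC pU.
by apply: bigsetU_measurable => x _; apply: mcell.
Qed.

Lemma step_measure (U : pred (K * K)) : periodic D U -> (forall z, U z -> B z) ->
  mu [set z | U z] = (cell_measure delta * (count U X)%:R)%:E.
Proof.
move=> pU UB; have mU := step_measurable pU UB.
rewrite -[X in mu X]setIT -(integral_indic mu measurableT mU).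
have e y : \1_([set z | U z] : set V) y = (U y)%:R :> R.
  by rewrite indicE; congr ((nat_of_bool _)%:R); apply/idP/idP; rewrite inE.
under eq_integral do rewrite e.
rewrite (step_integral (g := fun y => (U y)%:R)); first last.
- by move=> z nB; case Uz: (U z) => //; rewrite (UB z Uz) in nB.
- by move=> x d Dd; rewrite pU.
congr (_ * _)%:E; rewrite -sum1_count natr_sum [RHS]big_mkcond.
by apply: eq_bigr => x _; case: (U x).
Qed.

End Reps.

(** The unit ball has measure 1 and splits into [q^(2L)] translates of the cell. *)
Lemma cell_measureE (w : K) (reps : seq K) L : is_uniformizer absv w ->
  [/\ forall r, r \in reps -> absv r <= 1,
      forall i j, (i < size reps)%N -> (j < size reps)%N -> i != j ->
        1 <= absv (nth 0 reps i - nth 0 reps j),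
      forall x, absv x <= 1 -> exists2 r, r \in reps & absv (x - r) < 1 &
      absv w = ((size reps)%:R)^-1] ->
  cell_measure (absv w ^+ L) = (size reps)%:R ^- (2 * L).
Proof.
move=> unif repsP; have tr := unit_coset_reps na unif repsP L.
have w0 := absw_gt0 unif; have w1 := absw_lt1 unif.
have d01 : 0 < absv w ^+ L <= 1 by rewrite exprn_gt0 // exprn_ile1 // ltW.
have [_ O1] := haar; have [_ d1] := andP d01.
have sub y d : absv w ^+ L <= d -> ballV absv (absv w ^+ L) y -> ballV absv d y.
  exact: ballV_le.
have pU : periodic (ballV absv (absv w ^+ L)) (ballV absv 1).
  move=> x d /(sub _ _ d1) Dd; have s1 := subgrp_ballV na ler01.
  apply/idP/idP => h; last exact: subgrpD.
  by rewrite -(addrK d x); apply: (proj2 s1).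
have := step_measure d01 d1 tr pU (fun _ h => h).
rewrite (_ : [set z | ballV absv 1 z] = O2 absv); last first.
  by apply/seteqP; split => -[y1 y2]; rewrite /O2 -/(cell 1 (0, 0)) cellE /= /ballV /absV2 /= !subr0.
rewrite O1 => /(congr1 fine) /= e.
have cnt : count (ballV absv 1) [seq (a, b) | a <- digits w reps L, b <- digits w reps L] =
    (size reps ^ (2 * L))%N.
  rewrite -[RHS]/(size reps ^ (2 * L))%N mul2n -addnn expnD -!(size_digits w reps).
  rewrite -(size_allpairs (fun a b => (a, b))); apply/eqP; rewrite -all_count; apply/allP => x.
  by case: tr => _ + _ _; apply.
rewrite cnt in e; have q0 : (size reps)%:R ^+ (2 * L) != 0 :> R.
  by rewrite expf_neq0 // pnatr_eq0 -lt0n ltnW // (q_gt1 unif repsP).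
by apply: (mulIf q0); rewrite mulVf // -natrX.
Qed.

End StepIntegral.

Lemma expVn_sqr (F : fieldType) (x : F) l : (x ^- l) ^+ 2 = x ^- (2 * l).
Proof. by rewrite -exprVn -exprM mulnC exprVn. Qed.

(** The given nontrivial value at [x], with [|x| <= 1 / |w|], is reached as [t * (x / t)];
    discreteness gives [1 / |t| <= |w|] as soon as [|t| > 1]. *)
Lemma std_character_unitary (R : realType) (K : fieldType) (absv : K -> R) w ch :
  ultrametric_abs absv -> is_uniformizer absv w -> std_character absv w ch ->
  unitary_character absv ch.
Proof.
move=> na unif [chD ch1 chO [x [xw chx]]]; split=> // t t1.
have t0 : t != 0 by rewrite -(abs_gt0 na); apply: lt_trans t1.
exists (x / t); last by rewrite mulrC divfK.
have ti : absv t^-1 <= absv w.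
  by apply: (absw_lt unif); rewrite absV // invf_lt1 // (lt_trans _ t1).
have w0 := absw_gt0 unif.
rewrite absM //; apply: (@le_trans _ _ ((absv w)^-1 * absv w)).
  by apply: ler_pM; rewrite ?abs_ge0.
by rewrite mulVf // gt_eqF.
Qed.

(** * Fourier projections on the grid *)

Section Fourier.
Variables (R : realType) (K : fieldType) (absv : K -> R) (w : K) (reps : seq K).
Variables (eta N L : nat) (mu : {measure set (g_sigma_algebraType (balls2 absv)) -> \bar R}).
Variables (ch : K -> R[i]) (f : K2 K -> R[i]).
Hypothesis na : ultrametric_abs absv.
Hypothesis unif : is_uniformizer absv w.
Hypothesis repsP : [/\ forall r, r \in reps -> absv r <= 1,
  forall i j, (i < size reps)%N -> (j < size reps)%N -> i != j ->
    1 <= absv (nth 0 reps i - nth 0 reps j),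
  forall x, absv x <= 1 -> exists2 r, r \in reps & absv (x - r) < 1 &
  absv w = ((size reps)%:R)^-1].
Hypothesis haar : haar_normalized mu.
Hypothesis uc : unitary_character absv ch.
Hypothesis eta0 : (0 < eta)%N.
Hypothesis etaL : (eta * (2 * N) <= L)%N.

Local Notation p := ((absv w)^-1 ^+ eta).
Local Notation D := (ballV absv (absv w ^+ L)).
Local Notation B := (ballV absv (absv w ^- L)).
Local Notation X := (grid w reps L).
Local Notation C := (centers w reps eta).
Local Notation v := (cell_measure mu (absv w ^+ L)).

Let w0 : 0 < absv w := absw_gt0 unif.
Let w1 : absv w < 1 := absw_lt1 unif.
Let p2 : 2 <= p := p_ge2 unif repsP eta0.
Let capC : cap_centers absv p C := centers_cap_centers na unif repsP eta.
Let trX : coset_reps X D B := grid_coset_reps na unif repsP L.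

Lemma cell_radius : 0 < absv w ^+ L <= 1.
Proof. by rewrite exprn_gt0 // exprn_ile1 // ltW. Qed.
Lemma grid_radius_ge1 : 1 <= absv w ^- L.
Proof. by have /andP[h1 h2] := cell_radius; rewrite invf_ge1. Qed.
Lemma cell_le_grid : absv w ^+ L <= absv w ^- L.
Proof. by have /andP[_ h] := cell_radius; apply: le_trans h grid_radius_ge1. Qed.

Let absP0 : absv (w^-1 ^+ eta) = p. Proof. by rewrite absX // absV. Qed.
Let delta0 : 0 <= absv w ^+ L. Proof. by have /andP[/ltW] := cell_radius. Qed.
Let delta1 : absv w ^+ L <= 1. Proof. by have /andP[] := cell_radius. Qed.

Lemma pV2N : p ^- (2 * N) = absv w ^+ (eta * (2 * N)). Proof. exact: pVE. Qed.

(** The resolution must reach [1 / R] for indicators of caps to be step functions; dually, by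
    [p_le_grid], the ball [B] contains the tiles centered at 0. *)
Lemma cell_le_p : absv w ^+ L <= p ^- (2 * N).
Proof. by rewrite pV2N ler_wiXn2l // ltW. Qed.

Lemma p_le_grid : p ^+ (2 * N) <= absv w ^- L.
Proof.
move: cell_le_p; rewrite pV2N => h.
have -> : p ^+ (2 * N) = (absv w ^+ (eta * (2 * N)))^-1 by rewrite -pV2N invrK.
by rewrite lef_pV2 ?posrE ?exprn_gt0.
Qed.

Let sD : subgrp D. Proof. by apply: subgrp_ballV => //; have /andP[/ltW] := cell_radius. Qed.
Let sB : subgrp B. Proof. by apply: subgrp_ballV => //; apply: le_trans grid_radius_ge1. Qed.
Let sDB x : D x -> B x. Proof. exact: ballV_le cell_le_grid. Qed.

Lemma abs_dot2_le r s x y : ballV absv r x -> ballV absv s y -> absv (dot2 x y) <= r * s.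
Proof. by move=> /ballVP[x1 x2] /ballVP[y1 y2]; apply: absD_le => //; apply: absM_le. Qed.

Lemma dot2_DB x y : D x -> B y -> absv (dot2 x y) <= 1.
Proof.
move=> Dx By; apply: le_trans (abs_dot2_le Dx By) _; rewrite divff // gt_eqF //.
by have /andP[] := cell_radius.
Qed.

Lemma dot2C (x y : K2 K) : dot2 x y = dot2 y x.
Proof. by rewrite /dot2 mulrC [X in _ + X]mulrC. Qed.

Lemma dot2D (x d y : K * K) : dot2 (x + d) y = dot2 x y + dot2 d y.
Proof. by rewrite /dot2 /= !mulrDl addrACA. Qed.

Lemma Cint_step (g : K * K -> R[i]) : periodic D g -> (forall z, ~~ B z -> g z = 0) ->
  Cint mu setT g = (v%:C)%C * \sum_(x <- X) g x.
Proof.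
move=> pg g0; rewrite /Cint.
have st := step_Rintegral na haar cell_radius cell_le_grid trX.
have pRe : periodic D (fun x => complex.Re (g x)) by move=> x d Dd; rewrite pg.
have pIm : periodic D (fun x => complex.Im (g x)) by move=> x d Dd; rewrite pg.
rewrite (st _ pRe) => [|z /g0 -> //]; rewrite (st _ pIm) => [|z /g0 -> //].
have -> : \sum_(x <- X) complex.Re (g x) = complex.Re (\sum_(x <- X) g x).
  by elim/big_rec2: _ => // y u z _ ->; rewrite ReD.
have -> : \sum_(x <- X) complex.Im (g x) = complex.Im (\sum_(x <- X) g x).
  by elim/big_rec2: _ => // y u z _ ->; rewrite ImD.
by case: (\sum_(x <- X) g x) => a b; apply/eqP; rewrite eq_complex /= !mul0r subr0 addr0 !eqxx.
Qed.

Hypothesis fD : periodic D f.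
Hypothesis fB : forall z, ~~ B z -> f z = 0.
Hypothesis f_supp : forall xi, ~ nbhd_parabola absv (p ^+ (2 * N)) xi -> fourier mu ch f xi = 0.

Local Notation fhat := (fourier mu ch f).

Lemma XB x : x \in X -> B x. Proof. by case: trX => _ + _ _; apply. Qed.

Lemma fourier_step xi : B xi -> fhat xi = (v%:C)%C * \sum_(x <- X) ch (dot2 x xi) * f x.
Proof.
move=> Bxi; apply: Cint_step => [x d Dd|z /fB ->]; last by rewrite mulr0.
by rewrite fD // dot2D (chD uc) (ch_triv uc (dot2_DB Dd Bxi)) mulr1.
Qed.

Lemma nbhd_ball xi : nbhd_parabola absv (p ^+ (2 * N)) xi -> ballV absv 1 xi.
Proof.
move=> [h1 h2]; apply/ballVP; split=> //.
have -> : xi.2 = (xi.2 - xi.1 ^+ 2) + xi.1 ^+ 2 by rewrite subrK.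
apply: absD_le => //; last by rewrite absX // exprn_ile1 // abs_ge0.
by apply: le_trans h2 (pV_le1 p2 _).
Qed.

Lemma fourier_out xi : ~~ B xi -> fhat xi = 0.
Proof.
move=> nB; apply: f_supp => /nbhd_ball /(ballV_le grid_radius_ge1).
exact/negP.
Qed.

(** The radii of [D] and [B] are inverse to each other, so [f] being supported in [B] makes its
    transform [D]-periodic. One grid therefore serves on both sides of the Fourier transform. *)
Lemma fourier_periodic : periodic D fhat.
Proof.
move=> xi d Dd; have [Bxi|nB] := boolP (B xi); last first.
  rewrite !fourier_out //; apply: contra nB => h; rewrite -(addrK d xi).
  by apply: (proj2 sB) => //; apply: sDB.
rewrite !fourier_step //; last by apply: subgrpD => //; apply: sDB.
congr (_ * _); rewrite big_seq [RHS]big_seq; apply: eq_bigr => x /XB Bx; congr (_ * _).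
apply: (ch_eq1 uc); rewrite ![dot2 x _]dot2C dot2D [X in X - _]addrC addrK.
exact: dot2_DB.
Qed.

(** This sum is the projection only for [x] in [B], where the integrand is [D]-periodic in [xi]. It
    is defined for every [x], so that equivariance can be asserted without restriction. *)
Definition fproj_step (A : set (K2 K)) x :=
  (v%:C)%C * \sum_(xi <- X) fhat xi * indic2 A xi * ch (- dot2 x xi).

Lemma fproj_stepE A x : periodic D (@indic2 R K A) -> B x -> fproj mu ch f A x = fproj_step A x.
Proof.
move=> pA Bx; apply: Cint_step => [xi d Dd|z /fourier_out ->]; last by rewrite !mul0r.
rewrite fourier_periodic // pA //; congr (_ * _); apply: (ch_eq1 uc).
have -> : - dot2 x (xi + d) - - dot2 x xi = - dot2 d x by rewrite ![dot2 x _]dot2C dot2D; ring.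
by rewrite absN // dot2_DB.
Qed.

Lemma cap_periodic l c : (l <= N)%N -> absv c <= 1 -> periodic D (@indic2 R K (cap absv c (p ^- l))).
Proof.
move=> lN c1; have imp xi d : D d -> cap absv c (p ^- l) xi -> cap absv c (p ^- l) (xi + d).
  move=> Dd [h1 h2]; have {}Dd : ballV absv (p ^- (2 * l)) d.
    by apply: ballV_le Dd; apply: le_trans cell_le_p (pV_le p2 _); rewrite leq_mul2l.
  have [d1 d2] := ballVP _ _ _ Dd.
  have pl1 := pV_le1 p2 l.
  have x1 : absv xi.1 <= 1.
    by rewrite -(subrK c xi.1); apply: absD_le => //; apply: le_trans h1 _.
  have pl2 : p ^- (2 * l) <= p ^- l by apply: (pV_le p2); rewrite leq_pmull.
  split => /=.
    by rewrite addrAC; apply: absD_le => //; apply: le_trans d1 _.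
  rewrite expVn_sqr in h2 *.
  have -> : xi.2 + d.2 - (xi.1 + d.1) ^+ 2 =
    (xi.2 - xi.1 ^+ 2) + (d.2 - 2 * (xi.1 * d.1) - d.1 * d.1) by ring.
  have d1' : absv d.1 <= 1 by apply: le_trans d1 (pV_le1 p2 _).
  apply: absD_le => //; apply: absB_le => //; last by rewrite -[leRHS]mul1r absM_le.
  by apply: absB_le => //; apply: abs2M_le => //; rewrite -[leRHS]mul1r absM_le.
move=> xi d Dd; rewrite /indic2; congr (if _ then _ else _); apply/asboolP/asboolP; last exact: imp.
by move=> h; rewrite -(addrK d xi); apply: imp => //; apply: subgrpN.
Qed.

Definition theta_proj c x := fproj_step (cap absv c (p ^- N)) x.

Local Notation capsum := (capsum absv p C N theta_proj).

Lemma cap_partition (Q : pred K) xi : (forall c c', same_cap absv p N c c' -> Q c = Q c') ->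
  \sum_(c <- C N | Q c) fhat xi * indic2 (cap absv c (p ^- N)) xi =
  if Q xi.1 then fhat xi else 0.
Proof.
move=> Qn; have [xiP|/f_supp ->] := pselect (nbhd_parabola absv (p ^+ (2 * N)) xi); last first.
  by rewrite if_same big1 // => c _; rewrite mul0r.
have [x1 x2] := xiP; have [c0 c0C xc0] := C_ex capC N x1.
rewrite (eq_bigr (fun c => if same_cap absv p N c c0 then fhat xi else 0)) => [|c _].
  rewrite -big_mkcondr /= (sum_center na p2 capC (fun=> fhat xi) Q c0C).
  by rewrite (Qn _ _ xc0).
rewrite /indic2 (_ : `[< _ >] = same_cap absv p N c c0); first by case: ifP; rewrite ?mulr1 ?mulr0.
rewrite -(same_cap_congr na c xc0) (same_cap_sym p na).
apply/asboolP/idP => [[]//|h]; split=> //.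
by rewrite expVn_sqr.
Qed.

Lemma sum_theta_proj (Q : pred K) x : (forall c c', same_cap absv p N c c' -> Q c = Q c') ->
  \sum_(c <- C N | Q c) theta_proj c x =
  (v%:C)%C * \sum_(xi <- X) (if Q xi.1 then fhat xi else 0) * ch (- dot2 x xi).
Proof.
move=> Qn; rewrite /theta_proj /fproj_step -mulr_sumr exchange_big /=; congr (_ * _).
by apply: eq_bigr => xi _; rewrite -mulr_suml cap_partition.
Qed.

(** On the support of [fhat] the vertical condition in the definition of a cap is automatic, as
    [1 / R <= p^(-2l)]; a cap there is just a condition on the first coordinate. *)
Lemma capsum_fproj l c x : (l <= N)%N -> absv c <= 1 -> B x ->
  capsum l c x = fproj mu ch f (cap absv c (p ^- l)) x.
Proof.
move=> lN c1 Bx; rewrite fproj_stepE //; last exact: cap_periodic.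
rewrite /capsum sum_theta_proj; last first.
  move=> c' c'' /(same_cap_le p2 lN) h.
  exact: (same_cap_congr na _ h).
congr (_ * _); apply: eq_bigr => xi _; congr (_ * _).
have [xiP|/f_supp ->] := pselect (nbhd_parabola absv (p ^+ (2 * N)) xi); last first.
  by rewrite if_same mul0r.
rewrite /indic2 (_ : `[< _ >] = same_cap absv p l c xi.1).
  by case: ifP; rewrite ?mulr1 ?mulr0.
rewrite (same_cap_sym p na); apply/asboolP/idP => [[]//|h]; split=> //.
have [_ h2] := xiP; apply: le_trans h2 _.
by rewrite expVn_sqr; apply: (pV_le p2); rewrite leq_mul2l.
Qed.

Lemma theta_proj_equivariant : equivariant absv p C ch N theta_proj.
Proof.
move=> c x a cC /andP[a1 a2]; rewrite /theta_proj /fproj_step [RHS]mulrCA; congr (_ * _).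
rewrite mulr_sumr; apply: eq_bigr => xi _; rewrite /indic2.
case: ifP => [/asboolP[h1 h2]|_]; last by rewrite !mulr0 !mul0r mulr0.
rewrite !mulr1 mulrCA; congr (_ * _); rewrite dot2D opprD addrC (chD uc); congr (_ * _).
apply: (ch_eq1 uc).
(* Taylor expansion of the parabola at [c]: the three terms are controlled by the width of the cap,
   its square, and the vertical thickness. *)
have -> : - dot2 a xi - - dotp a c = - ((xi.1 - c) * (a.1 + 2 * c * a.2) +
  ((xi.1 - c) * (xi.1 - c) * a.2 + (xi.2 - xi.1 ^+ 2) * a.2)) by rewrite /dot2 /dotp; ring.
have pN : p ^- N * p ^+ N = 1 by rewrite mulVf // gt_eqF // pX_gt0.
have p2N : p ^- N * p ^- N * p ^+ (2 * N) = 1.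
  by rewrite mul2n -addnn exprD mulrACA pN mulr1.
rewrite absN //; apply: absD_le => //; first by rewrite -pN absM_le.
apply: absD_le => //; rewrite -p2N; first by rewrite absM_le // absM_le.
by rewrite absM_le // -expr2.
Qed.

Lemma sum_character z : B z -> \sum_(xi <- X) ch (dot2 z xi) = if D z then (size X)%:R else 0.
Proof.
move=> Bz; have [Dz|nDz] := boolP (D z).
  rewrite big_seq (eq_bigr (fun=> 1)) => [|xi /XB Bxi]; last exact: (ch_triv uc (dot2_DB Dz Bxi)).
  by rewrite -big_seq big_const_seq count_predT iter_addr_0.
have [a [Ba cha]] : exists a, B a /\ ch (dot2 a z) != 1.
  have wL : absv (w ^- L) = absv w ^- L by rewrite absV // absX.
  have wL0 : 0 < absv w ^+ L by rewrite exprn_gt0.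
  have nt t : ~~ (absv t <= absv w ^+ L) -> exists2 a, absv a <= absv w ^- L & ch (t * a) != 1.
    rewrite -ltNge => h; have := @ch_nontriv _ _ _ _ na uc t (w ^- L); rewrite wL; apply.
    by rewrite absM // wL ltr_pdivlMr // mul1r.
  move: nDz; rewrite /ballV absV2_le negb_and => /orP[/nt|/nt] [a a_le cha].
    exists (a, 0); split; first by apply/ballVP; rewrite /= abs0 // a_le invr_ge0 ltW.
    by rewrite /dot2 /= mul0r addr0 mulrC.
  exists (0, a); split; first by apply/ballVP; rewrite /= abs0 // a_le invr_ge0 ltW.
  by rewrite /dot2 /= mul0r add0r mulrC.
apply: (sum_equivariant0 sD sB sDB trX (a := a) (c := ch (dot2 a z))) => //.
- move=> xi d Dd; apply: (ch_eq1 uc).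
  by rewrite ![dot2 z _]dot2C dot2D addrAC subrr add0r dot2_DB.
- by move=> xi; rewrite ![dot2 z _]dot2C dot2D (chD uc) mulrC.
Qed.

(** The normalization of Fourier inversion on the finite quotient: two integrals contribute [v]
    each, and a full character sum is the number of cells. *)
Lemma cell_measure_sqr : v * v * (size X)%:R = 1.
Proof.
rewrite size_grid (cell_measureE na haar L unif repsP) natrX.
have q0 : (size reps)%:R != 0 :> R by rewrite pnatr_eq0 -lt0n ltnW // (q_gt1 unif repsP).
have -> : (4 * L = 2 * L + 2 * L)%N by rewrite -mulnDl.
by rewrite exprD; field; rewrite expf_neq0.
Qed.

Lemma fourier_inversion x : B x -> \sum_(c <- C N) theta_proj c x = f x.
Proof.
move=> Bx; rewrite (sum_theta_proj (Q := predT)) //=.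
have e : \sum_(xi <- X) fhat xi * ch (- dot2 x xi) =
    (v%:C)%C * \sum_(y <- X) \sum_(xi <- X) f y * ch (dot2 (y - x) xi).
  rewrite exchange_big mulr_sumr big_seq [RHS]big_seq; apply: eq_bigr => xi /XB Bxi.
  rewrite fourier_step // -mulrA mulr_suml; congr (_ * _); apply: eq_bigr => y _ /=.
  rewrite dot2D (chD uc) mulrAC [RHS]mulrC; congr (_ * ch _ * _).
  by rewrite /dot2 /=; ring.
rewrite e (_ : \sum_(y <- X) _ = (size X)%:R * f x); last first.
  rewrite mulr_natl -(sum_cells na cell_radius trX fD Bx) -sumrMnl [RHS]big_mkcond.
  rewrite big_seq [RHS]big_seq; apply: eq_bigr => y /XB By.
  rewrite -mulr_sumr sum_character; last exact: (proj2 sB).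
  have -> : D (y - x) = D (x - y) by rewrite /ballV /absV2 /= absBC // [absv (x.2 - _)]absBC.
  by case: ifP => _; rewrite ?mulr0 // mulrC mulr_natl.
have -> : (size X)%:R = ((size X)%:R : R)%:C%C :> R[i] by rewrite rmorph_nat.
rewrite !mulrA -!(rmorphM (real_complex R)).
by rewrite cell_measure_sqr rmorph1 mul1r.
Qed.

Lemma cap_inj s c c' : 0 <= s -> cap absv c s = cap absv c' s -> absv (c - c') <= s.
Proof.
move=> s0 e; have : cap absv c s (c, c ^+ 2).
  by split; rewrite /= subrr abs0 // sqr_ge0.
by rewrite e => -[].
Qed.

Lemma cap_eq s c c' : absv (c - c') <= s -> cap absv c s = cap absv c' s.
Proof.
move=> cc; apply/seteqP; split => x [h1 h2]; split=> //.
  by rewrite -(subrK c x.1) -addrA absD_le.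
by rewrite -(subrK c' x.1) -addrA absD_le // absBC.
Qed.

Lemma cap_map_uniq l (P : pred K) : uniq [seq cap absv c (p ^- l) | c <- C l & P c].
Proof.
rewrite map_inj_in_uniq; first by apply: filter_uniq; apply: (C_uniq capC).
move=> c c'; rewrite !mem_filter => /andP[_ cC] /andP[_ c'C].
by move=> /(cap_inj (ltW (pV_gt0 p2 l))) h; apply: (C_inj capC cC c'C h).
Qed.

Lemma capsP l tau : caps absv (p ^- l) tau -> exists2 c, c \in C l & tau = cap absv c (p ^- l).
Proof.
move=> [c [cO ->]]; have c1 : absv c <= 1.
  have := cO c; rewrite /ballK /= subrr subr0 abs0 //; apply.
  exact: ltW (pV_gt0 p2 l).
by have [c' c'C cc'] := C_ex capC l c1; exists c' => //; apply: cap_eq.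
Qed.

Lemma caps_center l c : absv c <= 1 -> caps absv (p ^- l) (cap absv c (p ^- l)).
Proof.
move=> c1; exists c; split=> // x; rewrite /ballK /= subr0 => h.
by rewrite -(subrK c x) absD_le //; apply: le_trans h (pV_le1 p2 l).
Qed.

Lemma theta_projE c x : c \in C N -> B x -> theta_proj c x = fproj mu ch f (cap absv c (p ^- N)) x.
Proof. by move=> cC Bx; rewrite -capsum_fproj ?(capsumN na p2 capC) // (C_le1 capC cC). Qed.

(** The sum in [sqfun] ranges over caps as sets. Identifying its index set with a finite list
    without repetition gives it the intended value. *)
Lemma sqfun_energy l c x : (l <= N)%N -> absv c <= 1 -> B x ->
  sqfun mu ch f (p ^- N) (p ^- l) (cap absv c (p ^- l)) x =
  cap_energy absv p C N theta_proj l c x.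
Proof.
move=> lN c1 Bx; rewrite /sqfun /cap_energy.
pose s := [seq cap absv c' (p ^- N) | c' <- C N & same_cap absv p l c c'].
have pl := ltW (pV_gt0 p2 l); have pN := ltW (pV_gt0 p2 N).
have -> : [set theta | caps absv (p ^- N) theta /\
    cap_prec absv (p ^- N) (p ^- l) theta (cap absv c (p ^- l))] = [set` s].
  apply/seteqP; split => theta /=.
    move=> [/capsP[c' c'C ->] [cJ [cI [/(cap_inj pN) eJ /(cap_inj pl) eI sub]]]].
    apply/mapP; exists c' => //; rewrite mem_filter c'C andbT.
    (* The centers hidden in [cap_prec] need not be [c'] and [c]; they only lie in the same caps. *)
    have hJ : absv (cJ - cI) <= p ^- l by apply: (sub cJ); rewrite /ballK /= subrr abs0.
    apply: (same_cap_trans na eI); rewrite (same_cap_sym p na); apply: (same_cap_trans na _ hJ).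
    exact: same_cap_le eJ.
  move=> /mapP[c']; rewrite mem_filter => /andP[cc' c'C] ->.
  split; first by apply: caps_center; apply: (C_le1 capC c'C).
  exists c', c; split=> // x' h'; rewrite /ballK /=.
  rewrite (_ : x' - c = (x' - c') - (c - c')); last by ring.
  by apply: absB_le => //; apply: le_trans h' (pV_le p2 lN).
rewrite -fsbig_seq; last exact: cap_map_uniq.
rewrite /s big_map big_filter big_seq_cond [RHS]big_seq_cond; apply: eq_bigr => c' /andP[c'C _].
by rewrite normc2E theta_projE.
Qed.

Local Notation active := (active absv p C N X theta_proj).

Lemma active_ncaps m : (m <= N)%N -> (count (active m) (C m))%:R <= ncaps mu ch f (p ^- m).
Proof.
move=> mN; rewrite /ncaps.
pose act c := `[< exists x, fproj mu ch f (cap absv c (p ^- m)) x != 0 >].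
have -> : [set tau | caps absv (p ^- m) tau /\ exists x, fproj mu ch f tau x != 0] =
    [set` [seq cap absv c (p ^- m) | c <- C m & act c]].
  apply/seteqP; split => tau /=.
    move=> [/capsP[c cC ->] ex]; apply/mapP; exists c => //.
    by rewrite mem_filter cC andbT; apply/asboolP.
  move=> /mapP[c]; rewrite mem_filter => /andP[/asboolP ex cC] ->; split=> //.
  by apply: caps_center; apply: (C_le1 capC cC).
rewrite -fsbig_seq; last exact: cap_map_uniq.
rewrite big_map big_filter sum_const_count mulr1 ler_nat.
rewrite -!size_filter; apply: uniq_leq_size; first by apply: filter_uniq; apply: (C_uniq capC).
move=> c; rewrite !mem_filter => /andP[/hasP[c' c'C /andP[cc' /hasP[x xX nz]]] cC].
rewrite cC andbT; apply/asboolP; apply: contrapT => no.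
(* If the projection to the larger cap vanished, so would that to each smaller cap, by
   orthogonality. *)
case/eqP: nz; move: x xX; apply: (capsum_eq0 na uc p2 capC absP0 delta0 delta1 p_le_grid trX
  theta_proj_equivariant _ c'C cc') => x xX.
have Bx := XB xX; rewrite capsum_fproj ?(C_le1 capC cC) //.
by apply/eqP/negPn/negP => nz; apply: no; exists x.
Qed.

Local Notation tile m c := (plank absv c (p ^+ (2 * N - m)) (p ^+ (2 * N))).
Local Notation V := (g_sigma_algebraType (balls2 absv)).

Definition tile_at m c x : set V := translate x (tile0 absv c (p ^- m) (p ^+ (2 * N))).

Lemma tile_atE m c x : (m <= N)%N -> tile_at m c x = [set y | tile m c (y - x)].
Proof.
move=> mN; have e : p ^- m * p ^+ (2 * N) = p ^+ (2 * N - m).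
  have mN2 : (m <= 2 * N)%N by apply: leq_trans mN _; rewrite leq_pmull.
  by rewrite -{1}(subnKC mN2) exprD mulKf // gt_eqF // pX_gt0.
apply/seteqP; split => -[y1 y2]; rewrite /tile_at /translate /tile0 /sub2 /plank /= e.
  by move=> [-> ->].
by move=> /andP[-> ->].
Qed.

Lemma tile_shift_periodic m c x : absv c <= 1 -> periodic D (fun y => tile m c (y - x)).
Proof.
move=> c1 y d Dd; have [st Dt _] := intermediate_tile na p2 delta1 p_le_grid m c1.
have td := Dt _ Dd; rewrite addrAC; apply/idP/idP => h; last exact: subgrpD.
by rewrite -(addrK d (y - x)); apply: (proj2 st).
Qed.

Lemma tile_shift_sub m c x y : absv c <= 1 -> B x -> tile m c (y - x) -> B y.
Proof.
move=> c1 Bx; have [_ _ tB] := intermediate_tile na p2 delta1 p_le_grid m c1.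
by move=> /tB h; rewrite -(subrK x y); apply: subgrpD.
Qed.

Lemma sum_tile_shift (W : nmodType) (g : K * K -> W) m c x : absv c <= 1 -> B x -> periodic D g ->
  \sum_(y <- X | tile m c (y - x)) g y = \sum_(y <- X | tile m c y) g (x + y).
Proof.
move=> c1 Bx pg; rewrite big_mkcond [RHS]big_mkcond.
rewrite -(sum_shift sD sB sDB trX (a := x)) //=; first by apply: eq_bigr => y _; rewrite addrK addrC.
by move=> y d Dd /=; rewrite pg // (tile_shift_periodic m x c1 y Dd).
Qed.

Lemma mu_tile m c x : (m <= N)%N -> absv c <= 1 -> B x ->
  mu (tile_at m c x) = (v * (count (tile m c) X)%:R)%:E.
Proof.
move=> mN c1 Bx; rewrite tile_atE //.
rewrite (step_measure na haar cell_radius cell_le_grid trX (tile_shift_periodic m x c1)); last first.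
  by move=> y; apply: tile_shift_sub.
by rewrite -!sum1_count (sum_tile_shift (g := fun=> 1%N) m c1 Bx).
Qed.

Lemma avg_tile m c x : (m <= N)%N -> absv c <= 1 -> B x ->
  avg mu (tile_at m c x) (sqfun mu ch f (p ^- N) (p ^- m) (cap absv c (p ^- m))) =
  mean X (tile m c) (cap_energy absv p C N theta_proj m c) x.
Proof.
move=> mN c1 Bx; rewrite /avg mu_tile // tile_atE // Rintegral_mkcond.
have v0 : v != 0.
  apply/eqP => v0; have := cell_measure_sqr; rewrite v0 !mul0r => /eqP.
  by rewrite eq_sym oner_eq0.
set E := cap_energy _ _ _ _ _ _ _.
have pE : periodic D E by apply: (cap_energy_D na uc p2 capC delta1 theta_proj_equivariant).
rewrite (_ : _ \_ _ = fun y => if tile m c (y - x) then E y else 0); last first.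
  apply/funext => y; rewrite patchE; case: ifP => [|/negbT].
    rewrite inE /= => h; rewrite h.
    rewrite -[LHS]/(sqfun mu ch f (p ^- N) (p ^- m) (cap absv c (p ^- m)) y).
    by rewrite sqfun_energy //; apply: tile_shift_sub h.
  by rewrite notin_setE /= => /negP/negbTE ->.
rewrite (step_Rintegral na haar cell_radius cell_le_grid trX); first last.
- move=> y nB; case: ifP => // h; by rewrite (tile_shift_sub c1 Bx h) in nB.
- by move=> y d Dd; rewrite pE // (tile_shift_periodic m x c1 y Dd).
by rewrite -big_mkcond sum_tile_shift //= invfM mulrACA mulVf // mul1r.
Qed.

(** The sums over tiles and caps only have to be bounded from below, so finite subfamilies
    suffice. *)
Lemma esum_ge_seq (T : choiceType) (S : set T) (s : seq T) (a : T -> \bar R) : uniq s ->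
  (forall x, x \in s -> S x) -> (\sum_(x <- s) a x <= \esum_(x in S) a x)%E.
Proof.
move=> us sS; apply: esum_ge; exists [set` s]; last by rewrite fsbig_seq.
by split; [exact: finite_seq | move=> x /sS].
Qed.

Variable alpha : R.
Local Notation Rr := (p ^+ (2 * N)).
Local Notation kappa := ((expR 1) ^+ 2 / 2 * (ln Rr) ^+ 2 / (ln p) ^+ 2).
Local Notation nc := (fun m => ncaps mu ch f (p ^- m)).
Local Notation good := (good absv p C N X theta_proj alpha kappa nc).
Local Notation energy := (cap_energy absv p C N theta_proj).

Definition tile_value m c (U : set V) : R :=
  fine (mu U) * (avg mu U (sqfun mu ch f (p ^- N) (p ^- m) (cap absv c (p ^- m)))) ^+ 2.

(** Grid points are grouped by the tile through them. All points of a group lie in their tile [U],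
    so there are at most [mu(U) / v] of them, and each carries the same average. *)
Lemma good_tiles_esum m c : (m <= N)%N -> c \in C m ->
  ((v * \sum_(x <- X | good m c x) mean X (tile m c) (energy m c) x ^+ 2)%:E <=
   \esum_(U in good_tiles mu ch f p Rr (p ^- N) alpha (p ^- m) (cap absv c (p ^- m)))
     (tile_value m c U)%:E)%E.
Proof.
move=> mN cC; have c1 := C_le1 capC cC.
pose T x := tile_at m c x.
pose Y := [seq x <- X | good m c x]; pose s := undup [seq T x | x <- Y].
have YP x : x \in Y -> [/\ x \in X, B x & good m c x].
  by rewrite mem_filter => /andP[g xX]; split=> //; apply: XB.
apply: (@le_trans _ _ (\sum_(U <- s) (tile_value m c U)%:E)%E); last first.
  apply: esum_ge_seq; first exact: undup_uniq.
  move=> U; rewrite mem_undup => /mapP[x /YP[xX Bx gx] ->]; split.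
    exists c, x; split=> //; split; rewrite /= subrr abs0 ?sqr_ge0 //.
    exact: ltW (pV_gt0 p2 m).
  by rewrite avg_tile //.
rewrite sumEFin lee_fin mulr_sumr -big_filter -/Y.
have part (F : K * K -> R) : \sum_(x <- Y) F x = \sum_(U <- s) \sum_(x <- Y | T x == U) F x.
  rewrite (exchange_big_dep predT) //= big_seq [RHS]big_seq; apply: eq_bigr => x xY.
  have Ts : T x \in s by rewrite mem_undup map_f.
  rewrite -big_filter (_ : [seq U <- s | T x == U] = [:: T x]) ?big_seq1 //.
  rewrite (eq_filter (a2 := pred1 (T x))) => [|U]; last by rewrite /= eq_sym.
  by rewrite filter_pred1_uniq // undup_uniq.
rewrite part big_seq [leRHS]big_seq; apply: ler_sum => U.
rewrite mem_undup => /mapP[x0 x0Y eU]; have [x0X Bx0 gx0] := YP _ x0Y.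
rewrite /tile_value eU mu_tile //= avg_tile //.
rewrite (big_seq_cond (fun x => T x == _)).
rewrite (eq_bigr (fun=> v * mean X (tile m c) (energy m c) x0 ^+ 2)) => [|x /andP[/YP[xX Bx _] /eqP eT]].
  rewrite -big_seq_cond sum_const_count mulrCA mulrA ler_wpM2r ?sqr_ge0 //.
  have v0 : 0 <= v by apply: fine_ge0.
  rewrite ler_wpM2l // ler_nat -[leqRHS](_ : count (fun y => tile m c (y - x0)) X = _).
    rewrite count_filter; apply: sub_count => x /andP[/eqP eT _] /=.
    have : T x x by rewrite /T tile_atE //= subrr; case: (intermediate_tile na p2 delta1 p_le_grid m c1) => -[].
    by rewrite eT /T tile_atE.
  by rewrite -!sum1_count (sum_tile_shift (g := fun=> 1%N) m c1 Bx0).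
by congr (_ * _ ^+ 2); rewrite -!avg_tile // -/(T x) eT.
Qed.

Lemma good_wave_esum m : (m <= N)%N ->
  ((v * good_wave absv p C N X theta_proj alpha kappa nc m)%:E <=
   \esum_(tau in caps absv (p ^- m))
     \esum_(U in good_tiles mu ch f p Rr (p ^- N) alpha (p ^- m) tau)
       (fine (mu U) * (avg mu U (sqfun mu ch f (p ^- N) (p ^- m) tau)) ^+ 2)%:E)%E.
Proof.
move=> mN.
apply: (@le_trans _ _ (\sum_(tau <- [seq cap absv c (p ^- m) | c <- C m & true])
  \esum_(U in good_tiles mu ch f p Rr (p ^- N) alpha (p ^- m) tau)
     (fine (mu U) * (avg mu U (sqfun mu ch f (p ^- N) (p ^- m) tau)) ^+ 2)%:E)%E); last first.
  apply: esum_ge_seq; first exact: cap_map_uniq.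
  move=> tau /mapP[c]; rewrite mem_filter /= => cC ->.
  by apply: caps_center; apply: (C_le1 capC cC).
rewrite big_map big_filter /good_wave mulr_sumr -sumEFin big_seq [leRHS]big_seq.
by apply: lee_sum => c cC; apply: good_tiles_esum.
Qed.

End Fourier.

(** * Numerical bounds for exponential and logarithm *)

Section Numerics.
Variable R : realType.

Lemma le_sqr_trans (a b c : R) : 0 <= a -> c <= a ^+ 2 -> a <= b -> c <= b ^+ 2.
Proof. by move=> a0 ca ab; apply: le_trans ca _; rewrite lerXn2r ?nnegrE // (le_trans a0). Qed.

Lemma sqr_le_trans (a b c : R) : 0 <= b -> b <= a -> a ^+ 2 <= c -> b ^+ 2 <= c.
Proof. by move=> b0 ba; apply: le_trans; rewrite lerXn2r ?nnegrE // (le_trans b0). Qed.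

Lemma expR1_sqr_ge7 : 7 <= expR 1 ^+ 2 :> R.
Proof.
have h0 : 33 / 32 <= expR (1 / 32) :> R by apply: le_trans (expR_ge1Dx _); lra.
have -> : expR 1 ^+ 2 = ((((expR (1 / 32) ^+ 2) ^+ 2) ^+ 2) ^+ 2 ^+ 2) ^+ 2 :> R.
  by rewrite -!exprM -!expRM_natl; congr expR; field.
(* Rational lower approximations of successive square roots of 7, down to the linear bound at
   [1 / 32]. *)
apply: (@le_sqr_trans (265 / 100)); [lra | lra |].
apply: (@le_sqr_trans (1635 / 1000)); [lra | lra |].
apply: (@le_sqr_trans (12787 / 10000)); [lra | lra |].
apply: (@le_sqr_trans (11308 / 10000)); [lra | lra |].
apply: (@le_sqr_trans (10634 / 10000)); [lra | lra |].
apply: (@le_sqr_trans (33 / 32)) h0; lra.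
Qed.

Lemma expR1_le3 : expR 1 <= 3 :> R.
Proof.
have h0 : expR (1 / 8) <= 8 / 7 :> R.
  have h : 7 / 8 <= expR (- (1 / 8)) :> R by apply: le_trans (expR_ge1Dx _); lra.
  have := expR_gt0 (1 / 8 : R); have := expRxMexpNx_1 (1 / 8 : R); nra.
have -> : expR 1 = ((expR (1 / 8) ^+ 2) ^+ 2) ^+ 2 :> R.
  by rewrite -!exprM -!expRM_natl; congr expR; field.
apply: (@sqr_le_trans (173 / 100)); [exact: sqr_ge0 | | lra].
apply: (@sqr_le_trans (131 / 100)); [exact: sqr_ge0 | | lra].
apply: (@sqr_le_trans (8 / 7)); [exact: expR_ge0 | exact: h0 | lra].
Qed.

Lemma ln2_ge : 84 / 125 <= ln 2 :> R.
Proof.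
rewrite -[leLHS]expRK ler_ln ?posrE ?expR_gt0 //.
have h : 479 / 500 <= expR (- (21 / 500)) :> R by apply: le_trans (expR_ge1Dx _); lra.
have h16 : 1 / 2 <= expR (- (84 / 125)) :> R.
  have -> : expR (- (84 / 125)) = (((expR (- (21 / 500)) ^+ 2) ^+ 2) ^+ 2) ^+ 2 :> R.
    by rewrite -!exprM -!expRM_natl; congr expR; lra.
  apply: (@le_sqr_trans (29 / 41)); [lra | lra |].
  apply: (@le_sqr_trans (53 / 63)); [lra | lra |].
  apply: (@le_sqr_trans (89 / 97)); [lra | lra |].
  apply: (@le_sqr_trans (479 / 500)) h; lra.
have := expRxMexpNx_1 (84 / 125 : R); have := expR_gt0 (84 / 125 : R).
by move: (expR (84 / 125)) (expR (- (84 / 125))) h16 => a b; nra.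
Qed.

Lemma compound_le3 n : (0 < n)%N -> (1 + n%:R^-1) ^+ n <= 3 :> R.
Proof.
move=> n0; apply: le_trans expR1_le3; have nn : n%:R != 0 :> R by rewrite pnatr_eq0 -lt0n.
have -> : expR 1 = expR (n%:R^-1) ^+ n :> R by rewrite -expRM_natl divff.
by rewrite lerXn2r ?nnegrE ?expR_ge0 ?addr_ge0 ?invr_ge0 // expR_ge1Dx.
Qed.

(** With [ln R = 2 N ln p] and [ln p >= ln 2], this amounts to [245 <= 13 * 2^10 * (ln 2)^10]. *)
Lemma final_constant (p : R) (N : nat) : 2 <= p ->
  245 * N%:R ^+ 10 * p ^+ 12 <= 13 * p ^+ 12 * (ln (p ^+ (2 * N))) ^+ 10.
Proof.
move=> p2; have p0 : 0 < p by lra.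
have lnp : 84 / 125 <= ln p by apply: le_trans ln2_ge _; rewrite ler_ln ?posrE.
rewrite lnXn // -[_ *+ (2 * N)]mulr_natl natrM !exprMn.
have h : 59 / 3200 <= ln p ^+ 10.
  have h2 : 9 / 20 <= ln p ^+ 2 by apply: (@le_sqr_trans (84 / 125)) lnp; lra.
  have h8 : 41 / 1000 <= ((ln p ^+ 2) ^+ 2) ^+ 2.
    apply: (@le_sqr_trans (81 / 400)); [lra | lra |].
    by apply: (@le_sqr_trans (9 / 20)) h2; lra.
  rewrite (_ : ln p ^+ 10 = ((ln p ^+ 2) ^+ 2) ^+ 2 * ln p ^+ 2); last by ring.
  by apply: (@le_trans _ _ (41 / 1000 * (9 / 20))); [lra | apply: ler_pM h8 h2; lra].
have c : 245 <= 13 * (2 * 2 * 2 * 2 * 2 * (2 * 2 * 2 * 2 * 2)) * (59 / 3200) :> R by lra.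
have nn : 0 <= N%:R ^+ 10 * p ^+ 12 by rewrite mulr_ge0 ?exprn_ge0 // ltW.
rewrite (_ : 13 * _ * _ =
  13 * (2 * 2 * 2 * 2 * 2 * (2 * 2 * 2 * 2 * 2)) * ln p ^+ 10 * (N%:R ^+ 10 * p ^+ 12)); last by ring.
rewrite -[leLHS]mulrA; apply: (ler_wpM2r nn); move: (ln p ^+ 10) c h => ?; lra.
Qed.

(** Since [ln R / ln p = 2 N], the constant is [2 * exp(2) * N^2], and [exp(2) >= 7]. *)
Lemma kappa_constant (p : R) (N : nat) : 2 <= p ->
  14 * N%:R ^+ 2 <= expR 1 ^+ 2 / 2 * ln (p ^+ (2 * N)) ^+ 2 / ln p ^+ 2.
Proof.
move=> p2; have p0 : 0 < p by lra.
have lnp : 0 < ln p by rewrite ln_gt0; lra.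
rewrite lnXn // -[_ *+ (2 * N)]mulr_natl natrM.
rewrite (_ : _ / _ = expR 1 ^+ 2 * (2 * N%:R ^+ 2)); last by field; rewrite gt_eqF.
have := expR1_sqr_ge7; have : 0 <= N%:R ^+ 2 :> R by apply: sqr_ge0.
nra.
Qed.

End Numerics.

Lemma eventually_exprn_le (R : realType) (a r : R) : 0 < a < 1 -> 0 < r ->
  exists n0, forall n, (n0 <= n)%N -> a ^+ n <= r.
Proof.
move=> /andP[a0 a1] r0.
have : a ^+ n @[n --> \oo] --> (0 : R^o) by apply: cvg_expr; rewrite ger0_norm // ltW.
move/cvgr0_norm_le => /(_ _ r0) [n0 _ h]; exists n0 => n nn.
by have := h n nn; rewrite /= ger0_norm // exprn_ge0 // ltW.
Qed.

Lemma schwartz_bruhat_step (R : realType) (K : fieldType) (absv : K -> R) (w : K)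
    (f : K2 K -> R[i]) (M : nat) :
  ultrametric_abs absv -> 0 < absv w < 1 -> schwartz_bruhat absv f ->
  exists L, [/\ (M <= L)%N, periodic (ballV absv (absv w ^+ L)) f &
    forall z, ~~ ballV absv (absv w ^- L) z -> f z = 0].
Proof.
move=> na w01 [l [l0 fE]]; have /andP[w0 _] := w01.
suff [n0 h] : exists n0, forall L t, (n0 <= L)%N -> t \in l ->
    [/\ absv w ^+ L <= t.2, t.2 <= absv w ^- L & ballV absv (absv w ^- L) t.1.2].
  exists (maxn M n0); have Ln : (n0 <= maxn M n0)%N by rewrite leq_maxr.
  set L := maxn M n0 in Ln *; split; first by rewrite leq_maxl.
    move=> x d Dd; rewrite !fE big_seq [RHS]big_seq; apply: eq_bigr => t tl.
    have [t1 _ _] := h L t Ln tl; congr (_ * _).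
    rewrite /indic2; congr (if _ then _ else _).
    have {}Dd := ballV_le t1 Dd; have [_ sB] := subgrp_ballV na (ltW (l0 _ tl)).
    have st : subgrp (ballV absv t.2) by apply: subgrp_ballV (ltW (l0 _ tl)).
    rewrite -[ball2 _ _ _ (x + d)]/(is_true (ballV absv t.2 ((x + d) - t.1.2))).
    rewrite -[ball2 _ _ _ x]/(is_true (ballV absv t.2 (x - t.1.2))) addrAC.
    apply/asboolP/asboolP => hx; last exact: subgrpD.
    by rewrite -(addrK d (x - t.1.2)); apply: sB.
  move=> z nB; rewrite fE big_seq big1 // => t tl; have [_ t2 tc] := h L t Ln tl.
  rewrite /indic2; case: asboolP => [zt|]; last by rewrite mulr0.
  case/negP: nB; rewrite -(subrK t.1.2 z); apply: subgrpD tc.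
    by apply: subgrp_ballV => //; rewrite invr_ge0 exprn_ge0 // ltW.
  exact: ballV_le t2 zt.
elim: l l0 {fE} => [|t l IH] l0; first by exists 0%N.
have [n1 h1] : exists n0, forall L t, (n0 <= L)%N -> t \in l ->
    [/\ absv w ^+ L <= t.2, t.2 <= absv w ^- L & ballV absv (absv w ^- L) t.1.2].
  by apply: IH => t' t'l; apply: l0; rewrite inE t'l orbT.
have t0 : 0 < t.2 by apply: l0; rewrite mem_head.
(* A single bound for both the radius and the center of the ball. *)
pose b := t.2 + absv t.1.2.1 + absv t.1.2.2.
have a1 := abs_ge0 na t.1.2.1; have a2 := abs_ge0 na t.1.2.2.
have b0 : 0 < b by rewrite /b; lra.
have [n2 h2] := eventually_exprn_le w01 t0.
have bV : 0 < b^-1 by rewrite invr_gt0.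
have [n3 h3] := eventually_exprn_le w01 bV.
exists (maxn n1 (maxn n2 n3)) => L t'; rewrite !geq_max => /and3P[L1 L2 L3].
rewrite inE => /orP[/eqP ->|]; last exact: h1.
have bL : b <= absv w ^- L by rewrite -(invrK b) lef_pV2 ?posrE ?exprn_gt0 // h3.
split; [exact: h2 | by move: bL; rewrite /b; lra |].
by apply/ballVP; move: bL; rewrite /b => bL; split; lra.
Qed.

(** * From the grid to the measure inequality *)

Section Conclusion.
Variables (R : realType) (K : fieldType) (absv : K -> R) (w : K) (reps : seq K).
Variables (eta N L : nat) (mu : {measure set (g_sigma_algebraType (balls2 absv)) -> \bar R}).
Variables (ch : K -> R[i]) (f : K2 K -> R[i]).
Hypothesis na : ultrametric_abs absv.
Hypothesis unif : is_uniformizer absv w.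
Hypothesis repsP : [/\ forall r, r \in reps -> absv r <= 1,
  forall i j, (i < size reps)%N -> (j < size reps)%N -> i != j ->
    1 <= absv (nth 0 reps i - nth 0 reps j),
  forall x, absv x <= 1 -> exists2 r, r \in reps & absv (x - r) < 1 &
  absv w = ((size reps)%:R)^-1].
Hypothesis haar : haar_normalized mu.
Hypothesis uc : unitary_character absv ch.
Hypotheses (eta0 : (0 < eta)%N) (N0 : (0 < N)%N) (etaL : (eta * (2 * N) <= L)%N).
Hypotheses (char2 : (2%:R : K) != 0) (abs2p : (absv 2%:R)^-1 <= (absv w)^-1 ^+ eta).
Hypothesis fD : periodic (ballV absv (absv w ^+ L)) f.
Hypothesis fB : forall z, ~~ ballV absv (absv w ^- L) z -> f z = 0.
Hypothesis f_supp : forall xi,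
  ~ nbhd_parabola absv ((absv w)^-1 ^+ eta ^+ (2 * N)) xi -> fourier mu ch f xi = 0.
Variable alpha : R.
Hypothesis alpha0 : 0 < alpha.

Local Notation p := ((absv w)^-1 ^+ eta).
Local Notation Rr := (p ^+ (2 * N)).
Local Notation kappa := ((expR 1) ^+ 2 / 2 * (ln Rr) ^+ 2 / (ln p) ^+ 2).
Local Notation X := (grid w reps L).
Local Notation C := (centers w reps eta).
Local Notation F := (theta_proj w reps eta N L mu ch f).
Local Notation v := (cell_measure mu (absv w ^+ L)).
Local Notation nc := (fun m => ncaps mu ch f (p ^- m)).
Local Notation level := (fun x => alpha < normc (f x)).

Let p2 : 2 <= p := p_ge2 unif repsP eta0.
Let capC : cap_centers absv p C := centers_cap_centers na unif repsP eta.
Let trX := grid_coset_reps na unif repsP L.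

Lemma level_set_measure : mu [set x | level x] = (v * (count level X)%:R)%:E.
Proof.
apply: (step_measure na haar (cell_radius L unif) (cell_le_grid L unif) trX).
  by move=> x d Dd; rewrite fD.
move=> z; apply: contraTT => /fB ->.
by rewrite -leNgt /normc /= expr0n /= addr0 sqrtr0 ltW.
Qed.

(** The thresholds divide by the number of caps, so it must be positive: a point where [f] is
    nonzero makes some smallest cap nonzero, and with it a cap of every scale active. *)
Lemma ncaps_gt0 m : (m <= N)%N -> has level X -> 0 < nc m.
Proof.
move=> mN /hasP[x xX lx]; apply: lt_le_trans (active_ncaps na unif repsP haar uc eta0 etaL fD fB f_supp mN).
have Bx : ballV absv (absv w ^- L) x by case: trX => _ + _ _; apply.
have fx : f x != 0.
  by apply: contraTneq lx => ->; rewrite -leNgt /normc /= expr0n /= addr0 sqrtr0 ltW.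
have /hasP[c cC Fc] : has (fun c => F c x != 0) (C N).
  apply: contraNT fx => /hasPn h.
  rewrite -(fourier_inversion na unif repsP haar uc eta0 fD fB f_supp Bx) big_seq big1 // => c /h.
  by rewrite negbK => /eqP.
have [c' c'C cc'] := C_ex capC m (C_le1 capC cC).
rewrite ltr0n -has_count; apply/hasP; exists c' => //; apply/hasP; exists c => //.
apply/andP; split; last by apply/hasP; exists x.
by rewrite (same_cap_sym p na).
Qed.

Lemma level_set_count : has level X ->
  alpha ^+ 4 * (count level X)%:R <=
  13 * p ^+ 12 * ln Rr ^+ 10 * \sum_(0 <= m < N.+1) good_wave absv p C N X F alpha kappa nc m.
Proof.
move=> hasX.
have /andP[d0 d1] := cell_radius L unif.
have absP0 : absv (w^-1 ^+ eta) = p by rewrite absX // absV.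
have a2 : 0 < absv 2 by rewrite abs_gt0.
have abs2p' : 1 <= p * absv 2 by rewrite -ler_pdivrMr // mul1r.
have M1 : 1 <= p ^+ 2 / 2.
  by move: p2; set P := p => P2; rewrite expr2; nra.
have [e01 cb1 cb2] := broad_constant p2 N0.
have e3 : (1 + (4 * N%:R)^-1) ^+ (4 * N) <= 3 :> R.
  by rewrite -natrM; apply: compound_le3; rewrite muln_gt0.
have countM l c : c \in C l -> (count (fun c' => absv (c - c') < p ^+ 2 / p ^+ l) (C l))%:R <= p ^+ 2 / 2.
  by move=> _; apply: (centers_count_far na unif repsP eta0).
have := level_set_bound na uc p2 capC absP0 abs2p' M1 countM
  (centers_count_close na unif repsP eta0) (ltW d0) d1 (p_le_grid unif etaL) trX
  (theta_proj_equivariant (N := N) L mu f na unif repsP uc eta0) alpha0 N0 (kappa_constant N p2)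
  (fun m mN => ncaps_gt0 mN hasX)
  (fun m mN => active_ncaps na unif repsP haar uc eta0 etaL fD fB f_supp mN) e01 e3 cb1 cb2.
rewrite (_ : count _ X = count level X); last first.
  apply: eq_in_count => x xX /=; rewrite /total.
  by rewrite (fourier_inversion na unif repsP haar uc eta0 fD fB f_supp) //; case: trX => _ + _ _; apply.
move/le_trans; apply; apply: ler_wpM2r; last first.
  by apply: le_trans (total_constant p2 N0) (final_constant N p2).
by apply: sumr_ge0 => m _; apply: sumr_ge0 => c _; apply: sumr_ge0 => x _; apply: sqr_ge0.
Qed.

Lemma wave_envelope_estimate :
  ((alpha ^+ 4)%:E * mu [set x | level x] <=
   (13 * p ^+ 12 * (ln Rr) ^+ 10)%:E *
   \sum_(0 <= k < N.+1)
     \esum_(tau in caps absv (p ^- k))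
       \esum_(U in good_tiles mu ch f p Rr (p ^- N) alpha (p ^- k) tau)
         (fine (mu U) * (avg mu U (sqfun mu ch f (p ^- N) (p ^- k) tau)) ^+ 2)%:E)%E.
Proof.
have p0 : 0 < p by move: p2; lra.
have ln0 : 0 <= ln Rr by rewrite ln_ge0 // exprn_ege1 //; move: p2; lra.
have cst0 : 0 <= 13 * p ^+ 12 * ln Rr ^+ 10.
  by apply: mulr_ge0; [apply: mulr_ge0 => //; apply: exprn_ge0; apply: ltW | apply: exprn_ge0].
(* If no grid point lies in the level set, its measure is zero and the right-hand side only has to
   be nonnegative. *)
rewrite level_set_measure; have [hasX|] := boolP (has level X); last first.
  rewrite has_count -leqNgt leqn0 => /eqP ->; rewrite mulr0 mule0 mule_ge0 ?lee_fin //.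
  apply: sume_ge0 => k _; apply: esum_ge0 => tau _; apply: esum_ge0 => U _.
  by rewrite lee_fin mulr_ge0 ?sqr_ge0 // fine_ge0.
have v0 : 0 <= v by apply: fine_ge0.
apply: (@le_trans _ _ ((13 * p ^+ 12 * ln Rr ^+ 10)%:E *
  \sum_(0 <= m < N.+1) (v * good_wave absv p C N X F alpha kappa nc m)%:E)%E).
  rewrite sumEFin -!EFinM lee_fin -mulr_sumr mulrCA [leRHS]mulrCA.
  by apply: ler_wpM2l => //; apply: level_set_count.
apply: lee_wpmul2l; first by rewrite lee_fin.
rewrite big_nat [leRHS]big_nat; apply: lee_sum => m mN.
exact: (good_wave_esum na unif repsP haar uc eta0 etaL fD fB f_supp).
Qed.

End Conclusion.

Theorem mainTheorem2 (R : realType) (K : fieldType) (absv : K -> R) (w : K)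
  (eta N : nat)
  (mu : {measure set (g_sigma_algebraType (balls2 absv)) -> \bar R})
  (ch : K -> R[i]) (f : K2 K -> R[i]) :
  nonarch_local_field absv w ->
  (2%:R : K) != 0 ->
  haar_normalized mu ->
  std_character absv w ch ->
  (* eta is the least positive integer with |w|^-eta >= |2|^-1 *)
  (0 < eta)%N ->
  (absv 2%:R)^-1 <= (absv w)^-1 ^+ eta ->
  (forall k : nat, (0 < k < eta)%N -> (absv w)^-1 ^+ k < (absv 2%:R)^-1) ->
  (* R = p^(2N) with N a positive integer *)
  (0 < N)%N ->
  schwartz_bruhat absv f ->
  (forall xi, ~ nbhd_parabola absv ((absv w)^-1 ^+ eta ^+ (2 * N)) xi ->
     fourier mu ch f xi = 0) ->
  forall alpha : R, 0 < alpha ->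
  let p := (absv w)^-1 ^+ eta in
  let Rr := p ^+ (2 * N) in
  ((alpha ^+ 4)%:E * mu [set x | (alpha < ComplexField.Normc.normc (f x))%R] <=
   (13 * p ^+ 12 * (ln Rr) ^+ 10)%:E *
   \sum_(0 <= k < N.+1)
     \esum_(tau in caps absv (p ^- k))
       \esum_(U in good_tiles mu ch f p Rr (p ^- N) alpha (p ^- k) tau)
         (fine (mu U) * (avg mu U (sqfun mu ch f (p ^- N) (p ^- k) tau)) ^+ 2)%:E)%E.
Proof.
move=> [na unif _ [reps repsP] _] char2 haar chS eta0 abs2p _ N0 fS f_supp alpha alpha0.
have w01 : 0 < absv w < 1 by case: unif.
(* [L] is large enough both for the balls defining [f] and for the resolution [1 / R]. *)
have [L [etaL fD fB]] := schwartz_bruhat_step (eta * (2 * N)) na w01 fS.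
exact: (wave_envelope_estimate na unif repsP haar (std_character_unitary na unif chS)
  eta0 N0 etaL char2 abs2p fD fB f_supp alpha0).
Qed.
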